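(* Let $0<p<1$, let $\varphi=(\varphi_k)_{k\in\mathbb Z}$ be a sequence of complex numbers and let $\tilde\varphi_{r,c}=\varphi_{r-c}$ for $(r,c)\in\mathbb Z\times\mathbb Z$. The following are equivalent: (i) the Fourier multiplier $\varphi$ is contractive on $\mathrm L^p$; (ii) the Fourier multiplier $\varphi$ is contractive on $\mathrm L^p(\mathrm S^p)$; (iii) the Schur multiplier $\tilde\varphi$ is contractive on $\mathrm S^p$; (iv) the Schur multiplier $\tilde\varphi$ is contractive on $\mathrm S^p(\mathrm S^p)$; (v) the sequence $\varphi$ is the Fourier transform of an atomic measure of the form $\sum a_g\delta_g$ on the unit circle $\mathbb T$ with $\sum|a_g|^p\le1$.
   Context: $\mathrm L^p$ is the completion of the trigonometric polynomials on $\mathbb T$ (normalised Haar measure $m$) for the quantity $\int|f|^p\,dm$, and $\mathrm L^p(\mathrm S^p)$ is the space of $\mathrm S^p$-valued functions on $\mathbb T$ with the quantity $\int\operatorname{tr}|f(z)|^p\,dm(z)$. $\mathrm S^p$ is the space of compact operators $x$ on $\ell^2_{\mathbb Z}$ (or on $\ell^2$) with $\operatorname{tr}|x|^p<\infty$; $\mathrm S^p(\mathrm S^p)$ is the analogous space for $\ell^2\otimes\ell^2_{\mathbb Z}$ and $\operatorname{tr}\otimes\operatorname{tr}$, its elements being seen as matrices indexed by $\mathbb Z\times\mathbb Z$ with entries in $\mathrm S^p$. The F-norm is the power $1/(1+p)$ of these quantities. The Fourier multiplier $\varphi$ maps $\sum x_kz^k$ to $\sum\varphi_kx_kz^k$ (with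 $x_k\in\mathbb C$ or $x_k\in\mathrm S^p$, finite sums); the Schur multiplier $\tilde\varphi$ maps $(x_{r,c})$ to $(\tilde\varphi_{r,c}x_{r,c})$ (with $x_{r,c}\in\mathbb C$ or $\mathrm S^p$, finitely many nonzero). A multiplier $T$ is contractive if $\|Tx\|\le\|x\|$ for all such $x$. *)

(* Defs.v *)
From mathcomp Require Import all_boot all_order all_algebra.
From mathcomp Require Import all_classical all_reals all_analysis.
From mathcomp Require Import complex.

Set Implicit Arguments.
Unset Strict Implicit.
Unset Printing Implicit Defensive.

Import Order.TTheory GRing.Theory Num.Theory.
Import numFieldNormedType.Exports.

Local Open Scope classical_set_scope.
Local Open Scope ring_scope.
Local Open Scope complex_scope.

Section Sums.
Variables (R : realType) (I : choiceType).

(* Unconditional sums over I of summable families; junk values if the family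
   is not absolutely summable. *)
Definition rsum (f : I -> R) : R :=
  fine (\esum_(i in [set: I]) (Num.max (f i) 0)%:E) -
  fine (\esum_(i in [set: I]) (Num.max (- f i) 0)%:E).

Definition csum (f : I -> R[i]) : R[i] :=
  rsum (fun i => complex.Re (f i)) +i* rsum (fun i => complex.Im (f i)).

End Sums.

Definition cabs (R : realType) (z : R[i]) : R := complex.Re `|z|.

Section Operators.
Variables (R : realType) (I : choiceType).

(* An operator on l^2(I) is represented by its matrix in the canonical basis:
   a i j is the coefficient in row i and column j. *)
Definition opmat := I -> I -> R[i].

Definition sqnorm (v : I -> R[i]) : \bar R :=
  \esum_(i in [set: I]) (cabs (v i) ^+ 2)%:E.

Definition opapp (a : opmat) (v : I -> R[i]) : I -> R[i] :=
  fun i => csum (fun j => a i j * v j).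

Definition opmul (a b : opmat) : opmat :=
  fun i j => csum (fun k => a i k * b k j).

Definition opadj (a : opmat) : opmat := fun i j => (a j i)^*.

Definition op1 : opmat := fun i j => (i == j)%:R.

Definition unitary_op (u : opmat) : Prop :=
  opmul (opadj u) u = op1 /\ opmul u (opadj u) = op1.

(* The rows of a are in l^2(I), so that opapp a v is a family of absolutely
   convergent sums for every v in l^2(I), and a maps every sequence of the unit
   ball to a sequence that has a norm convergent subsequence. *)
Definition compact_op (a : opmat) : Prop :=
  (forall i, (sqnorm (a i) < +oo)%E) /\
  forall v : nat -> I -> R[i], (forall n, (sqnorm (v n) <= 1)%E) ->
    exists (s : nat -> nat) (w : I -> R[i]),
      [/\ {homo s : m n / (m < n)%N}, (sqnorm w < +oo)%E &
          (fun n => sqnorm (fun i => opapp a (v (s n)) i - w i)) @ \oo --> 0%E].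

(* b = f(a): the columns of u form an orthonormal basis of l^2(I) of
   eigenvectors of a with real eigenvalues l, and b is diagonal in this basis
   with eigenvalues f(l). *)
Definition is_fcalc (f : R -> R) (a b : opmat) : Prop :=
  exists (u : opmat) (l : I -> R),
    [/\ unitary_op u,
        opmul a u = (fun i j => u i j * (l j)%:C) &
        b = opmul (fun i j => u i j * (f (l j))%:C) (opadj u)].

Definition fcalc (f : R -> R) (a : opmat) : opmat :=
  xget (fun _ _ => 0) [set b | is_fcalc f a b].

Definition opabs (a : opmat) : opmat := fcalc Num.sqrt (opmul (opadj a) a).

(* Trace of a positive operator. *)
Definition optr (a : opmat) : \bar R :=
  \esum_(i in [set: I]) (complex.Re (a i i))%:E.

(* tr |a|^p *)
Definition trpow (p : R) (a : opmat) : \bar R :=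
  optr (fcalc (fun t => t `^ p) (opabs a)).

Definition schatten (p : R) (a : opmat) : Prop :=
  compact_op a /\ (trpow p a < +oo)%E.

End Operators.

Definition finsupp_fun (K : Type) (V : zmodType) (x : K -> V) : Prop :=
  finite_set [set k | x k != 0].

Section Multipliers.
Variable R : realType.
Implicit Types (p : R) (phi : int -> R[i]).

Definition haar_int (F : R[i] -> \bar R) : \bar R :=
  (\int[@lebesgue_measure R]_(t in `[0%R, 1%R])
     F (cos (2 * pi * t) +i* sin (2 * pi * t)))%E.

Definition Fnorm p (q : \bar R) : \bar R := (q `^ (1 + p)^-1)%E.

Definition trigpoly (x : int -> R[i]) (z : R[i]) : R[i] :=
  \sum_(k \in [set: int]) x k * z ^ k.

Definition trigpoly_op (x : int -> opmat R nat) (z : R[i]) : opmat R nat :=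
  fun i j => trigpoly (fun k => x k i j) z.

Definition Lp_norm p (x : int -> R[i]) : \bar R :=
  Fnorm p (haar_int (fun z => (cabs (trigpoly x z) `^ p)%:E)).

Definition LpSp_norm p (x : int -> opmat R nat) : \bar R :=
  Fnorm p (haar_int (fun z => trpow p (trigpoly_op x z))).

Definition Sp_norm p (x : opmat R int) : \bar R := Fnorm p (trpow p x).

(* The operator on l^2 (x) l^2_Z = l^2(nat * int) with block matrix x. *)
Definition block_op (x : int -> int -> opmat R nat) : opmat R (nat * int)%type :=
  fun a b => x a.2 b.2 a.1 b.1.

Definition SpSp_norm p (x : int -> int -> opmat R nat) : \bar R :=
  Fnorm p (trpow p (block_op x)).

Definition fourier_contractive_Lp p phi : Prop :=
  forall x : int -> R[i], finsupp_fun x ->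
    (Lp_norm p (fun k => phi k * x k)%R <= Lp_norm p x)%E.

Definition fourier_contractive_LpSp p phi : Prop :=
  forall x : int -> opmat R nat, finsupp_fun x -> (forall k, schatten p (x k)) ->
    (LpSp_norm p (fun k i j => phi k * x k i j)%R <= LpSp_norm p x)%E.

Definition schur_contractive_Sp p (psi : int -> int -> R[i]) : Prop :=
  forall x : opmat R int, finsupp_fun (fun rc => x rc.1 rc.2) ->
    (Sp_norm p (fun r c => psi r c * x r c)%R <= Sp_norm p x)%E.

Definition schur_contractive_SpSp p (psi : int -> int -> R[i]) : Prop :=
  forall x : int -> int -> opmat R nat, finsupp_fun (fun rc => x rc.1 rc.2) ->
    (forall r c, schatten p (x r c)) ->
    (SpSp_norm p (fun r c i j => psi r c * x r c i j)%R <= SpSp_norm p x)%E.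

Definition circle : Type := {z : R[i] | `|z| == 1}.

(* k-th Fourier coefficient of the atomic measure \sum_g a_g \delta_g *)
Definition fourier_atomic (a : circle -> R[i]) (k : int) : R[i] :=
  csum (fun g : circle => a g * sval g ^ (- k)).

Definition atomic_fourier_transform p phi : Prop :=
  exists a : circle -> R[i],
    (\esum_(g in [set: circle]) (cabs (a g) `^ p)%:E <= 1)%E /\
    forall k, phi k = fourier_atomic a k.

End Multipliers.

(* Main.v *)
(* Since p < 1, the quantities |.|^p and tr |.|^p are subadditive, and a
   character k |-> g^(-k) acts as a rotation of the circle, respectively as a
   conjugation by a diagonal unitary; hence a p-summable combination of
   characters is contractive in the four settings.

   Conversely, a contraction on Schur multipliers yields one on L^p because
   truncated Toeplitz matrices are close to circulant matrices, whose singular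
   values are the values of the symbol at roots of unity. If phi is contractive
   on L^p, test it on a normalised power of the Dirichlet kernel of length N: by
   sampling at N translated roots of unity one gets measures with N atoms whose
   Fourier coefficients tend to those of phi and whose atoms have bounded
   p-sum. Because p < 1 the masses, in decreasing order, have uniformly small
   tails, so that a limit of these measures is still atomic. Finally, testing on
   (1 + z)^n separates the atoms and shows that their p-sum is at most 1. *)

Require Import Defs.
From mathcomp Require Import all_boot all_order all_algebra.
From mathcomp Require Import all_classical all_reals all_analysis.
From mathcomp Require Import complex.
From mathcomp Require Import ring lra zify.

Set Implicit Arguments.
Unset Strict Implicit.
Unset Printing Implicit Defensive.

Import Order.TTheory GRing.Theory Num.Theory.
Import numFieldNormedType.Exports.

Local Open Scope classical_set_scope.
Local Open Scope ring_scope.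
Local Open Scope complex_scope.
Local Notation "x ^*" := (conjc x) : ring_scope.

(** * Unconditional sums *)

Section Nsum.
Variables (R : realType) (I : choiceType).
Implicit Types (f g : I -> R) (s : seq I).

(** Subadditivity of tr |.|^p rests on describing tr |a|^p as the least value of the sums of |c_k|^p
    over all decompositions of a into rank one operators c_k xi_k eta_k^* with xi_k, eta_k in the
    unit ball: the singular value decomposition attains it, and compressions give the lower bound.
    Scaling, twisting or adding operators is then done on the rank one terms, and the same
    inequality estimates Toeplitz matrices from both sides. As the functional calculus asks for an
    eigenbasis indexed by the same set as the canonical basis, the spectral theorem has to provide
    one.

    In the easy implications the test element is fixed and the multiplier c is the variable: c |->
    |sum c_k x_k|^p and its operator analogue obey the same rules ([psemi]), so one argument serves
    all settings.

    In the converse the power of the kernel is dictated by p: the p-th power of its modulus must be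
    dominated by a square, so that Parseval bounds the sampled sums. The p-sums so obtained are only
    bounded by some constant, possibly larger than 1, which the limit does not improve; hence the
    separate sharpening. *)

Definition nsum f : \bar R := \esum_(i in [set: I]) (f i)%:E.

Lemma eq_nsum f g : f =1 g -> nsum f = nsum g.
Proof. by move=> fg; congr nsum; apply/funext. Qed.

Lemma nsum_ge0 f : (forall i, 0 <= f i) -> (0 <= nsum f)%E.
Proof. by move=> f0; apply: esum_ge0 => i _; rewrite lee_fin. Qed.

Lemma le_nsum f g : (forall i, f i <= g i) -> (nsum f <= nsum g)%E.
Proof. by move=> fg; apply: le_esum => i _; rewrite lee_fin. Qed.

Lemma nsumD f g : (forall i, 0 <= f i) -> (forall i, 0 <= g i) ->
  nsum (fun i => f i + g i)%R = (nsum f + nsum g)%E.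
Proof.
by move=> f0 g0; rewrite /nsum -esumD// => i _; rewrite lee_fin.
Qed.

Lemma nsum_seq_le f s : uniq s -> ((\sum_(i <- s) f i)%:E <= nsum f)%E.
Proof.
move=> us; apply: ereal_sup_ubound; exists [set` s]; first by split.
by rewrite -sumEFin -fsbig_seq.
Qed.

Lemma nsum_le f (M : \bar R) :
  (forall s, uniq s -> ((\sum_(i <- s) f i)%:E <= M)%E) -> (nsum f <= M)%E.
Proof.
move=> h; apply: ge_ereal_sup => _ [X [finX _] <-].
by rewrite fsbig_finite//= sumEFin; apply: h; exact: finmap.fset_uniq.
Qed.

Lemma nsum_gt f (x : R) : (x%:E < nsum f)%E ->
  exists2 s, uniq s & x < \sum_(i <- s) f i.
Proof.
move=> h; apply: contrapT => hn; move: h; rewrite ltNge => /negP; apply.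
apply: nsum_le => s us; rewrite lee_fin leNgt; apply/negP => xs.
by apply: hn; exists s.
Qed.

Lemma nsum_supp f s : uniq s -> (forall i, 0 <= f i) ->
  (forall i, i \notin s -> f i = 0) -> nsum f = (\sum_(i <- s) f i)%:E.
Proof.
move=> us f0 fs; apply/eqP; rewrite eq_le nsum_seq_le// andbT.
apply: nsum_le => t ut; rewrite lee_fin.
rewrite (bigID (mem s))/= [X in _ + X]big1 ?addr0; last by move=> i /fs.
rewrite [leRHS](bigID (mem t))/=.
rewrite -big_filter -[X in _ <= X + _]big_filter (perm_big [seq i <- s | i \in t]).
  by rewrite lerDl sumr_ge0.
by apply: uniq_perm; rewrite ?filter_uniq// => i; rewrite !mem_filter andbC.
Qed.

Lemma nsum1 j (x : R) : 0 <= x -> nsum (fun i => if i == j then x else 0)%R = x%:E.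
Proof.
move=> x0; rewrite (@nsum_supp _ [:: j])//.
- by rewrite big_seq1 eqxx.
- by move=> i; case: ifP.
- by move=> i; rewrite inE => /negPf ->.
Qed.

Lemma nsum0 : nsum (fun=> 0)%R = 0%E.
Proof. by rewrite /nsum esum1. Qed.

Lemma nsum_ge_term f j : (forall i, 0 <= f i) -> ((f j)%:E <= nsum f)%E.
Proof.
by move=> f0; have := @nsum_seq_le f [:: j] isT; rewrite big_seq1.
Qed.

Lemma nsumZ c f : 0 <= c -> (forall i, 0 <= f i) ->
  nsum (fun i => c * f i)%R = (c%:E * nsum f)%E.
Proof.
rewrite le_eqVlt => /predU1P[<-|c0] f0.
  by rewrite mul0e; rewrite (eq_nsum (g := fun=> 0%R)) ?nsum0// => i; rewrite mul0r.
(* One inequality is enough: it is applied to [c] and to its inverse. *)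
have H (d : R) (g : I -> R) : 0 < d -> (nsum (fun i => d * g i)%R <= d%:E * nsum g)%E.
  move=> d0; apply: nsum_le => s us; rewrite -mulr_sumr EFinM.
  by rewrite lee_pmul2l// nsum_seq_le.
apply/eqP; rewrite eq_le H//=.
rewrite -(@lee_pmul2l _ c^-1%:E)// ?lte_fin ?invr_gt0// muleA -EFinM.
rewrite mulVf ?gt_eqF// mul1e.
apply: (le_trans _ (H _ _ _)); last by rewrite invr_gt0.
by apply: le_nsum => i; rewrite mulrA mulVf ?gt_eqF// mul1r.
Qed.

Lemma nsumID (P : pred I) f : (forall i, 0 <= f i) ->
  nsum f = (nsum (fun i => if P i then f i else 0%R)%R +
            nsum (fun i => if P i then 0%R else f i)%R)%E.
Proof.
move=> f0; rewrite -nsumD; do ?by move=> i; case: ifP.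
by apply: eq_nsum => i; case: ifP; rewrite ?addr0 ?add0r.
Qed.

Lemma nsum_fin f : (forall i, 0 <= f i) -> (nsum f < +oo)%E ->
  nsum f = (fine (nsum f))%:E.
Proof.
by move=> f0 h; rewrite fineK// ge0_fin_numE// nsum_ge0.
Qed.

Lemma nsum_tail f (e : R) : (forall i, 0 <= f i) -> (nsum f < +oo)%E -> 0 < e ->
  exists2 s, uniq s & (nsum (fun i => if i \in s then 0%R else f i)%R <= e%:E)%E.
Proof.
move=> f0 foo e0; have := nsum_fin f0 foo; set l := fine _ => fl.
have [|s us ls] := @nsum_gt f (l - e).
  by rewrite fl lte_fin gtrBl.
exists s => //; move: fl; rewrite (nsumID (mem s) f0)/=.
rewrite (@nsum_supp (fun i => if i \in s then _ else _) s) //; last 2 first.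
- by move=> i; case: ifP.
- by move=> i /negPf ->.
rewrite big_seq; under eq_bigr => i -> do []; rewrite -big_seq.
have : (0 <= nsum (fun i => if i \in s then 0%R else f i)%R)%E.
  by apply: nsum_ge0 => i; case: ifP.
case: (nsum (fun i => if i \in s then 0 else f i)%R) => [x||] //= _.
by move=> [] h; rewrite lee_fin; lra.
Qed.

End Nsum.

Section Nsum2.
Variables (R : realType) (I J : choiceType).

Lemma nsum_pair (f : I -> J -> R) : (forall i j, 0 <= f i j) ->
  \esum_(i in [set: I]) nsum (f i) = nsum (fun k : I * J => f k.1 k.2)%R.
Proof.
move=> f0; rewrite esum_esum; last by move=> i j _ _; rewrite lee_fin.
by congr esum; apply/seteqP; split => -[].
Qed.

Lemma nsum_exchange (f : I -> J -> R) : (forall i j, 0 <= f i j) ->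
  \esum_(i in [set: I]) nsum (f i) = \esum_(j in [set: J]) nsum (f^~ j).
Proof.
move=> f0; rewrite nsum_pair// esum_esum; last by move=> i j _ _; rewrite lee_fin.
rewrite /nsum (@reindex_esum _ _ _ [set: J * I] [set: I * J] (fun x => (x.2, x.1))).
  by congr esum; apply/seteqP; split => -[].
by split => //= [[a b] [c d] _ _ [-> ->]//|[a b] _]; exists (b, a).
Qed.

Lemma reindex_nsum (h : J -> I) (f : I -> R) : bijective h ->
  nsum f = nsum (fun j => f (h j))%R.
Proof.
move=> [g hg gh]; rewrite /nsum (@reindex_esum _ _ _ [set: J] [set: I] h)//.
by split => //= [x y _ _ /(congr1 g)|i _]; [rewrite !hg|exists (g i); rewrite ?gh].
Qed.

Lemma nsum_inj (h : J -> I) (f : I -> R) : (forall i, 0 <= f i) -> injective h ->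
  (nsum (fun j => f (h j))%R <= nsum f)%E.
Proof.
move=> f0 hi; apply: nsum_le => s us; rewrite -(big_map h xpredT).
by apply: nsum_seq_le; rewrite map_inj_uniq.
Qed.

End Nsum2.

(** * The real-valued modulus of a complex number *)

Section Cabs.
Variable R : realType.
Implicit Types (z w : R[i]).

Lemma cabsE z : (cabs z)%:C = `|z|.
Proof. by rewrite /cabs normc_def. Qed.

Lemma cabs_ge0 z : 0 <= cabs z.
Proof. by rewrite -ler0c cabsE. Qed.

Lemma cabs0 : cabs (0 : R[i]) = 0.
Proof. by apply: complexI; rewrite cabsE normr0. Qed.

Lemma cabs1 : cabs (1 : R[i]) = 1.
Proof. by apply: complexI; rewrite cabsE normr1. Qed.

Lemma cabsM z w : cabs (z * w) = cabs z * cabs w.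
Proof. by apply: complexI; rewrite rmorphM !cabsE normrM. Qed.

Lemma cabsN z : cabs (- z) = cabs z.
Proof. by apply: complexI; rewrite !cabsE normrN. Qed.

Lemma cabsV z : cabs z^-1 = (cabs z)^-1.
Proof. by apply: complexI; rewrite fmorphV !cabsE normfV. Qed.

Lemma cabsX z n : cabs (z ^+ n) = cabs z ^+ n.
Proof. by apply: complexI; rewrite rmorphXn !cabsE normrX. Qed.

Lemma cabsXz z (k : int) : cabs (z ^ k) = cabs z ^ k.
Proof. by case: k => n; rewrite ?NegzE -?exprnP -?exprnN ?cabsV cabsX. Qed.

Lemma cabsD z w : cabs (z + w) <= cabs z + cabs w.
Proof. by rewrite -lecR rmorphD !cabsE ler_normD. Qed.

Lemma cabs_sum (T : Type) (r : seq T) (P : pred T) (F : T -> R[i]) :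
  cabs (\sum_(i <- r | P i) F i) <= \sum_(i <- r | P i) cabs (F i).
Proof.
by rewrite -lecR rmorph_sum cabsE (le_trans (ler_norm_sum _ _ _))// ler_sum// => i _; rewrite cabsE.
Qed.

Lemma cabs_conj z : cabs z^* = cabs z.
Proof. by apply: complexI; rewrite !cabsE normcJ. Qed.

Lemma cabs_real (x : R) : cabs x%:C = `|x|.
Proof. by apply: complexI; rewrite cabsE normc_def /= expr0n addr0 sqrtr_sqr. Qed.

Lemma cabs_eq0 z : (cabs z == 0) = (z == 0).
Proof. by rewrite -(inj_eq (@complexI R)) cabsE normr_eq0. Qed.

Lemma mulcJ z : z * z^* = (cabs z ^+ 2)%:C.
Proof. by rewrite -sqr_normc rmorphXn/= cabsE. Qed.

Lemma cabs_Re z : `|complex.Re z| <= cabs z.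
Proof. by rewrite -lecR cabsE normc_ge_Re. Qed.

Lemma ImRe z : complex.Im z = complex.Re (- 'i%C * z).
Proof. by case: z => a b; simpc. Qed.

Lemma cabs_Im z : `|complex.Im z| <= cabs z.
Proof.
rewrite ImRe (le_trans (cabs_Re _))// cabsM cabsN.
by rewrite (_ : cabs 'i%C = 1) ?mul1r// /cabs normc_def/= expr0n add0r expr1n sqrtr1.
Qed.

Lemma sqr_cabs z : cabs z ^+ 2 = complex.Re z ^+ 2 + complex.Im z ^+ 2.
Proof. by apply: complexI; rewrite add_Re2_Im2 rmorphXn/= cabsE. Qed.

Lemma ReM z w : complex.Re (z * w) =
  complex.Re z * complex.Re w - complex.Im z * complex.Im w.
Proof. by case: z w => a b [c d]; simpc. Qed.

Lemma ImM z w : complex.Im (z * w) =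
  complex.Re z * complex.Im w + complex.Im z * complex.Re w.
Proof. by case: z w => a b [c d]; simpc; rewrite addrC. Qed.

Lemma ReD z w : complex.Re (z + w) = complex.Re z + complex.Re w.
Proof. by case: z w => a b [c d]. Qed.

Lemma ImD z w : complex.Im (z + w) = complex.Im z + complex.Im w.
Proof. by case: z w => a b [c d]. Qed.

Lemma conjD z w : (z + w)^* = z^* + w^*.
Proof. exact: rmorphD. Qed.

Lemma conjM z w : (z * w)^* = z^* * w^*.
Proof. exact: rmorphM. Qed.

Lemma conjN z : (- z)^* = - z^*.
Proof. exact: rmorphN. Qed.

Lemma conj_sum (T : Type) (r : seq T) (P : pred T) (F : T -> R[i]) :
  (\sum_(i <- r | P i) F i)^* = \sum_(i <- r | P i) (F i)^*.
Proof. exact: rmorph_sum. Qed.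

Lemma realCD (x y : R) : (x + y)%:C = x%:C + y%:C :> R[i].
Proof. exact: rmorphD. Qed.

Lemma realCM (x y : R) : (x * y)%:C = x%:C * y%:C :> R[i].
Proof. exact: rmorphM. Qed.

Lemma realCN (x : R) : (- x)%:C = - x%:C :> R[i].
Proof. exact: rmorphN. Qed.

Lemma realC_sum (T : Type) (r : seq T) (P : pred T) (F : T -> R) :
  (\sum_(i <- r | P i) F i)%:C = \sum_(i <- r | P i) (F i)%:C :> R[i].
Proof. exact: rmorph_sum. Qed.

Lemma addJ z : z + z^* = (2 * complex.Re z)%:C.
Proof. by case: z => a b; rewrite mulr2n mulrDl mul1r; apply/eqP; rewrite eq_complex /= subrr !eqxx. Qed.

Lemma ReN z : complex.Re (- z) = - complex.Re z.
Proof. by case: z. Qed.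

Lemma ReJ z : complex.Re z^* = complex.Re z.
Proof. by case: z. Qed.

Lemma ImJ z : complex.Im z^* = - complex.Im z.
Proof. by case: z. Qed.

Lemma Re_sum (T : Type) (r : seq T) (P : pred T) (F : T -> R[i]) :
  complex.Re (\sum_(i <- r | P i) F i) = \sum_(i <- r | P i) complex.Re (F i).
Proof. by rewrite (big_morph _ ReD (erefl _)). Qed.

Lemma Re_realM (x : R) z : complex.Re (x%:C * z) = x * complex.Re z.
Proof. by rewrite ReM/= mul0r subr0. Qed.

Lemma cabs_Re_unit z : exists2 u, cabs u = 1 & u * z = (cabs z)%:C.
Proof.
have [->|z0] := eqVneq z 0; first by exists 1; rewrite ?cabs1 ?mulr0 ?cabs0.
exists ((cabs z)^-1%:C * z^*).
  by rewrite cabsM cabs_real cabs_conj ger0_norm ?invr_ge0 ?cabs_ge0// mulVf// cabs_eq0.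
rewrite -mulrA [_ * z]mulrC mulcJ -rmorphM/= expr2 mulrA mulVf ?mul1r//.
by rewrite cabs_eq0.
Qed.

Lemma cabs_ReIm z : cabs z <= `|complex.Re z| + `|complex.Im z|.
Proof.
rewrite -(@ler_pXn2r _ 2)// ?nnegrE ?cabs_ge0 ?addr_ge0// sqr_cabs.
by rewrite sqrrD !real_normK ?num_real// -addrA lerD2l lerDr mulrn_wge0// mulr_ge0.
Qed.

End Cabs.

(** * Linearity and estimates for sums of absolutely summable families *)

Section Csum.
Variables (R : realType) (I : choiceType).
Implicit Types (f g : I -> R[i]).

Definition asum f := (nsum (fun i => cabs (f i))%R < +oo)%E.

(** The sum does not depend on how f is split into a difference: if fp and fn are the positive and
    negative parts, fp + h = fn + g termwise, and nonnegative sums are additive. Linearity of [rsum]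
    follows from this freedom. *)
Lemma rsum_split (f g h : I -> R) : (forall i, 0 <= g i) -> (forall i, 0 <= h i) ->
  (nsum g < +oo)%E -> (nsum h < +oo)%E -> (forall i, f i = g i - h i) ->
  rsum f = fine (nsum g) - fine (nsum h).
Proof.
move=> g0 h0 goo hoo fgh; rewrite /rsum -/(nsum _) -/(nsum _).
set fp := fun i => Num.max (f i) 0; set fn := fun i => Num.max (- f i) 0.
have fp0 i : 0 <= fp i by rewrite /fp le_max lexx orbT.
have fn0 i : 0 <= fn i by rewrite /fn le_max lexx orbT.
have fpg i : fp i <= g i by rewrite /fp fgh ge_max g0 lerBlDr lerDl h0.
have fnh i : fn i <= h i by rewrite /fn fgh ge_max h0 opprB lerBlDr lerDl g0.
have fpoo : (nsum fp < +oo)%E by apply: le_lt_trans goo; exact: le_nsum.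
have fnoo : (nsum fn < +oo)%E by apply: le_lt_trans hoo; exact: le_nsum.
have : nsum (fun i => fp i + h i)%R = nsum (fun i => fn i + g i)%R.
  apply: eq_nsum => i; rewrite /fp /fn fgh.
  by case: (leP (g i - h i) 0) => ?; case: (leP (- (g i - h i)) 0) => ?; lra.
rewrite !nsumD// (nsum_fin fp0)// (nsum_fin fn0)// (nsum_fin g0)// (nsum_fin h0)//.
rewrite -!EFinD => -[] /=; lra.
Qed.

Lemma rsum_pos (f : I -> R) : (forall i, 0 <= f i) -> (nsum f < +oo)%E ->
  rsum f = fine (nsum f).
Proof.
move=> f0 foo; rewrite (@rsum_split f f (fun=> 0))// ?nsum0//= ?subr0//.
by move=> i; rewrite subr0.
Qed.

Lemma rsumN (f : I -> R) : rsum (fun i => - f i) = - rsum f.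
Proof.
rewrite /rsum opprB; congr (_ - _); congr fine.
by apply: eq_esum => i _; rewrite opprK.
Qed.

Let absp (f : I -> R) i : Num.max (f i) 0 <= `|f i|.
Proof. by rewrite ge_max ler_norm normr_ge0. Qed.
Let absn (f : I -> R) i : Num.max (- f i) 0 <= `|f i|.
Proof. by rewrite ge_max -normrN ler_norm normr_ge0. Qed.
Let maxp (f : I -> R) i : 0 <= Num.max (f i) 0.
Proof. by rewrite le_max lexx orbT. Qed.
Let maxn (f : I -> R) i : 0 <= Num.max (- f i) 0.
Proof. by rewrite le_max lexx orbT. Qed.
Let maxD (f : I -> R) i : f i = Num.max (f i) 0 - Num.max (- f i) 0.
Proof. by case: (leP (f i) 0) => ?; case: (leP (- f i) 0) => ?; lra. Qed.

Let rfin (f : I -> R) : (nsum (fun i => `|f i|)%R < +oo)%E ->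
  (nsum (fun i => Num.max (f i) 0)%R < +oo)%E /\ (nsum (fun i => Num.max (- f i) 0)%R < +oo)%E.
Proof. by move=> foo; split; apply: le_lt_trans foo; apply: le_nsum. Qed.

Lemma rsumD (f g : I -> R) : (nsum (fun i => `|f i|)%R < +oo)%E ->
  (nsum (fun i => `|g i|)%R < +oo)%E ->
  rsum (fun i => f i + g i) = rsum f + rsum g.
Proof.
move=> /rfin[fp fn] /rfin[gp gn].
rewrite (@rsum_split _ (fun i => Num.max (f i) 0 + Num.max (g i) 0)
  (fun i => Num.max (- f i) 0 + Num.max (- g i) 0)).
- rewrite !nsumD// !fineD ?ge0_fin_numE ?nsum_ge0//.
  by rewrite /rsum -/(nsum _) -/(nsum _) -/(nsum _) -/(nsum _) opprD addrACA.
- by move=> i; rewrite addr_ge0.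
- by move=> i; rewrite addr_ge0.
- by rewrite nsumD// lte_add_pinfty.
- by rewrite nsumD// lte_add_pinfty.
- by move=> i; rewrite {1}(maxD f) {1}(maxD g) opprD addrACA.
Qed.

Lemma rsumZ (c : R) (f : I -> R) : (nsum (fun i => `|f i|)%R < +oo)%E ->
  rsum (fun i => c * f i) = c * rsum f.
Proof.
move=> foo; have [fp fn] := rfin foo.
wlog c0 : c / 0 <= c => [H|].
  have [|c0] := leP 0 c; first exact: H.
  rewrite -[c]opprK mulNr -H ?oppr_ge0 1?ltW// -rsumN; congr rsum.
  by apply/funext => i; rewrite !mulNr !opprK.
rewrite (@rsum_split _ (fun i => c * Num.max (f i) 0) (fun i => c * Num.max (- f i) 0)).
- rewrite !nsumZ// !fineM ?ge0_fin_numE ?nsum_ge0//= ?ltry//.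
  by rewrite /rsum -/(nsum _) -/(nsum _) mulrBr.
- by move=> i; rewrite mulr_ge0.
- by move=> i; rewrite mulr_ge0.
- by rewrite nsumZ// lte_mul_pinfty ?lee_fin ?ltry.
- by rewrite nsumZ// lte_mul_pinfty ?lee_fin ?ltry.
- by move=> i; rewrite {1}(maxD f i) mulrBr.
Qed.

Lemma rsum_le (f : I -> R) : (nsum (fun i => `|f i|)%R < +oo)%E ->
  (`|rsum f|%:E <= nsum (fun i => `|f i|)%R)%E.
Proof.
move=> foo; have [fp fn] := rfin foo.
rewrite (nsum_fin (f := fun i => `|f i|))//= lee_fin.
have -> : nsum (fun i => `|f i|)%R =
  (nsum (fun i => Num.max (f i) 0)%R + nsum (fun i => Num.max (- f i) 0)%R)%E.
  rewrite -nsumD//; apply: eq_nsum => i.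
  by case: (leP (f i) 0) => ?; case: (leP (- f i) 0) => ?; case: (ger0P (f i)) => ?; lra.
rewrite fineD ?ge0_fin_numE ?nsum_ge0// /rsum -/(nsum _) -/(nsum _).
rewrite (le_trans (ler_normB _ _))// !ger0_norm// fine_ge0// nsum_ge0//.
Qed.

Lemma asum_Re f : asum f -> (nsum (fun i => `|complex.Re (f i)|)%R < +oo)%E.
Proof. by apply: le_lt_trans; apply: le_nsum => i; exact: cabs_Re. Qed.

Lemma asum_Im f : asum f -> (nsum (fun i => `|complex.Im (f i)|)%R < +oo)%E.
Proof. by apply: le_lt_trans; apply: le_nsum => i; exact: cabs_Im. Qed.

Lemma asum_le f (g : I -> R) : (forall i, cabs (f i) <= g i) -> (nsum g < +oo)%E -> asum f.
Proof. by move=> fg; apply: le_lt_trans; exact: le_nsum. Qed.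

Lemma asumD f g : asum f -> asum g -> asum (fun i => f i + g i).
Proof.
move=> fs gs; apply: (@asum_le _ (fun i => cabs (f i) + cabs (g i))).
  by move=> i; exact: cabsD.
by rewrite nsumD ?lte_add_pinfty// => i; exact: cabs_ge0.
Qed.

Lemma asumZ c f : asum f -> asum (fun i => c * f i).
Proof.
move=> fs; apply: (@asum_le _ (fun i => cabs c * cabs (f i))).
  by move=> i; rewrite cabsM.
rewrite nsumZ ?cabs_ge0//; last by move=> i; exact: cabs_ge0.
by rewrite lte_mul_pinfty ?lee_fin ?ltry ?cabs_ge0.
Qed.

Lemma asumN f : asum f -> asum (fun i => - f i).
Proof. by rewrite /asum (eq_nsum (g := fun i => cabs (f i)))// => i; rewrite cabsN. Qed.

Lemma asum0 : asum (fun=> 0).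
Proof. by rewrite /asum (eq_nsum (g := fun=> 0%R)) ?nsum0// => i; rewrite cabs0. Qed.

Lemma asum_supp f (s : seq I) : uniq s -> (forall i, i \notin s -> f i = 0) -> asum f.
Proof.
move=> us fs; rewrite /asum (@nsum_supp _ _ _ s) ?ltry//.
- by move=> i; exact: cabs_ge0.
- by move=> i /fs ->; rewrite cabs0.
Qed.

Lemma csumD f g : asum f -> asum g -> csum (fun i => f i + g i) = csum f + csum g.
Proof.
move=> fs gs; rewrite /csum; apply/eqP; rewrite eq_complex/=.
under [X in rsum X]eq_fun do rewrite ReD.
under [X in _ && (rsum X == _)]eq_fun do rewrite ImD.
rewrite (rsumD (asum_Re fs) (asum_Re gs)) (rsumD (asum_Im fs) (asum_Im gs)).
by rewrite !eqxx.
Qed.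

Lemma csumZ c f : asum f -> csum (fun i => c * f i) = c * csum f.
Proof.
move=> fs; have [fr fi] := (asum_Re fs, asum_Im fs).
have H (d : R) (h : I -> R) : (nsum (fun i => `|h i|)%R < +oo)%E -> (nsum (fun i => `|d * h i|)%R < +oo)%E.
  move=> hoo; under eq_nsum do rewrite normrM.
  by rewrite nsumZ// lte_mul_pinfty ?lee_fin ?ltry.
rewrite /csum; under [X in rsum X]eq_fun do rewrite ReM -mulNr.
under [X in _ +i* rsum X]eq_fun do rewrite ImM.
rewrite (rsumD (H _ _ fr) (H _ _ fi)) (rsumD (H _ _ fi) (H _ _ fr)) !rsumZ//.
by case: c => a b; rewrite mulNr.
Qed.

Lemma csumN f : csum (fun i => - f i) = - csum f.
Proof.
rewrite /csum; under [X in rsum X]eq_fun do rewrite ReN.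
rewrite (_ : (fun i => complex.Im (- f i)) = (fun i => - complex.Im (f i))) ?rsumN//.
by apply/funext => i; case: (f i).
Qed.

Lemma csum_conj f : csum (fun i => (f i)^*) = (csum f)^*.
Proof.
rewrite /csum; under [X in rsum X]eq_fun do rewrite ReJ.
by under [X in _ +i* rsum X]eq_fun do rewrite ImJ; rewrite rsumN.
Qed.

Lemma csumB f g : asum f -> asum g -> csum (fun i => f i - g i) = csum f - csum g.
Proof. by move=> fs gs; rewrite csumD ?csumN//; exact: asumN. Qed.

Lemma eq_csum f g : f =1 g -> csum f = csum g.
Proof. by move=> fg; congr csum; apply/funext. Qed.

Lemma Re_csum f : complex.Re (csum f) = rsum (fun i => complex.Re (f i)).
Proof. by []. Qed.

Lemma csum_pos (f : I -> R) : (forall i, 0 <= f i) -> (nsum f < +oo)%E ->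
  csum (fun i => (f i)%:C) = (fine (nsum f))%:C.
Proof.
move=> f0 foo; rewrite /csum/= rsum_pos//; congr (_ +i* _).
by rewrite rsum_pos// nsum0.
Qed.

(** A unimodular factor turns the sum into a nonnegative real, so that the real triangle inequality
    applies without loss of a constant. *)
Lemma cabs_csum f : asum f -> ((cabs (csum f))%:E <= nsum (fun i => cabs (f i))%R)%E.
Proof.
move=> fs; have [u u1 uf] := cabs_Re_unit (csum f).
have := Re_csum (fun i => u * f i); rewrite csumZ// uf/= => ->.
have ufs := asumZ u fs.
apply: (@le_trans _ _ `|rsum (fun i => complex.Re (u * f i))|%:E).
  by rewrite lee_fin ler_norm.
apply: (le_trans (rsum_le (asum_Re ufs))); apply: le_nsum => i.
by rewrite (le_trans (cabs_Re _))// cabsM u1 mul1r.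
Qed.

Lemma csum0 : csum (fun _ : I => 0 : R[i]) = 0.
Proof. by rewrite /csum /rsum/= oppr0 -/(nsum _) maxxx nsum0/= subrr. Qed.

Lemma csum1 (j : I) (x : R[i]) : csum (fun i => if i == j then x else 0) = x.
Proof.
have fs : asum (fun i => if i == j then 1 else 0 : R[i]).
  by apply: (@asum_supp _ [:: j]) => // i; rewrite inE => /negPf ->.
transitivity (csum (fun i => x * if i == j then 1 else 0)).
  by apply: eq_csum => i; case: ifP; rewrite ?mulr1 ?mulr0.
rewrite csumZ// (_ : csum _ = 1) ?mulr1//.
transitivity (csum (fun i => (if i == j then 1 else 0 : R)%:C)).
  by apply: eq_csum => i; case: ifP.
by rewrite csum_pos ?nsum1 ?ltry// => i; case: ifP.
Qed.

Lemma csum_sum (T : Type) (r : seq T) (F : T -> I -> R[i]) :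
  (forall t, asum (F t)) ->
  csum (fun i => \sum_(t <- r) F t i) = \sum_(t <- r) csum (F t) /\
  asum (fun i => \sum_(t <- r) F t i).
Proof.
move=> Fs; elim: r => [|t r [IH1 IH2]].
  under eq_csum do rewrite big_nil; rewrite csum0 big_nil; split => //.
  by under [X in asum X]eq_fun do rewrite big_nil; exact: asum0.
have e : (fun i => \sum_(t0 <- t :: r) F t0 i) = (fun i => F t i + \sum_(t0 <- r) F t0 i).
  by apply/funext => i; rewrite big_cons.
by rewrite e; split; [rewrite csumD// IH1 big_cons|exact: asumD].
Qed.

Lemma csum_supp f (s : seq I) : uniq s -> (forall i, i \notin s -> f i = 0) ->
  csum f = \sum_(i <- s) f i.
Proof.
move=> us fs.
transitivity (csum (fun i => \sum_(j <- s) if i == j then f j else 0)).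
  apply: eq_csum => i; have [is_|/[dup] is_ /fs ->] := boolP (i \in s).
    rewrite (bigD1_seq i)//= eqxx big1 ?addr0// => j /negPf.
    by rewrite eq_sym => ->.
  rewrite big1_seq// => j /andP[_ js].
  by case: eqP => // e; rewrite e js in is_.
rewrite (proj1 (csum_sum _ _)); first by apply: eq_bigr => j _; exact: csum1.
by move=> j; apply: (@asum_supp _ [:: j]) => // i; rewrite inE => /negPf ->.
Qed.

Lemma csum_restrict f (s : seq I) : asum f -> uniq s ->
  csum f = \sum_(i <- s) f i + csum (fun i => if i \in s then 0 else f i).
Proof.
move=> fs us.
transitivity (csum (fun i => (if i \in s then f i else 0) + (if i \in s then 0 else f i))).
  by apply: eq_csum => i; case: ifP; rewrite ?addr0 ?add0r.
rewrite csumD.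
- congr (_ + _); rewrite (@csum_supp _ s)//; last by move=> i /negPf ->.
  by rewrite big_seq; under eq_bigr => i -> do []; rewrite -big_seq.
- by apply: (@asum_supp _ s) => // i /negPf ->.
- apply: (@asum_le _ (fun i => cabs (f i))) => // i.
  by case: ifP => _; rewrite ?cabs0 ?cabs_ge0.
Qed.

Lemma csum_approx f (e : R) : asum f -> 0 < e -> exists2 s : seq I, uniq s &
  forall t, uniq t -> {subset s <= t} -> cabs (csum f - \sum_(i <- t) f i) <= e.
Proof.
move=> fs e0; have [|s us se] := @nsum_tail _ _ (fun i => cabs (f i)) e _ fs e0.
  by move=> i; exact: cabs_ge0.
exists s => // t ut st; rewrite (csum_restrict fs ut) addrC addKr.
have ts : asum (fun i => if i \in t then 0 else f i).
  apply: (@asum_le _ (fun i => cabs (f i))) => // i.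
  by case: ifP => _; rewrite ?cabs0 ?cabs_ge0.
rewrite -lee_fin (le_trans (cabs_csum ts))// (le_trans _ se)//.
apply: le_nsum => i; case: ifPn => [_|it]; first by rewrite cabs0; case: ifP; rewrite ?cabs_ge0.
by case: ifPn => // /st; rewrite (negPf it).
Qed.

End Csum.

(** * Fubini and reindexing for signed and complex sums *)

Section Csum2.
Variables (R : realType) (I J : choiceType).

(** By definition each inner sum is a difference of two nonnegative sums, so [rsum_split] applies to
    the outer family and Fubini is only needed for nonnegative families. *)
Let rsum_fub (f : I -> J -> R) :
  (\esum_(i in [set: I]) nsum (fun j => `|f i j|%R)%R < +oo)%E ->
  let F (g : I -> J -> R) := nsum (fun k : I * J => g k.1 k.2)%R in
  rsum (fun i => rsum (f i)) =
    fine (F (fun i j => Num.max (f i j) 0)) - fine (F (fun i j => Num.max (- f i j) 0)).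
Proof.
move=> foo F.
have fp (g : I -> J -> R) : (forall i j, 0 <= g i j <= `|f i j|) ->
    (F g < +oo)%E /\ F g = nsum (fun i => fine (nsum (g i)))%R /\ forall i, (nsum (g i) < +oo)%E.
  move=> gf.
  have g0 i j : 0 <= g i j by have /andP[] := gf i j.
  have gle i j : g i j <= `|f i j| by have /andP[] := gf i j.
  have E : (\esum_(i in [set: I]) nsum (g i) < +oo)%E.
    by apply: le_lt_trans foo; apply: le_esum => i _; exact: le_nsum.
  have Ei i : (nsum (g i) < +oo)%E.
    apply: le_lt_trans E; rewrite -(@esum_set1 _ _ i (fun i => nsum (g i))) ?nsum_ge0//.
    rewrite esum_mkcond; apply: le_esum => k _; case: ifP => // _.
    exact: nsum_ge0.
  rewrite /F -nsum_pair//; split => //; split => //.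
  by apply: eq_esum => i _; rewrite -nsum_fin.
have Q i j : 0 <= Num.max (f i j) 0 <= `|f i j|.
  by rewrite le_max lexx orbT/= ge_max normr_ge0 ler_norm.
have Q' i j : 0 <= Num.max (- f i j) 0 <= `|f i j|.
  by rewrite le_max lexx orbT/= ge_max normr_ge0 -normrN ler_norm.
have [Fp [Fpe Fpi]] := fp _ Q; have [Fn [Fne Fni]] := fp _ Q'.
rewrite Fpe Fne.
apply: rsum_split.
- by move=> i; rewrite fine_ge0// nsum_ge0// => j; rewrite le_max lexx orbT.
- by move=> i; rewrite fine_ge0// nsum_ge0// => j; rewrite le_max lexx orbT.
- by rewrite -Fpe.
- by rewrite -Fne.
- by move=> i; rewrite /rsum.
Qed.

Lemma csum_pair (f : I -> J -> R[i]) :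
  asum (fun k : I * J => f k.1 k.2) ->
  csum (fun i => csum (f i)) = csum (fun k : I * J => f k.1 k.2).
Proof.
move=> foo; have h (part : R[i] -> R) : (forall z, `|part z| <= cabs z) ->
  rsum (fun i => rsum (fun j => part (f i j))) = rsum (fun k : I * J => part (f k.1 k.2)).
  move=> hp; rewrite rsum_fub//; apply: le_lt_trans foo.
  rewrite -(nsum_pair (f := fun i j => cabs (f i j))); last by move=> *; exact: cabs_ge0.
  by apply: le_esum => i _; apply: le_nsum.
by rewrite /csum; congr (_ +i* _); apply: h => z; [exact: cabs_Re|exact: cabs_Im].
Qed.

Lemma reindex_csum (h : J -> I) (f : I -> R[i]) : bijective h ->
  csum f = csum (fun j => f (h j)).
Proof.
by move=> bh; rewrite /csum /rsum; do 4!rewrite -/(nsum _) (reindex_nsum _ bh).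
Qed.

End Csum2.

Lemma csum_exchange (R : realType) (I J : choiceType) (f : I -> J -> R[i]) :
  asum (fun k : I * J => f k.1 k.2) ->
  csum (fun i => csum (f i)) = csum (fun j => csum (fun i => f i j)).
Proof.
move=> foo; rewrite csum_pair// (@csum_pair _ _ _ (fun j i => f i j)).
  by rewrite (@reindex_csum _ _ _ (fun k : J * I => (k.2, k.1)))//; exists (fun k => (k.2, k.1)) => -[].
move: foo; rewrite /asum (@reindex_nsum _ _ _ (fun k : J * I => (k.2, k.1)))//.
by exists (fun k => (k.2, k.1)) => -[].
Qed.

(** * Square-summable families and bounded matrices *)

Section L2.
Variables (R : realType) (I : choiceType).
Implicit Types (v w x : I -> R[i]).

Definition l2 v := (sqnorm v < +oo)%E.
(** The square of the norm as a real number; it takes the junk value 0 outside l^2. *)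
Definition nrm2 v : R := fine (sqnorm v).
Definition inner v w : R[i] := csum (fun i => v i * (w i)^*).
Definition dvec (j : I) : I -> R[i] := fun i => (i == j)%:R.

Lemma sqnormE v : sqnorm v = nsum (fun i => cabs (v i) ^+ 2).
Proof. by []. Qed.

Lemma sqnorm_ge0 v : (0 <= sqnorm v)%E.
Proof. by apply: nsum_ge0 => i; rewrite exprn_ge0 ?cabs_ge0. Qed.

Lemma nrm2_ge0 v : 0 <= nrm2 v.
Proof. by rewrite fine_ge0// sqnorm_ge0. Qed.

Lemma sqnorm_fin v : l2 v -> sqnorm v = (nrm2 v)%:E.
Proof. by move=> lv; rewrite /nrm2 fineK// ge0_fin_numE// sqnorm_ge0. Qed.

Lemma l2_le v (M : R) : (sqnorm v <= M%:E)%E -> l2 v.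
Proof. by move=> h; rewrite /l2 (le_lt_trans h)// ltry. Qed.

Lemma nrm2_le v (M : R) : (sqnorm v <= M%:E)%E -> nrm2 v <= M.
Proof. by move=> h; rewrite -lee_fin -sqnorm_fin//; exact: l2_le h. Qed.

Lemma sqnormZ (c : R[i]) v : sqnorm (fun i => c * v i) = ((cabs c ^+ 2)%:E * sqnorm v)%E.
Proof.
rewrite !sqnormE -nsumZ ?exprn_ge0 ?cabs_ge0//; last by move=> i; rewrite exprn_ge0 ?cabs_ge0.
by apply: eq_nsum => i; rewrite cabsM exprMn.
Qed.

Lemma l2Z (c : R[i]) v : l2 v -> l2 (fun i => c * v i).
Proof.
move=> lv; rewrite /l2 sqnormZ sqnorm_fin// -EFinM ltry//.
Qed.

Lemma nrm2Z (c : R[i]) v : l2 v -> nrm2 (fun i => c * v i) = cabs c ^+ 2 * nrm2 v.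
Proof. by move=> lv; rewrite /nrm2 sqnormZ sqnorm_fin. Qed.

Lemma sqnormD_le v w :
  (sqnorm (fun i => v i + w i)%R <= 2%:E * sqnorm v + 2%:E * sqnorm w)%E.
Proof.
rewrite !sqnormE -!nsumZ//; try by move=> i; rewrite exprn_ge0 ?cabs_ge0.
rewrite -nsumD; try by move=> i; rewrite mulr_ge0 ?exprn_ge0 ?cabs_ge0.
apply: le_nsum => i; apply: (@le_trans _ _ ((cabs (v i) + cabs (w i)) ^+ 2)).
  by rewrite ler_pXn2r ?nnegrE ?addr_ge0 ?cabs_ge0// cabsD.
by have := sqr_ge0 (cabs (v i) - cabs (w i)); nra.
Qed.

Lemma l2D v w : l2 v -> l2 w -> l2 (fun i => v i + w i).
Proof.
move=> lv lw; apply: (@l2_le _ (2 * nrm2 v + 2 * nrm2 w)).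
by apply: (le_trans (sqnormD_le _ _)); rewrite !sqnorm_fin.
Qed.

Lemma l2N v : l2 v -> l2 (fun i => - v i).
Proof. by rewrite /l2 !sqnormE; under [X in _ -> (nsum X < _)%E]eq_fun do rewrite cabsN. Qed.

Lemma l2B v w : l2 v -> l2 w -> l2 (fun i => v i - w i).
Proof. by move=> lv lw; apply: l2D => //; exact: l2N. Qed.

Lemma l2_conj v : l2 v -> l2 (fun i => (v i)^*).
Proof. by rewrite /l2 !sqnormE; under [X in _ -> (nsum X < _)%E]eq_fun do rewrite cabs_conj. Qed.

Lemma l2_supp v (s : seq I) : uniq s -> (forall i, i \notin s -> v i = 0) -> l2 v.
Proof.
move=> us vs; rewrite /l2 sqnormE (@nsum_supp _ _ _ s) ?ltry//.
- by move=> i; rewrite exprn_ge0 ?cabs_ge0.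
- by move=> i /vs ->; rewrite cabs0 expr0n.
Qed.

Lemma l2_0 : l2 (fun=> 0).
Proof. exact: (@l2_supp _ [::]). Qed.

Lemma l2_dvec j : l2 (dvec j).
Proof. by apply: (@l2_supp _ [:: j]) => // i; rewrite inE /dvec => /negPf ->. Qed.

Lemma l2_sum (T : Type) (r : seq T) (F : T -> I -> R[i]) :
  (forall t, l2 (F t)) -> l2 (fun i => \sum_(t <- r) F t i).
Proof.
move=> Fl; elim: r => [|t r IH].
  by under [X in l2 X]eq_fun do rewrite big_nil; exact: l2_0.
by under [X in l2 X]eq_fun do rewrite big_cons; exact: l2D.
Qed.

(* AM-GM in the form 2 |v_i| |w_i| <= t |v_i|^2 + |w_i|^2 / t, with t optimal. *)
Lemma nsum_CS v w : l2 v -> l2 w ->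
  (nsum (fun i => cabs (v i) * cabs (w i))%R <= (Num.sqrt (nrm2 v * nrm2 w))%:E)%E.
Proof.
move=> lv lw; have A0 := nrm2_ge0 v; have B0 := nrm2_ge0 w.
have H (t : R) : 0 < t ->
    (nsum (fun i => cabs (v i) * cabs (w i))%R <= ((t * nrm2 v + t^-1 * nrm2 w) / 2)%:E)%E.
  move=> t0; have ti0 : 0 < t^-1 by rewrite invr_gt0.
  have -> : ((t * nrm2 v + t^-1 * nrm2 w) / 2)%:E = nsum (fun i => (t / 2) * cabs (v i) ^+ 2 + (t^-1 / 2) * cabs (w i) ^+ 2)%R.
    rewrite nsumD; try by move=> i; rewrite mulr_ge0 ?exprn_ge0 ?cabs_ge0 ?divr_ge0// ltW.
    rewrite !nsumZ ?divr_ge0// ?ltW//; try by move=> i; rewrite exprn_ge0 ?cabs_ge0.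
    by rewrite -!sqnormE !sqnorm_fin// -!EFinM -EFinD; congr EFin; lra.
  apply: le_nsum => i; have := cabs_ge0 (v i); have := cabs_ge0 (w i).
  move: (cabs (v i)) (cabs (w i)) => a b b0 a0.
  have h := sqr_ge0 (t * a - b).
  rewrite -(ler_pM2l t0).
  have -> : t * (t / 2 * a ^+ 2 + t^-1 / 2 * b ^+ 2) = ((t * a) ^+ 2 + b ^+ 2) / 2.
    by field; rewrite gt_eqF.
  nra.
have S0 : (0 <= nsum (fun i => cabs (v i) * cabs (w i))%R)%E.
  by apply: nsum_ge0 => i; rewrite mulr_ge0 ?cabs_ge0.
have Sfin : nsum (fun i => cabs (v i) * cabs (w i))%R \is a fin_num.
  by rewrite ge0_fin_numE// (le_lt_trans (H 1 ltr01))// ltry.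
move: H S0; rewrite -(fineK Sfin) => H; rewrite !lee_fin => S0.
set S := fine _ in H S0 *.
rewrite -(@ler_pXn2r _ 2)// ?nnegrE ?sqrtr_ge0// sqr_sqrtr ?mulr_ge0//.
have [->|Sn0] := eqVneq S 0; first by rewrite expr0n/= mulr_ge0.
have {}S0 : 0 < S by rewrite lt_neqAle eq_sym Sn0.
(* No optimal [t] exists when v = 0; with W = [nrm2 w], the large value t = (W + 1) / S already
   gives 2 (W + 1) <= W. *)
have [A00|An0] := eqVneq (nrm2 v) 0.
  have t0 : 0 < (nrm2 w + 1) / S by rewrite divr_gt0// ltr_wpDl.
  have := H _ t0; rewrite lee_fin A00 mulr0 add0r invf_div.
  rewrite ler_pdivlMr// -mulrA [_^-1 * _]mulrC mulrA ler_pdivlMr; last by rewrite ltr_wpDl.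
  by nra.
have {}A0 : 0 < nrm2 v by rewrite lt_neqAle eq_sym An0.
(* This [t] makes t |v|^2 equal to S, which leaves S <= |v|^2 |w|^2 / S. *)
have := H (S / nrm2 v) (divr_gt0 S0 A0); rewrite lee_fin divfK// invf_div.
rewrite ler_pdivlMr// => h.
have h2 : S <= nrm2 v * nrm2 w / S by rewrite mulrAC; lra.
by move: h2; rewrite ler_pdivlMr// expr2.
Qed.

Lemma asum_inner v w : l2 v -> l2 w -> asum (fun i => v i * (w i)^*).
Proof.
move=> lv lw; apply: (@asum_le _ _ _ (fun i => cabs (v i) * cabs (w i))).
  by move=> i; rewrite cabsM cabs_conj.
by rewrite (le_lt_trans (nsum_CS lv lw))// ltry.
Qed.

Lemma asum_mul v w : l2 v -> l2 w -> asum (fun i => v i * w i).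
Proof.
move=> lv lw; have := asum_inner lv (l2_conj lw).
by under [X in asum X -> _]eq_fun do rewrite conjcK.
Qed.

Lemma inner_CS v w : l2 v -> l2 w -> cabs (inner v w) <= Num.sqrt (nrm2 v * nrm2 w).
Proof.
move=> lv lw; rewrite -lee_fin (le_trans (cabs_csum (asum_inner lv lw)))//.
rewrite (le_trans _ (nsum_CS lv lw))//; apply: le_nsum => i.
by rewrite cabsM cabs_conj.
Qed.

Lemma innerDl v w x : l2 v -> l2 w -> l2 x ->
  inner (fun i => v i + w i) x = inner v x + inner w x.
Proof.
move=> lv lw lx; rewrite /inner -csumD; do ?exact: asum_inner.
by apply: eq_csum => i; rewrite mulrDl.
Qed.

Lemma innerZl (c : R[i]) v x : l2 v -> l2 x -> inner (fun i => c * v i) x = c * inner v x.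
Proof.
move=> lv lx; rewrite /inner -csumZ; do ?exact: asum_inner.
by apply: eq_csum => i; rewrite mulrA.
Qed.

Lemma innerC v w : inner w v = (inner v w)^*.
Proof.
by rewrite /inner -csum_conj; apply: eq_csum => i; rewrite conjM conjcK mulrC.
Qed.

Lemma innerDr v w x : l2 v -> l2 w -> l2 x ->
  inner x (fun i => v i + w i) = inner x v + inner x w.
Proof.
by move=> lv lw lx; rewrite innerC innerDl// conjD -!innerC.
Qed.

Lemma innerZr (c : R[i]) v x : l2 v -> l2 x -> inner x (fun i => c * v i) = c^* * inner x v.
Proof. by move=> lv lx; rewrite innerC innerZl// conjM -innerC. Qed.

Lemma innerNl v x : inner (fun i => - v i) x = - inner v x.
Proof. by rewrite /inner -csumN; apply: eq_csum => i; rewrite mulNr. Qed.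

Lemma innerNr v x : inner x (fun i => - v i) = - inner x v.
Proof. by rewrite innerC innerNl conjN -innerC. Qed.

Lemma innerBl v w x : l2 v -> l2 w -> l2 x ->
  inner (fun i => v i - w i) x = inner v x - inner w x.
Proof. by move=> lv lw lx; rewrite innerDl// ?innerNl//; exact: l2N. Qed.

Lemma inner_suml (T : Type) (r : seq T) (F : T -> I -> R[i]) x :
  (forall t, l2 (F t)) -> l2 x ->
  inner (fun i => \sum_(t <- r) F t i) x = \sum_(t <- r) inner (F t) x.
Proof.
move=> Fl lx; elim: r => [|t r IH].
  rewrite big_nil /inner -[RHS](csum0 R I); apply: eq_csum => i.
  by rewrite big_nil mul0r.
rewrite big_cons -IH -innerDl//; last exact: l2_sum.
by apply: eq_csum => i; rewrite big_cons.
Qed.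

Lemma inner_self v : l2 v -> inner v v = (nrm2 v)%:C.
Proof.
move=> lv; rewrite /inner; under eq_csum do rewrite mulcJ.
by rewrite csum_pos// => i; rewrite exprn_ge0 ?cabs_ge0.
Qed.

Lemma inner_dvecr v j : inner v (dvec j) = v j.
Proof.
rewrite /inner -[RHS](csum1 j); apply: eq_csum => i; rewrite /dvec.
by case: eqP => [->|_]; rewrite ?conjc1 ?conjc0 ?mulr1 ?mulr0.
Qed.

Lemma inner_dvecl v j : inner (dvec j) v = (v j)^*.
Proof. by rewrite innerC inner_dvecr. Qed.

Lemma nrm2_0 : nrm2 (fun=> 0) = 0.
Proof.
apply: complexI; rewrite -inner_self ?l2_0// /inner -[RHS](csum0 R I).
by apply: eq_csum => i; rewrite mul0r.
Qed.

Lemma nrm2D v w : l2 v -> l2 w ->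
  nrm2 (fun i => v i + w i) = nrm2 v + nrm2 w + 2 * complex.Re (inner v w).
Proof.
move=> lv lw; apply: complexI; rewrite -inner_self ?l2D// innerDl ?innerDr//; try exact: l2D.
rewrite (innerC v w) (inner_self lv) (inner_self lw) !realCD -addJ; ring.
Qed.

Lemma nrm2N v : nrm2 (fun i => - v i) = nrm2 v.
Proof. by congr fine; apply: eq_nsum => i; rewrite cabsN. Qed.

Lemma nrm2B v w : l2 v -> l2 w ->
  nrm2 (fun i => v i - w i) = nrm2 v + nrm2 w - 2 * complex.Re (inner v w).
Proof.
by move=> lv lw; rewrite nrm2D ?nrm2N ?innerNr ?ReN ?mulrN//; exact: l2N.
Qed.

Lemma cabs_le_nrm2 v i : l2 v -> cabs (v i) ^+ 2 <= nrm2 v.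
Proof.
move=> lv; rewrite -lee_fin -sqnorm_fin//.
by apply: (@nsum_ge_term _ _ (fun i => cabs (v i) ^+ 2)) => j; rewrite exprn_ge0 ?cabs_ge0.
Qed.

Lemma nrm2_eq0 v : l2 v -> nrm2 v = 0 -> v = fun=> 0.
Proof.
move=> lv v0; apply/funext => i; apply/eqP; rewrite -cabs_eq0.
by have := cabs_le_nrm2 i lv; rewrite v0 exprn_even_le0//=.
Qed.

Lemma nrm2_dvec j : nrm2 (dvec j) = 1.
Proof.
apply: complexI; rewrite -inner_self ?l2_dvec// inner_dvecr /dvec eqxx//.
Qed.

(** Duality by self-testing: if X is a partial sum of |v_i|^2, the hypothesis reads X^2 <= K X.
    Membership in l^2 is thus a conclusion, and the pairing on the left is the form in which an
    operator can be moved to the other side. *)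
Lemma sqnorm_dual v (K : R) : 0 <= K ->
  (forall s, uniq s -> cabs (\sum_(i <- s) v i * (v i)^*) <=
     Num.sqrt (K * \sum_(i <- s) cabs (v i) ^+ 2)) ->
  (sqnorm v <= K%:E)%E.
Proof.
move=> K0 h; apply: nsum_le => s us; rewrite lee_fin.
have := h s us; under eq_bigr do rewrite mulcJ.
rewrite -rmorph_sum/= cabs_real; set X := \sum_(i <- s) _.
have X0 : 0 <= X by apply: sumr_ge0 => i _; rewrite exprn_ge0 ?cabs_ge0.
rewrite ger0_norm// => hX.
have {hX} : X ^+ 2 <= K * X.
  by rewrite -(@sqr_sqrtr _ (K * X)) ?mulr_ge0// ler_pXn2r ?nnegrE ?sqrtr_ge0.
have [->//|Xn0] := eqVneq X 0.
by rewrite expr2 ler_pM2r// lt_neqAle eq_sym Xn0.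
Qed.

End L2.

Section Ops.
Variables (R : realType) (I : choiceType).
Implicit Types (v w x : I -> R[i]) (a b u : opmat R I) (s : seq I).

Definition vres s v : I -> R[i] := fun i => if i \in s then v i else 0.

Lemma vres_out s v i : i \notin s -> vres s v i = 0.
Proof. by rewrite /vres => /negPf ->. Qed.

Lemma l2_vres s v : uniq s -> l2 (vres s v).
Proof. by move=> us; apply: (l2_supp us) => i /(vres_out v). Qed.

Lemma nrm2_supp s v : uniq s -> (forall i, i \notin s -> v i = 0) ->
  nrm2 v = \sum_(i <- s) cabs (v i) ^+ 2.
Proof.
move=> us vs; rewrite /nrm2 sqnormE (@nsum_supp _ _ _ s)//.
  by move=> i; rewrite exprn_ge0 ?cabs_ge0.
by move=> i /vs ->; rewrite cabs0 expr0n.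
Qed.

Lemma nrm2_vres s v : uniq s -> nrm2 (vres s v) = \sum_(i <- s) cabs (v i) ^+ 2.
Proof.
move=> us; rewrite (nrm2_supp us)//; last by move=> i /(vres_out v).
by rewrite big_seq [RHS]big_seq; apply: eq_bigr => i si; rewrite /vres si.
Qed.

Lemma nrm2_vres_le s v : l2 v -> uniq s -> nrm2 (vres s v) <= nrm2 v.
Proof.
move=> lv us; rewrite nrm2_vres// -lee_fin -sqnorm_fin// sqnormE.
exact: (nsum_seq_le (fun i => cabs (v i) ^+ 2) us).
Qed.

Lemma vres_tail v (e : R) : l2 v -> 0 < e -> exists2 s, uniq s &
  nrm2 (fun i => v i - vres s v i) <= e.
Proof.
move=> lv e0; have [|s us se] := @nsum_tail _ _ (fun i => cabs (v i) ^+ 2) e _ lv e0.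
  by move=> i; rewrite exprn_ge0 ?cabs_ge0.
exists s => //; apply: nrm2_le; apply: le_trans se; apply: le_nsum => i; rewrite /vres.
by case: ifP; rewrite ?subrr ?cabs0 ?expr0n ?subr0.
Qed.

Definition l2rows a := forall i, l2 (a i).
Definition l2cols a := forall j, l2 (a^~ j).

(** [C] bounds the square of the operator norm. Rows in l^2 ensure that [opapp a v] involves only
    absolutely convergent sums. *)
Definition bop a (C : R) := [/\ 0 <= C, l2rows a &
  forall v, l2 v -> (sqnorm (opapp a v) <= (C * nrm2 v)%:E)%E].

Lemma opapp_dvec a j i : opapp a (dvec R j) i = a i j.
Proof.
rewrite /opapp -[RHS](csum1 j); apply: eq_csum => k; rewrite /dvec.
by case: eqP => [->|_]; rewrite ?mulr1 ?mulr0.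
Qed.

Lemma opapp_supp a s v i : uniq s -> (forall i, i \notin s -> v i = 0) ->
  opapp a v i = \sum_(j <- s) a i j * v j.
Proof. by move=> us vs; apply: csum_supp => // j /vs ->; rewrite mulr0. Qed.

Lemma opapp_vres a s v i : uniq s -> opapp a (vres s v) i = \sum_(j <- s) a i j * v j.
Proof.
move=> us; rewrite (opapp_supp a i us (fun i => @vres_out s v i)).
by rewrite big_seq [RHS]big_seq; apply: eq_bigr => j sj; rewrite /vres sj.
Qed.

Lemma opappZ a (c : R[i]) v i : l2rows a -> l2 v ->
  opapp a (fun j => c * v j) i = c * opapp a v i.
Proof.
move=> la lv; rewrite /opapp -csumZ; last exact: asum_mul.
by apply: eq_csum => j; rewrite mulrCA.
Qed.

Lemma opappB a v w i : l2rows a -> l2 v -> l2 w ->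
  opapp a (fun j => v j - w j) i = opapp a v i - opapp a w i.
Proof.
move=> la lv lw; rewrite /opapp -csumB; do ?exact: asum_mul.
by apply: eq_csum => j; rewrite mulrBr.
Qed.

Lemma opapp0 a i : opapp a (fun=> 0) i = 0.
Proof. by rewrite /opapp -[RHS](csum0 R I); apply: eq_csum => j; rewrite mulr0. Qed.

Lemma bop_l2 a C v : bop a C -> l2 v -> l2 (opapp a v).
Proof. by move=> [_ _ h] lv; apply: l2_le (h _ lv). Qed.

Lemma bop_nrm2 a C v : bop a C -> l2 v -> nrm2 (opapp a v) <= C * nrm2 v.
Proof. by move=> [_ _ h] lv; apply: nrm2_le (h _ lv). Qed.

Lemma bop_cols a C : bop a C -> l2cols a.
Proof.
move=> ba j; have := bop_l2 ba (l2_dvec R j).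
by rewrite (_ : opapp _ _ = a^~ j)//; apply/funext => i; rewrite opapp_dvec.
Qed.

Lemma opapp_adj a w j : opapp (opadj a) w j = (inner (a^~ j) w)^*.
Proof. by rewrite -innerC /inner /opapp; apply: eq_csum => i; rewrite mulrC. Qed.

Lemma inner_fin a s v w : l2cols a -> l2 w -> uniq s ->
  inner (opapp a (vres s v)) w = \sum_(j <- s) v j * (opapp (opadj a) w j)^*.
Proof.
move=> la lw us.
transitivity (inner (fun i => \sum_(j <- s) v j * a i j) w).
  have -> // : opapp a (vres s v) = fun i => \sum_(j <- s) v j * a i j.
  apply/funext => i; rewrite (opapp_vres a v i us).
  by apply: eq_bigr => j _; rewrite mulrC.
rewrite inner_suml//; last by move=> j; apply: l2Z; exact: la.
by apply: eq_bigr => j _; rewrite innerZl// opapp_adj conjcK.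
Qed.

Lemma sqr_le_sqrt (x y : R) : 0 <= x -> x ^+ 2 <= y -> x <= Num.sqrt y.
Proof. by move=> x0 xy; rewrite -(ger0_norm x0) -sqrtr_sqr ler_wsqrtr. Qed.

(** Pairing the image of w under the adjoint with its own truncation moves the operator onto a
    finitely supported vector, where its bound is available. *)
Lemma bop_adj a C : bop a C -> bop (opadj a) C.
Proof.
move=> ba; have la := bop_cols ba; case: (ba) => C0 _ _.
split => // [j|w lw]; first exact: l2_conj (la j).
apply: sqnorm_dual => [|s us]; first by rewrite mulr_ge0 ?nrm2_ge0.
have := inner_fin (opapp (opadj a) w) la lw us => <-.
have lr := l2_vres (opapp (opadj a) w) us.
rewrite (le_trans (inner_CS (bop_l2 ba lr) lw))// ler_wsqrtr// -nrm2_vres//.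
by rewrite mulrAC ler_wpM2r ?nrm2_ge0// (bop_nrm2 ba lr).
Qed.

Lemma opadjK a : opadj (opadj a) = a.
Proof. by apply/funext => i; apply/funext => j; rewrite /opadj conjcK. Qed.

(** Both sides agree on finitely supported vectors. Hence their difference at v is their difference
    at a tail of v, which Cauchy-Schwarz makes arbitrarily small. *)
Lemma adjP a C v w : bop a C -> l2 v -> l2 w ->
  inner (opapp a v) w = inner v (opapp (opadj a) w).
Proof.
move=> ba lv lw; have ba' := bop_adj ba; have [C0 ra _] := ba.
apply/eqP; rewrite -subr_eq0 -cabs_eq0; set d := cabs _.
have d0 : 0 <= d by exact: cabs_ge0.
rewrite eq_le d0 andbT leNgt; apply/negP => dpos.
have K0 : 0 <= C * nrm2 w by rewrite mulr_ge0 ?nrm2_ge0.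
(* Chosen so that the bound d^2 <= 4 C |w|^2 e reached below contradicts 0 < d. *)
set e := d ^+ 2 / (8 * (C * nrm2 w + 1)).
have e0 : 0 < e by rewrite divr_gt0 ?exprn_gt0// mulr_gt0// ltr_wpDl.
have [s us se] := vres_tail lv e0.
have lr := l2_vres v us; set r := (fun i => _) in se.
have lrr : l2 r by exact: l2B.
have dE : d = cabs (inner (opapp a r) w - inner r (opapp (opadj a) w)).
  congr cabs; rewrite (_ : opapp a r = fun i => opapp a v i - opapp a (vres s v) i); last first.
    by apply/funext => i; rewrite opappB.
  rewrite (innerBl (bop_l2 ba lv) (bop_l2 ba lr) lw) (innerBl lv lr (bop_l2 ba' lw)).
  rewrite (inner_fin _ (bop_cols ba))// (_ : inner (vres s v) _ = \sum_(j <- s) v j * (opapp (opadj a) w j)^*); first by ring.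
  rewrite /inner (csum_supp us); last by move=> i /(vres_out v) ->; rewrite mul0r.
  by rewrite big_seq [RHS]big_seq; apply: eq_bigr => j sj; rewrite /vres sj.
have h1 : cabs (inner (opapp a r) w) <= Num.sqrt (C * nrm2 w * e).
  rewrite (le_trans (inner_CS (bop_l2 ba lrr) lw))// ler_wsqrtr// mulrAC ler_wpM2r ?nrm2_ge0//.
  by rewrite (le_trans (bop_nrm2 ba lrr))// ler_wpM2l.
have h2 : cabs (inner r (opapp (opadj a) w)) <= Num.sqrt (C * nrm2 w * e).
  rewrite (le_trans (inner_CS lrr (bop_l2 ba' lw)))// ler_wsqrtr// mulrC.
  by rewrite ler_pM ?nrm2_ge0// (bop_nrm2 ba' lw).
have h3 : d <= 2 * Num.sqrt (C * nrm2 w * e).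
  by rewrite dE (le_trans (cabsD _ _))// cabsN; lra.
have h4 : d ^+ 2 <= 4 * (C * nrm2 w * e).
  have /(@sqr_sqrtr _) <- : 0 <= C * nrm2 w * e by rewrite mulr_ge0// ltW.
  have := sqrtr_ge0 (C * nrm2 w * e); move: (Num.sqrt _) h3 => q h3 q0.
  have -> : 4 * q ^+ 2 = (2 * q) ^+ 2 by ring.
  by rewrite ler_pXn2r ?nnegrE ?mulr_ge0.
move: h4; rewrite /e mulrA mulrA ler_pdivlMr; last by rewrite mulr_gt0// ltr_wpDl.
have : 0 < d ^+ 2 by rewrite exprn_gt0.
by nra.
Qed.

(** A bound on finitely supported vectors extends to l^2 by duality: a truncation of the image is
    tested against itself, and the resulting pairing with v is approximated by truncating v as
    well. *)
Lemma bop_of_fin a C : 0 <= C ->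
  (forall s v, uniq s -> (forall i, i \notin s -> v i = 0) ->
     (sqnorm (opapp a v) <= (C * nrm2 v)%:E)%E) -> bop a C.
Proof.
move=> C0 h.
have h' s v : uniq s -> nrm2 (opapp a (vres s v)) <= C * \sum_(i <- s) cabs (v i) ^+ 2.
  by move=> us; rewrite -nrm2_vres//; apply: nrm2_le; apply: (h s) => // i /(vres_out v).
have l' s v : uniq s -> l2 (opapp a (vres s v)).
  by move=> us; apply: l2_le (h s _ us _) => i /(vres_out v).
(* Apply [a] to the truncated conjugate of row i: coordinate i of the image is the squared norm of
   that truncation. *)
have la : l2rows a.
  move=> i; apply: (@l2_le _ _ _ C).
  apply: sqnorm_dual => // s us.
  have := @opapp_vres a s (fun j => (a i j)^*) i us => <-.
  apply: sqr_le_sqrt; first exact: cabs_ge0.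
  rewrite (le_trans (cabs_le_nrm2 _ (l' _ _ us)))// (le_trans (h' _ _ us))//.
  by rewrite ler_wpM2l//; under eq_bigr do rewrite cabs_conj.
split => // v lv; have K0 : 0 <= C * nrm2 v by rewrite mulr_ge0 ?nrm2_ge0.
apply: sqnorm_dual => // s us.
set y := opapp a v; set c := fun j => \sum_(i <- s) (y i)^* * a i j.
have lc : l2 c by apply: l2_sum => i; apply: l2Z; exact: la.
have -> : \sum_(i <- s) y i * (y i)^* = csum (fun j => c j * v j).
  rewrite /c; under [RHS]eq_csum do rewrite mulr_suml.
  rewrite (proj1 (csum_sum _ _)); last by move=> i; apply: asum_mul => //; exact: l2Z (la i).
  apply: eq_bigr => i _; rewrite mulrC /y {2}/opapp -csumZ; last exact: asum_mul (la i) lv.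
  by apply: eq_csum => j; rewrite mulrA.
apply/ler_addgt0Pr => e e0.
have [t ut /(_ t ut (fun _ => id)) te] := csum_approx (asum_mul lc lv) e0.
rewrite -[X in cabs X](subrK (\sum_(j <- t) c j * v j)) (le_trans (cabsD _ _))// addrC.
rewrite lerD//.
have -> : \sum_(j <- t) c j * v j = inner (opapp a (vres t v)) (vres s y).
  rewrite /inner (csum_supp us); last by move=> i /(vres_out y) ->; rewrite conjc0 mulr0.
  rewrite [RHS]big_seq [RHS](eq_bigr (fun i => \sum_(j <- t) (y i)^* * a i j * v j)); last first.
    move=> i si; rewrite (opapp_vres a v i ut) mulr_suml; apply: eq_bigr => j _.
    by rewrite /vres si mulrC mulrA.
  rewrite -big_seq exchange_big; apply: eq_bigr => j _; rewrite /c mulr_suml.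
  by apply: eq_bigr.
rewrite (le_trans (inner_CS (l' _ _ ut) (l2_vres _ us)))// ler_wsqrtr// nrm2_vres//.
rewrite ler_wpM2r ?sumr_ge0//; first by move=> i _; rewrite exprn_ge0 ?cabs_ge0.
by rewrite (le_trans (h' _ _ ut))// ler_wpM2l// -nrm2_vres// nrm2_vres_le.
Qed.

Lemma opmul_app a b C v : l2rows a -> bop b C -> l2 v ->
  opapp (opmul a b) v = opapp a (opapp b v).
Proof.
move=> la bb lv; apply/funext => i.
transitivity (inner v (opapp (opadj b) (fun k => (a i k)^*))).
  rewrite /inner /opapp; apply: eq_csum => j; rewrite mulrC -csum_conj; congr (_ * _).
  by apply: eq_csum => k; rewrite conjM /opadj !conjcK mulrC.
rewrite -(adjP bb)//; last exact: l2_conj (la i).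
by rewrite /inner /opapp; apply: eq_csum => j; rewrite conjcK mulrC.
Qed.

Lemma bop_mul a b C D : bop a C -> bop b D -> bop (opmul a b) (C * D).
Proof.
move=> ba bb; have [C0 la _] := ba; have [D0 _ _] := bb.
split; first exact: mulr_ge0.
  move=> i; have := l2_conj (bop_l2 (bop_adj bb) (l2_conj (la i))).
  congr l2; apply/funext => j; rewrite /opapp -csum_conj; apply: eq_csum => k.
  by rewrite conjM /opadj !conjcK mulrC.
move=> v lv; rewrite (opmul_app la bb lv) sqnorm_fin; last exact: (bop_l2 ba (bop_l2 bb lv)).
rewrite lee_fin (le_trans (bop_nrm2 ba (bop_l2 bb lv)))// -mulrA ler_wpM2l//.
exact: (bop_nrm2 bb lv).
Qed.

Lemma opapp1 v : opapp (@op1 R I) v = v.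
Proof.
apply/funext => i; rewrite /opapp -[RHS](csum1 i); apply: eq_csum => j; rewrite /op1.
by rewrite eq_sym; case: eqP => [->|_]; rewrite ?mul1r ?mul0r.
Qed.

(** If v is not in l^2, the junk value of this sum is 0; a nonzero value therefore certifies square
    summability. In this way the matrix equations of [unitary_op] force the columns to lie in
    l^2. *)
Lemma sqnorm_of_csum v (x : R[i]) :
  csum (fun i => (v i)^* * v i) = x -> x != 0 -> l2 v.
Proof.
move=> <- x0; rewrite /l2 ltey; apply/eqP => vo; move/eqP: x0; apply.
rewrite /csum; apply/eqP; rewrite eq_complex.
have E i : (v i)^* * v i = (cabs (v i) ^+ 2)%:C by rewrite mulrC mulcJ.
have c0 i : 0 <= cabs (v i) ^+ 2 by rewrite exprn_ge0 ?cabs_ge0.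
apply/andP; split; apply/eqP => /=.
  under [X in rsum X]eq_fun do rewrite E; rewrite /rsum -/(nsum _) -/(nsum _).
  rewrite (eq_nsum (g := fun i => cabs (v i) ^+ 2)%R); last by move=> i /=; rewrite max_l.
  rewrite -sqnormE vo (eq_nsum (g := fun=> 0)%R) ?nsum0 ?subrr//.
  by move=> i /=; rewrite max_r// oppr_le0.
under [X in rsum X]eq_fun do rewrite E; rewrite /rsum -/(nsum _) -/(nsum _) /=.
by rewrite oppr0 subrr.
Qed.

Lemma bop_isometry u : l2cols u ->
  (forall j k, inner (u^~ j) (u^~ k) = (j == k)%:R) -> bop u 1.
Proof.
move=> lu uo; apply: bop_of_fin => // s v us vs; rewrite mul1r.
have e : opapp u v = fun i => \sum_(j <- s) v j * u i j.
  apply/funext => i; rewrite (opapp_supp _ _ us vs).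
  by apply: eq_bigr => j _; rewrite mulrC.
have lj j : l2 (fun i => v j * u i j) by exact: l2Z (lu j).
have lS : l2 (opapp u v) by rewrite e; apply: l2_sum.
rewrite sqnorm_fin// lee_fin -lecR -inner_self// {1}e inner_suml//.
rewrite (nrm2_supp us vs) realC_sum ler_sum// => j _.
rewrite innerZl// innerC e inner_suml//.
rewrite (eq_bigr (fun k => v k * (k == j)%:R)); last first.
  by move=> k _; rewrite innerZl ?uo.
have [js|jn] := boolP (j \in s); last by rewrite vs// !mul0r cabs0 expr0n.
rewrite (bigD1_seq j)//= eqxx mulr1 big1 ?addr0 ?mulcJ//.
by move=> k /negPf ->; rewrite mulr0.
Qed.

Section Unitary.
Variable u : opmat R I.
Hypothesis Uu : unitary_op u.

Lemma unitary_cols : l2cols u.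
Proof.
move=> j; have := congr1 (fun m : opmat R I => m j j) (proj1 Uu).
by rewrite /op1 eqxx => /sqnorm_of_csum; apply; exact: oner_neq0.
Qed.

Lemma unitary_inner j k : inner (u^~ j) (u^~ k) = (j == k)%:R.
Proof.
have := congr1 (fun m : opmat R I => m k j) (proj1 Uu).
rewrite /op1 eq_sym => <-; rewrite /inner /opmul /opadj.
by apply: eq_csum => i; rewrite mulrC.
Qed.

Lemma unitary_bop : bop u 1.
Proof. exact: bop_isometry unitary_cols unitary_inner. Qed.

Lemma unitary_adjK v : l2 v -> opapp u (opapp (opadj u) v) = v.
Proof.
have bu := unitary_bop; have [_ ru _] := bu.
by move=> lv; rewrite -(opmul_app ru (bop_adj bu) lv) (proj2 Uu) opapp1.
Qed.

Lemma unitary_Kadj v : l2 v -> opapp (opadj u) (opapp u v) = v.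
Proof.
have bu := unitary_bop; have [_ ru _] := bop_adj bu.
by move=> lv; rewrite -(opmul_app ru bu lv) (proj1 Uu) opapp1.
Qed.

Lemma unitary_nrm2 j : nrm2 (u^~ j) = 1.
Proof. by apply: complexI; rewrite -inner_self ?unitary_inner ?eqxx//; exact: unitary_cols. Qed.

End Unitary.
End Ops.

(** * Sums of rank one operators *)

Section PowerConcave.
Variables (R : realType) (p : R).
Hypotheses (p0 : 0 < p) (p1 : p < 1).
Implicit Types a b c x y : R.

Lemma le_powR x y : 0 <= x -> x <= y -> x `^ p <= y `^ p.
Proof.
by move=> x0 xy; apply: ge0_ler_powR; rewrite ?nnegrE ?(ltW p0) ?(le_trans x0).
Qed.

Lemma powR_tangent1 y : 0 <= y -> y `^ p <= 1 + p * (y - 1).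
Proof.
move=> y0; have q0 : 0 < 1 - p by rewrite subr_gt0.
(* Young's inequality with exponents 1/p and 1/(1-p) for the product of y^p and 1. *)
have := @conjugate_powR R (y `^ p) 1 p^-1 (1 - p)^-1 (powR_ge0 _ _) ler01.
rewrite !invr_gt0 !invrK powR1 -powRrM mulfV ?gt_eqF// powRr1// mulr1.
by rewrite mul1r subrKC => /(_ p0 q0 erefl); lra.
Qed.

Lemma powR_tangent b x : 0 < b -> 0 <= x ->
  x `^ p <= b `^ p + p * b `^ p / b * (x - b).
Proof.
move=> b0 x0; have y0 : 0 <= x / b by rewrite divr_ge0// ltW.
have -> : b `^ p + p * b `^ p / b * (x - b) = b `^ p * (1 + p * (x / b - 1)).
  by field; rewrite gt_eqF.
rewrite -{1}(divfK (lt0r_neq0 b0) x) mulrC powRM ?(ltW b0)//.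
by rewrite ler_wpM2l ?powR_ge0// powR_tangent1.
Qed.

(** The slope of the tangent at b separates the slopes of the two chords. *)
Lemma powR_slopes a b c : 0 <= a -> a < b -> b < c ->
  (c `^ p - b `^ p) * (b - a) <= (b `^ p - a `^ p) * (c - b).
Proof.
move=> a0 ab bc; have b0 : 0 < b by exact: le_lt_trans ab.
have c0 : 0 <= c by rewrite ltW// (lt_trans b0).
have := powR_tangent b0 a0; have := powR_tangent b0 c0.
move: (p * b `^ p / b) => m h1 h2.
apply: (@le_trans _ _ (m * (c - b) * (b - a))); first by rewrite ler_wpM2r; lra.
have -> : m * (c - b) * (b - a) = m * (b - a) * (c - b) by ring.
by rewrite ler_wpM2r; lra.
Qed.

Lemma powR_chord a b x : 0 <= a -> a <= x -> x <= b -> a < b ->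
  (b `^ p - a `^ p) / (b - a) * (x - a) <= x `^ p - a `^ p.
Proof.
move=> a0 ax xb ab; rewrite mulrAC ler_pdivrMr ?subr_gt0//.
have [->|xa] := eqVneq x a; first by rewrite !subrr mulr0 mul0r.
have [->|xb'] := eqVneq x b; first by [].
have ax' : a < x by rewrite lt_neqAle eq_sym xa.
have xb2 : x < b by rewrite lt_neqAle xb'.
have := powR_slopes a0 ax' xb2; nra.
Qed.

(** Because t <= t^p on [0,1], the power z^p is at least the share z / (x + y) of (x + y)^p, and the
    shares of x and y add up to 1. *)
Lemma powRD_le x y : 0 <= x -> 0 <= y -> (x + y) `^ p <= x `^ p + y `^ p.
Proof.
move=> x0 y0; have [s0|s0] := eqVneq (x + y) 0.
  by rewrite s0 powR0 ?gt_eqF// addr_ge0 ?powR_ge0.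
have sp : 0 < x + y by rewrite lt_neqAle eq_sym s0 addr_ge0.
have H z : 0 <= z -> z <= x + y -> z / (x + y) * (x + y) `^ p <= z `^ p.
  move=> z0 zs; rewrite -{2}(divfK (lt0r_neq0 sp) z) powRM ?divr_ge0 ?(ltW sp)//.
  rewrite ler_wpM2r ?powR_ge0//.
  have [->|zn0] := eqVneq z 0; first by rewrite mul0r powR_ge0.
  apply: ger1_powR; last exact: ltW.
  have zp : 0 < z by rewrite lt_neqAle eq_sym zn0.
  by rewrite divr_gt0//= ler_pdivrMr// mul1r.
have := lerD (H x x0 _) (H y y0 _).
rewrite -mulrDl -mulrDl mulfV// mul1r; apply; by rewrite ?lerDl ?lerDr.
Qed.

Lemma powR_sum_le (T : Type) (r : seq T) (F : T -> R) : (forall t, 0 <= F t) ->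
  (\sum_(t <- r) F t) `^ p <= \sum_(t <- r) F t `^ p.
Proof.
move=> F0; elim: r => [|t r IH]; first by rewrite !big_nil powR0 ?gt_eqF.
by rewrite !big_cons (le_trans (powRD_le _ _))// ?sumr_ge0// lerD2l.
Qed.

(* The piecewise linear interpolation of the power function minus its value at
   [a] with nodes [a :: ls], as a combination of truncations. *)
Fixpoint interp a (ls : seq R) (g : R -> R) : R :=
  if ls is b :: ls' then
    (b `^ p - a `^ p) / (b - a) * (g b - g a) + interp b ls' g
  else 0.

Lemma slope_ge0 a b : 0 <= a -> a < b -> 0 <= (b `^ p - a `^ p) / (b - a).
Proof.
by move=> a0 ab; rewrite divr_ge0 ?subr_ge0 ?le_powR// ltW.
Qed.

(** Abel summation: the values of g at the nodes [ls] get differences of consecutive slopes as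
    weights, which concavity makes nonnegative; the added term cancels the negative weight of g at
    the first node [a]. *)
Lemma interp_abel a ls g : 0 <= a -> path <%R a ls -> (forall x, 0 <= x -> 0 <= g x) ->
  0 <= interp a ls g + (if ls is b :: _ then (b `^ p - a `^ p) / (b - a) else 0) * g a.
Proof.
move=> + + g0; elim: ls a => [|b ls IH] a a0 /=; first by rewrite mul0r addr0.
move=> /andP[ab bls]; have b0 : 0 <= b by rewrite (le_trans a0)// ltW.
have := IH b b0 bls; have s1 := slope_ge0 a0 ab.
have gb := g0 b b0; have ga := g0 a a0.
case: ls bls {IH} => [|c ls] bls; first by rewrite /= mul0r !addr0; nra.
have bc : b < c by case/andP: bls.
have s2 : (c `^ p - b `^ p) / (c - b) <= (b `^ p - a `^ p) / (b - a).
  rewrite ler_pdivrMr ?subr_gt0// mulrAC ler_pdivlMr ?subr_gt0//.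
  exact: powR_slopes.
move: s1 s2; move: ((c `^ p - b `^ p) / (c - b)) ((b `^ p - a `^ p) / (b - a)) => d2 d1.
by move: (interp b _ g) => h d10 d12 h0; nra.
Qed.

Lemma interp_low a ls x : path <%R a ls -> x <= a -> interp a ls (Num.min x) = 0.
Proof.
elim: ls a => [//|b ls IH] a /= /andP[ab bls] xa.
have xb : x <= b by rewrite (le_trans xa)// ltW.
by rewrite IH// !min_l// subrr mulr0 add0r.
Qed.

Lemma interp_node a ls x : path <%R a ls -> x \in ls ->
  interp a ls (Num.min x) = x `^ p - a `^ p.
Proof.
elim: ls a => [//|b ls IH] a /= /andP[ab bls].
have nz : b - a != 0 by rewrite subr_eq0 gt_eqF.
rewrite inE => /predU1P[->|xls].
  by rewrite interp_low// addr0 minxx min_r ?(ltW ab)// divfK.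
have bx : b < x by have /allP := order_path_min lt_trans bls; exact.
rewrite IH// min_r ?(ltW bx)// min_r ?(ltW (lt_trans ab bx))// divfK//; ring.
Qed.

Lemma interp_le a ls x : 0 <= a -> path <%R a ls -> a <= x ->
  interp a ls (Num.min x) <= x `^ p - a `^ p.
Proof.
elim: ls a => [|b ls IH] a a0 /=.
  by move=> _ ax; rewrite subr_ge0 le_powR.
move=> /andP[ab bls] ax; have b0 : 0 <= b by rewrite (le_trans a0)// ltW.
have nz : b - a != 0 by rewrite subr_eq0 gt_eqF.
rewrite [Num.min x a]min_r//.
have [bx|/ltW xb] := leP b x.
  by have := IH b b0 bls bx; rewrite divfK//; lra.
by rewrite interp_low// addr0; exact: powR_chord.
Qed.

Lemma interpD a ls g h : interp a ls (fun x => g x - h x) = interp a ls g - interp a ls h.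
Proof. by elim: ls a => [|b ls IH] a /=; rewrite ?subrr// IH; ring. Qed.

Lemma interp_sum (T : Type) (r : seq T) a ls (g : T -> R -> R) :
  interp a ls (fun x => \sum_(t <- r) g t x) = \sum_(t <- r) interp a ls (g t).
Proof.
elim: ls a => [|b ls IH] a /=; first by rewrite big1.
by rewrite IH -sumrB mulr_sumr -big_split.
Qed.

Lemma interp_ge0 a ls x : 0 <= a -> path <%R a ls -> 0 <= interp a ls (Num.min x).
Proof.
elim: ls a => [//|b ls IH] a a0 /= /andP[ab bls].
have b0 : 0 <= b by rewrite (le_trans a0)// ltW.
rewrite addr_ge0 ?IH// mulr_ge0 ?slope_ge0// subr_ge0 le_min !ge_min lexx/=.
by rewrite (ltW ab) orbT.
Qed.

Lemma interp_nsum (K : choiceType) (t : K -> R) a ls : 0 <= a -> path <%R a ls ->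
  (forall k, 0 <= t k) -> (forall x : R, 0 <= x -> (nsum (fun k => Num.min (t k) x)%R < +oo)%E) ->
  nsum (fun k => interp a ls (Num.min (t k)))%R =
  (interp a ls (fun x => fine (nsum (fun k => Num.min (t k) x)%R)))%:E.
Proof.
move=> + + t0 too; elim: ls a => [|b ls IH] a a0 /=; first by rewrite nsum0.
move=> /andP[ab bls]; have b0 : 0 <= b by rewrite (le_trans a0)// ltW.
have m0 x k : 0 <= x -> 0 <= Num.min (t k) x by move=> x0; rewrite le_min t0.
have mab k : 0 <= Num.min (t k) b - Num.min (t k) a.
  by rewrite subr_ge0 le_min !ge_min lexx/= (ltW ab) orbT.
rewrite nsumD; last 2 first.
- by move=> k; rewrite mulr_ge0 ?slope_ge0.
- by move=> k; exact: interp_ge0.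
rewrite IH// nsumZ ?slope_ge0//.
suff -> : nsum (fun k => Num.min (t k) b - Num.min (t k) a)%R =
    (fine (nsum (fun k => Num.min (t k) b)%R) - fine (nsum (fun k => Num.min (t k) a)%R))%:E.
  by rewrite EFinD EFinM.
have : nsum (fun k => (Num.min (t k) b - Num.min (t k) a) + Num.min (t k) a)%R =
       nsum (fun k => Num.min (t k) b)%R.
  by apply: eq_nsum => k; rewrite subrK.
rewrite nsumD//; last by move=> k; exact: m0.
rewrite (nsum_fin (f := fun k => Num.min (t k) a)) ?too//; last by move=> k; exact: m0.
rewrite (nsum_fin (f := fun k => Num.min (t k) b)) ?too//; last by move=> k; exact: m0.
rewrite /=; have := nsum_ge0 mab.
case: (nsum (fun k => Num.min (t k) b - Num.min (t k) a)%R) => [x||]//= _ [] <-.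
by rewrite addrK.
Qed.

(** Interpolate the power function at the values of s: the interpolation is exact at the s_j, lies
    below the power at the t_k, and is a positive combination of truncations, for which the
    inequality is assumed. *)
Lemma pow_sum_of_trunc n (K : choiceType) (s : 'I_n -> R) (t : K -> R) :
  (forall j, 0 <= s j) -> (forall k, 0 <= t k) -> (nsum t < +oo)%E ->
  (forall x, 0 < x -> ((\sum_j Num.min (s j) x)%:E <= nsum (fun k => Num.min (t k) x)%R)%E) ->
  ((\sum_j s j `^ p)%:E <= nsum (fun k => t k `^ p)%R)%E.
Proof.
move=> s0 t0 too H.
(* The nodes are the distinct positive values of [s], in increasing order. *)
set ls := sort <=%R (undup [seq x <- codom s | 0 < x]).
have ls_path : path <%R 0 ls.
  rewrite path_min_sorted; first by rewrite /ls sort_lt_sorted undup_uniq.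
  by apply/allP => x; rewrite mem_sort mem_undup mem_filter => /andP[].
have too' x : 0 <= x -> (nsum (fun k => Num.min (t k) x)%R < +oo)%E.
  by move=> x0; apply: le_lt_trans too; apply: le_nsum => k; rewrite ge_min lexx.
have E j : s j `^ p = interp 0 ls (Num.min (s j)).
  have [->|sn0] := eqVneq (s j) 0.
    by rewrite powR0 ?gt_eqF// interp_low.
  rewrite interp_node// ?powR0 ?gt_eqF ?subr0//.
  by rewrite mem_sort mem_undup mem_filter codom_f lt_neqAle eq_sym sn0 s0.
apply: (@le_trans _ _ (nsum (fun k => interp 0 ls (Num.min (t k)))%R)); last first.
  apply: le_nsum => k; rewrite (le_trans (interp_le _ ls_path (t0 k)))//.
  by rewrite powR0 ?gt_eqF ?subr0.
rewrite interp_nsum// lee_fin (eq_bigr _ (fun j _ => E j)) -interp_sum -subr_ge0 -interpD.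
(* The excess of the truncated sums of t over those of s; it vanishes at 0, so the boundary term of
   [interp_abel] disappears. *)
set g := fun x => _.
have g0 x : 0 <= x -> 0 <= g x.
  move=> x0; rewrite /g subr_ge0; have [->|xn0] := eqVneq x 0.
    rewrite big1; last by move=> j _; rewrite min_r.
    by rewrite fine_ge0// nsum_ge0// => k; rewrite le_min t0 lexx.
  rewrite -lee_fin -nsum_fin ?too'//; last by move=> k; rewrite le_min t0.
  by apply: H; rewrite lt_neqAle eq_sym xn0.
have := interp_abel (lexx 0) ls_path g0; have -> : g 0 = 0; last by rewrite mulr0 addr0.
rewrite /g big1 ?subr0; last by move=> j _; rewrite min_r.
by rewrite (eq_nsum (g := fun=> 0)%R) ?nsum0// => k; rewrite min_r.
Qed.

(** The terms are bounded by some M, and t = t^(1-p) t^p <= M^(1-p) t^p. *)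
Lemma nsum_of_pow (K : choiceType) (t : K -> R) : (forall k, 0 <= t k) ->
  (nsum (fun k => t k `^ p)%R < +oo)%E -> (nsum t < +oo)%E.
Proof.
move=> t0 too; have tp0 k : 0 <= t k `^ p by exact: powR_ge0.
set M := fine (nsum (fun k => t k `^ p)%R) `^ p^-1.
have tM k : t k <= M.
  have -> : t k = (t k `^ p) `^ p^-1 by rewrite -powRrM mulfV ?gt_eqF// powRr1.
  apply: ge0_ler_powR; rewrite ?nnegrE ?invr_ge0 ?powR_ge0 ?(ltW p0)//.
    by rewrite fine_ge0// nsum_ge0.
  by rewrite -lee_fin -nsum_fin//; exact: (nsum_ge_term k tp0).
apply: (@le_lt_trans _ _ (nsum (fun k => M `^ (1 - p) * t k `^ p)%R)).
  apply: le_nsum => k; have [->|tn0] := eqVneq (t k) 0.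
    by rewrite mulr_ge0 ?powR_ge0.
  rewrite -{1}(powRr1 (t0 k)) -[X in _ `^ X](subrK p) powRD ?tn0 ?implybT//.
  by rewrite ler_wpM2r// ge0_ler_powR ?nnegrE ?subr_ge0 ?(ltW p1) ?powR_ge0.
by rewrite nsumZ ?powR_ge0// lte_mul_pinfty ?lee_fin ?ltry ?powR_ge0.
Qed.

End PowerConcave.

(** * Compressing a diagonal matrix away from finitely many rank one terms *)

Section Compression.
Variable R : realType.
Local Notation C := R[i].

Definition adjmx m n (A : 'M[C]_(m, n)) : 'M[C]_(n, m) := map_mx (@conjc R) A^T.

Lemma adjmxM m n k (A : 'M[C]_(m, n)) (B : 'M[C]_(n, k)) :
  adjmx (A *m B) = adjmx B *m adjmx A.
Proof. by rewrite /adjmx trmx_mul map_mxM. Qed.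

Lemma adjmxK m n (A : 'M[C]_(m, n)) : adjmx (adjmx A) = A.
Proof. by apply/matrixP => i j; rewrite !mxE conjcK. Qed.

Lemma adjmxB m n (A B : 'M[C]_(m, n)) : adjmx (A - B) = adjmx A - adjmx B.
Proof. by apply/matrixP => i j; rewrite !mxE rmorphB. Qed.

Lemma adjmx_realZ m n (x : R) (A : 'M[C]_(m, n)) : adjmx (x%:C *: A) = x%:C *: adjmx A.
Proof. by apply/matrixP => i j; rewrite !mxE rmorphM/= oppr0. Qed.

Lemma adjmx1 n : adjmx (1%:M : 'M[C]_n) = 1%:M.
Proof. by apply/matrixP => i j; rewrite !mxE eq_sym conjc_nat. Qed.

Definition sqcol n (y : 'cV[C]_n) : R := \sum_i cabs (y i 0) ^+ 2.

Lemma sqcol_ge0 n (y : 'cV[C]_n) : 0 <= sqcol y.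
Proof. by apply: sumr_ge0 => i _; rewrite exprn_ge0 ?cabs_ge0. Qed.

Lemma adjmx_sqcol n (y : 'cV[C]_n) : adjmx y *m y = (sqcol y)%:C%:M.
Proof.
apply/matrixP => i j; rewrite !ord1 !mxE eqxx mulr1n realC_sum.
by apply: eq_bigr => k _; rewrite !mxE mulrC mulcJ.
Qed.

Lemma sqcol_eq0 n (y : 'cV[C]_n) : (sqcol y == 0) = (y == 0).
Proof.
apply/eqP/eqP => [y0|->]; last first.
  by apply: big1 => i _; rewrite mxE cabs0 expr0n.
apply/colP => i; rewrite mxE; apply/eqP; rewrite -cabs_eq0.
have /psumr_eq0P : \sum_i cabs (y i 0) ^+ 2 = 0 by [].
by move=> /(_ (fun i _ => exprn_ge0 2 (cabs_ge0 _)) i isT)/eqP; rewrite expf_eq0.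
Qed.

(** Gram-Schmidt carried out on projections: a new vector x is killed by subtracting the rank one
    projection onto P x, which lowers the trace by 1. *)
Lemma kill_proj n (xs : seq 'cV[C]_n) : exists P : 'M[C]_n,
  [/\ P *m P = P, adjmx P = P, forall x, x \in xs -> P *m x = 0 &
      n%:R - (size xs)%:R <= complex.Re (\tr P)].
Proof.
elim: xs => [|x xs [P [PP aP Pxs trP]]].
  exists 1%:M; split => //; first by rewrite mulmx1.
    by rewrite adjmx1.
  by rewrite mxtrace1 subr0 -(rmorph_nat (real_complex R)).
have [y0|y0] := eqVneq (P *m x) 0.
  exists P; split => // [z|]; first by rewrite inE => /predU1P[->|/Pxs].
  by rewrite (le_trans _ trP)//= lerD2l lerN2 ler_nat.
set y := P *m x in y0; set N := sqcol y.
have N0 : N != 0 by rewrite sqcol_eq0.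
have Py : P *m y = y by rewrite /y mulmxA PP.
have yP : adjmx y *m P = adjmx y by rewrite -{1}aP -adjmxM Py.
have yy : adjmx y *m y = N%:C%:M by exact: adjmx_sqcol.
have yx : adjmx y *m x = N%:C%:M by rewrite -yy -{1}yP -mulmxA.
have Nc : N^-1%:C * N%:C = 1 :> C by rewrite -realCM mulVf.
set Y := y *m adjmx y.
exists (P - N^-1%:C *: Y); split.
- rewrite mulmxBl !mulmxBr PP -!scalemxAr -!scalemxAl.
  have PY : P *m Y = Y by rewrite /Y mulmxA Py.
  have YP : Y *m P = Y by rewrite /Y -mulmxA yP.
  have YY : Y *m Y = N%:C *: Y.
    by rewrite /Y mulmxA -[y *m adjmx y *m y]mulmxA yy mul_mx_scalar scalemxAl.
  by rewrite PY YP YY !scalerA -mulrA Nc mulr1 subrr subr0.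
- by rewrite adjmxB aP adjmx_realZ /Y adjmxM adjmxK.
- move=> z; rewrite inE mulmxBl -scalemxAl /Y => /predU1P[->|zs].
    by rewrite -mulmxA yx mul_mx_scalar scalerA Nc scale1r subrr.
  by rewrite -mulmxA -yP -(mulmxA _ P) Pxs// !mulmx0 scaler0 subr0.
- rewrite raddfB/= mxtraceZ mxtrace_mulC yy mxtrace_scalar mulr1n Nc.
  rewrite ReD ReN/=; move: trP => /=; rewrite -natr1; lra.
Qed.

(** [be k] and [al k] stand for the coordinates of the two vectors of the k-th rank one term with
    respect to the left and right singular vectors; [diag] says that in these coordinates the sum of
    the terms is the diagonal matrix of the s_j. *)
Variables (n : nat) (K : choiceType) (s : 'I_n -> R) (c : K -> C) (be al : K -> 'I_n -> C).
Hypotheses (s0 : forall j, 0 <= s j) (cs : asum c).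
Hypotheses (be1 : forall k, \sum_j cabs (be k j) ^+ 2 <= 1).
Hypotheses (al1 : forall k, \sum_j cabs (al k j) ^+ 2 <= 1).
Hypothesis diag : forall j l,
  csum (fun k => c k * (be k l * (al k j)^*)) = (j == l)%:R * (s j)%:C.

Let entry1 (f : 'I_n -> C) j : \sum_j cabs (f j) ^+ 2 <= 1 -> cabs (f j) <= 1.
Proof.
move=> f1; rewrite -(@ler_pXn2r _ 2)// ?nnegrE ?cabs_ge0// expr1n (le_trans _ f1)//.
by rewrite (bigD1 j)//= lerDl sumr_ge0// => i _; rewrite exprn_ge0 ?cabs_ge0.
Qed.

(** The left side is the real part of the trace of P times the diagonal matrix, that is, of the sum
    of the c_k d_k with d_k the pairing of P [be k] with [al k]. Here |d_k| <= 1, and d_k = 0 for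
    the killed terms. *)
Lemma diag_proj_le (P : 'M[C]_n) (B : seq K) : P *m P = P -> adjmx P = P ->
  (forall k, k \in B -> P *m (\col_l be k l) = 0) ->
  ((\sum_j complex.Re (P j j) * s j)%:E <=
    nsum (fun k => if k \in B then 0 else cabs (c k))%R)%E.
Proof.
move=> PP aP PB.
set d := fun k => \sum_j (P *m (\col_l be k l)) j 0 * (al k j)^*.
have dB k : k \in B -> d k = 0.
  by move=> /PB dk; rewrite /d dk; apply: big1 => j _; rewrite mxE mul0r.
(* Pythagoras for P and 1 - P. *)
have sqP (b : 'cV[C]_n) : sqcol (P *m b) <= sqcol b.
  have e (Q : 'M[C]_n) : Q *m Q = Q -> adjmx Q = Q ->
      adjmx b *m Q *m b = (sqcol (Q *m b))%:C%:M.
    by move=> QQ aQ; rewrite -adjmx_sqcol adjmxM aQ -{1}QQ !mulmxA.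
  have e1 := e _ PP aP.
  have := e (1%:M - P) _ _; rewrite !mulmxBl !mul1mx !mulmxBr !mulmx1 PP subrr subr0.
  rewrite adjmxB adjmx1 aP => /(_ erefl erefl); rewrite mulmxBl adjmx_sqcol e1 => e2.
  have := congr1 (fun M : 'M[C]_1 => complex.Re (M 0 0)) e2; rewrite !mxE eqxx !mulr1n/=.
  by have := sqcol_ge0 (b - P *m b); lra.
have d1 k : cabs (d k) <= 1.
  rewrite /d (le_trans (cabs_sum _ _ _))//.
  apply: (@le_trans _ _ (\sum_j (cabs ((P *m (\col_l be k l)) j 0) ^+ 2 + cabs (al k j) ^+ 2) / 2)).
    apply: ler_sum => j _; rewrite cabsM cabs_conj.
    by have := sqr_ge0 (cabs ((P *m (\col_l be k l)) j 0) - cabs (al k j)); lra.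
  rewrite -mulr_suml big_split/= ler_pdivrMr// mul1r -[2](natrD _ 1 1).
  rewrite lerD// (le_trans (sqP _))// (le_trans _ (be1 k))//.
  by apply: ler_sum => j _; rewrite mxE.
have cds : asum (fun k => c k * d k).
  apply: (@asum_le _ _ _ (fun k => cabs (c k))) => // k.
  by rewrite cabsM ler_piMr ?cabs_ge0.
have E : (\sum_j complex.Re (P j j) * s j) = complex.Re (csum (fun k => c k * d k)).
  have -> : csum (fun k => c k * d k) =
      csum (fun k => \sum_j \sum_l P j l * (c k * (be k l * (al k j)^*))).
    apply: eq_csum => k; rewrite /d mulr_sumr; apply: eq_bigr => j _.
    rewrite mxE mulr_suml mulr_sumr; apply: eq_bigr => l _; rewrite mxE; ring.
  have as1 j l : asum (fun k => c k * (be k l * (al k j)^*)).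
    apply: (@asum_le _ _ _ (fun k => cabs (c k))) => // k.
    by rewrite !cabsM cabs_conj ler_piMr ?cabs_ge0// mulr_ile1 ?cabs_ge0 ?entry1.
  have as2 j : asum (fun k => \sum_l P j l * (c k * (be k l * (al k j)^*))).
    by have [] := @csum_sum R K _ (index_enum 'I_n) (fun l k => P j l * (c k * (be k l * (al k j)^*)))
      (fun l => asumZ _ (as1 j l)).
  rewrite (proj1 (csum_sum _ as2)) Re_sum; apply: eq_bigr => j _.
  rewrite (proj1 (csum_sum _ (fun l => asumZ _ (as1 j l)))).
  rewrite (eq_bigr (fun l => P j l * ((j == l)%:R * (s j)%:C))); last first.
    by move=> l _; rewrite csumZ// diag.
  rewrite (bigD1 j)//= eqxx mul1r big1 ?addr0; last first.
    by move=> l; rewrite eq_sym => /negPf ->; rewrite mul0r mulr0.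
  by rewrite [in RHS]mulrC Re_realM mulrC.
rewrite E; apply: (@le_trans _ _ (cabs (csum (fun k => c k * d k)))%:E).
  by rewrite lee_fin (le_trans _ (cabs_Re _))// ler_norm.
apply: (le_trans (cabs_csum cds)); apply: le_nsum => k; case: ifPn => [/dB ->|_].
  by rewrite mulr0 cabs0.
by rewrite cabsM ler_piMr ?cabs_ge0.
Qed.

(** Let P kill the terms with |c_k| > x. The trace lost is at most their number, so what is lost
    costs at most x for each of them, and what remains is bounded by the sum of the other |c_k|:
    together this is the sum of the min(|c_k|, x). *)
Lemma trunc_sum_le (x : R) : 0 < x ->
  ((\sum_j Num.min (s j) x)%:E <= nsum (fun k => Num.min (cabs (c k)) x)%R)%E.
Proof.
move=> x0; have [|S0 uS0 hS0] := @nsum_tail _ _ (fun k => cabs (c k)) x _ cs x0.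
  by move=> k; exact: cabs_ge0.
set B := [seq k <- S0 | x < cabs (c k)].
have uB : uniq B by rewrite filter_uniq.
(* Outside [S0] the whole sum is at most x, hence so is each term: filtering [S0] misses no large
   term. *)
have inB k : (k \in B) = (x < cabs (c k)).
  rewrite mem_filter; apply: andb_idr => xk; apply: contraTT xk => kS.
  rewrite -leNgt -lee_fin; apply: le_trans hS0.
  have := @nsum_ge_term _ _ (fun i => if i \in S0 then 0 else cabs (c i)) k.
  by rewrite (negPf kS); apply => i; case: ifP; rewrite ?cabs_ge0.
have [P [PP aP PB trP]] := kill_proj [seq \col_l be k l | k <- B].
have {}PB k : k \in B -> P *m (\col_l be k l) = 0.
  by move=> kB; apply: PB; apply/mapP; exists k.
have dg (Q : 'M[C]_n) j : Q *m Q = Q -> adjmx Q = Q -> 0 <= complex.Re (Q j j).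
  move=> QQ aQ; rewrite -QQ -{1}aQ mxE Re_sum sumr_ge0// => k _.
  by rewrite !mxE mulrC mulcJ/= exprn_ge0 ?cabs_ge0.
set q := fun j => complex.Re (P j j).
have q0 j : 0 <= q j by exact: dg.
have q1 j : q j <= 1.
  have := @dg (1%:M - P) j; rewrite !mulmxBl !mul1mx !mulmxBr !mulmx1 PP subrr subr0.
  rewrite adjmxB adjmx1 aP => /(_ erefl erefl).
  by rewrite !mxE eqxx ReD ReN/= subr_ge0.
have := diag_proj_le PP aP PB; set T := nsum _ => hT.
have T0 : (0 <= T)%E by apply: nsum_ge0 => k; case: ifP; rewrite ?cabs_ge0.
have mfin : nsum (fun k => Num.min (cabs (c k)) x)%R = ((x * (size B)%:R)%:E + T)%E.
  rewrite (nsumID (mem B)); last by move=> k; rewrite le_min cabs_ge0 ltW.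
  congr (_ + _)%E.
    rewrite (@nsum_supp _ _ _ B)//; last 2 first.
    - by move=> k; case: ifP => // _; rewrite le_min cabs_ge0 ltW.
    - by move=> k /negPf /= ->.
    rewrite big_seq (eq_bigr (fun=> x)); last first.
      by move=> k kB; rewrite /= kB min_r// ltW// -inB.
    by rewrite -big_seq big_const_seq count_predT iter_addr_0 mulr_natr.
  apply: eq_nsum => k; rewrite /=; case: ifPn => // kB.
  by rewrite min_l// leNgt -inB.
rewrite mfin; apply: (@le_trans _ _ ((x * (size B)%:R)%:E + (\sum_j q j * s j)%:E)%E).
  rewrite -EFinD lee_fin.
  (* The minimum of s_j and x is below their convex combination with weights q_j and 1 - q_j. *)
  apply: (@le_trans _ _ (\sum_j (q j * s j + (1 - q j) * x))).
    apply: ler_sum => j _.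
    have m1 : Num.min (s j) x <= s j by rewrite ge_min lexx.
    have m2 : Num.min (s j) x <= x by rewrite ge_min lexx orbT.
    by have := q0 j; have := q1 j; nra.
  rewrite big_split/= addrC lerD2r -mulr_suml mulrC ler_wpM2l ?(ltW x0)//.
  rewrite sumrB big_const_ord iter_addr_0.
  move: trP; rewrite size_map /mxtrace Re_sum -/q; lra.
by rewrite leeD2l.
Qed.

End Compression.

(** * Singular values against rank one decompositions *)

Section RankOne.
Variables (R : realType) (I : choiceType).
Implicit Types (v w x : I -> R[i]).

Lemma asum_pair (K L : choiceType) (f : K -> L -> R[i]) (M : K -> R) :
  (forall k, (nsum (fun l => cabs (f k l))%R <= (M k)%:E)%E) -> (nsum M < +oo)%E ->
  asum (fun z : K * L => f z.1 z.2).
Proof.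
move=> fM Moo; rewrite /asum.
rewrite -(nsum_pair (f := fun k l => cabs (f k l))); last by move=> *; exact: cabs_ge0.
by apply: le_lt_trans Moo; apply: le_esum => k _; exact: fM.
Qed.

Definition orthonormal n (e : 'I_n -> I -> R[i]) :=
  (forall j, l2 (e j)) /\ forall j l, inner (e j) (e l) = (j == l)%:R.

Lemma bessel n (e : 'I_n -> I -> R[i]) v : orthonormal e -> l2 v ->
  \sum_j cabs (inner v (e j)) ^+ 2 <= nrm2 v.
Proof.
move=> [le oe] lv; set w := fun i => \sum_j inner v (e j) * e j i.
have lje j : l2 (fun i => inner v (e j) * e j i) by exact: l2Z.
have lw : l2 w by exact: l2_sum.
have wv : inner w v = (\sum_j cabs (inner v (e j)) ^+ 2)%:C.
  rewrite inner_suml// realC_sum; apply: eq_bigr => j _.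
  by rewrite innerZl// (innerC v (e j)) mulcJ.
have ww : nrm2 w = \sum_j cabs (inner v (e j)) ^+ 2.
  apply: complexI; rewrite -inner_self// -wv {1}/w inner_suml// [RHS]inner_suml//.
  apply: eq_bigr => j _; rewrite !innerZl//; congr (_ * _).
  rewrite innerC [in RHS]innerC inner_suml//; congr conjc.
  rewrite (bigD1 j)//= innerZl// oe eqxx mulr1 big1 ?addr0// => l lj.
  by rewrite innerZl// oe (negPf lj) mulr0.
have := nrm2_ge0 (fun i => v i - w i); rewrite nrm2B// ww innerC wv /=; lra.
Qed.

Lemma cabs_unit v i : (sqnorm v <= 1%:E)%E -> cabs (v i) <= 1.
Proof.
move=> v1; rewrite -(@ler_pXn2r _ 2)// ?nnegrE ?cabs_ge0// expr1n.
by rewrite (le_trans (cabs_le_nrm2 i (l2_le v1)))// nrm2_le.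
Qed.

Lemma nsum_unit v w : (sqnorm v <= 1%:E)%E -> l2 w -> nrm2 w <= 1 ->
  (nsum (fun i => cabs (v i) * cabs (w i))%R <= 1%:E)%E.
Proof.
move=> v1 lw w1; rewrite (le_trans (nsum_CS (l2_le v1) lw))// lee_fin.
by rewrite -sqrtr1 ler_wsqrtr// mulr_ile1 ?nrm2_ge0// nrm2_le.
Qed.

Variables (p : R) (p0 : 0 < p) (p1 : p < 1).

(* McCarthy's inequality for the singular values [s]: compressing to the
   complement of the atoms with |c_k| >= t bounds the sum of the min(s_j, t),
   and the concave power is a positive combination of such truncations. *)
Lemma rank_one_ineq (K : choiceType) n (a : opmat R I) (e f : 'I_n -> I -> R[i])
    (s : 'I_n -> R) (c : K -> R[i]) (xi eta : K -> I -> R[i]) :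
  (forall j, 0 <= s j) -> orthonormal e -> orthonormal f ->
  (forall j, opapp a (e j) = fun i => (s j)%:C * f j i) ->
  (forall k, (sqnorm (xi k) <= 1%:E)%E) -> (forall k, (sqnorm (eta k) <= 1%:E)%E) ->
  (forall i j, a i j = csum (fun k => c k * (xi k i * (eta k j)^*))) ->
  ((\sum_j s j `^ p)%:E <= nsum (fun k => cabs (c k) `^ p)%R)%E.
Proof.
move=> s0 oe of_ aef xi1 eta1 arep.
have [cp|cp] := eqVneq (nsum (fun k => cabs (c k) `^ p)%R) +oo%E; first by rewrite cp leey.
have cs : asum c.
  apply: (nsum_of_pow p0 p1) => [k|]; first exact: cabs_ge0.
  by rewrite ltey.
have nrm1 m (g : 'I_m -> I -> R[i]) j : orthonormal g -> nrm2 (g j) = 1.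
  by move=> [lg og]; apply: complexI; rewrite -inner_self// og eqxx.
have [le ie] := oe; have [lf if_] := of_.
apply: (pow_sum_of_trunc p0 p1) => //.
- by move=> k; exact: cabs_ge0.
(* Pass to coordinates in the two orthonormal families; by Bessel they stay in the unit ball. *)
apply: (@trunc_sum_le _ _ _ _ c (fun k l => inner (xi k) (f l)) (fun k j => inner (eta k) (e j))) => //.
- by move=> k; rewrite (le_trans (bessel of_ (l2_le (xi1 k))))// nrm2_le.
- by move=> k; rewrite (le_trans (bessel oe (l2_le (eta1 k))))// nrm2_le.
move=> j l.
have E1 i : opapp a (e j) i = csum (fun k => c k * (xi k i * (inner (eta k) (e j))^*)).
  rewrite /opapp.
  transitivity (csum (fun m => csum (fun k => c k * xi k i * ((eta k m)^* * e j m)))).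
    apply: eq_csum => m; rewrite arep mulrC -csumZ.
      by apply: eq_csum => k; ring.
    apply: (@asum_le _ _ _ (fun k => cabs (c k))) => // k.
    by rewrite !cabsM cabs_conj ler_piMr ?cabs_ge0// mulr_ile1 ?cabs_ge0 ?cabs_unit.
  (* Fubini applies here because the sum over m of each term is at most |c_k|, by Cauchy-Schwarz on
     unit vectors. *)
  rewrite -(csum_exchange (f := fun k m => c k * xi k i * ((eta k m)^* * e j m))); last first.
    apply: (asum_pair (f := fun k m => c k * xi k i * ((eta k m)^* * e j m)) (M := fun k => cabs (c k))) => // k.
    rewrite (eq_nsum (g := fun m => cabs (c k * xi k i) * (cabs (eta k m) * cabs (e j m)))%R); last first.
      by move=> m; rewrite !cabsM cabs_conj.
    rewrite nsumZ ?cabs_ge0//; last by move=> m; rewrite mulr_ge0 ?cabs_ge0.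
    apply: (@le_trans _ _ ((cabs (c k * xi k i))%:E * 1%:E)%E).
      by rewrite lee_wpmul2l ?lee_fin ?cabs_ge0// nsum_unit// nrm1.
    by rewrite mule1 lee_fin cabsM ler_piMr ?cabs_ge0 ?cabs_unit.
  apply: eq_csum => k; rewrite csumZ; last first.
    have := asum_inner (le j) (l2_le (eta1 k)).
    by under [X in asum X -> _]eq_fun do rewrite mulrC.
  rewrite -mulrA -innerC; congr (_ * (_ * _)).
  by apply: eq_csum => m; rewrite mulrC.
have al1 k : cabs (inner (eta k) (e j)) <= 1.
  rewrite (le_trans (inner_CS (l2_le (eta1 k)) (le j)))// nrm1// mulr1.
  by rewrite -sqrtr1 ler_wsqrtr// nrm2_le.
transitivity (inner (opapp a (e j)) (f l)); last by rewrite aef innerZl// if_ mulrC.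
rewrite /inner; under [RHS]eq_csum do rewrite E1.
transitivity (csum (fun i => csum (fun k => c k * (inner (eta k) (e j))^* * (xi k i * (f l i)^*)))); last first.
  apply: eq_csum => i; rewrite mulrC -csumZ.
    by apply: eq_csum => k; ring.
  apply: (@asum_le _ _ _ (fun k => cabs (c k))) => // k.
  by rewrite !cabsM cabs_conj ler_piMr ?cabs_ge0// mulr_ile1 ?cabs_ge0 ?cabs_unit.
rewrite -(csum_exchange (f := fun k i => c k * (inner (eta k) (e j))^* * (xi k i * (f l i)^*))).
  apply: eq_csum => k; rewrite csumZ; last exact: asum_inner (l2_le (xi1 k)) (lf l).
  by rewrite -mulrA; congr (_ * _); rewrite mulrC.
apply: (asum_pair (f := fun k i => c k * (inner (eta k) (e j))^* * (xi k i * (f l i)^*))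
  (M := fun k => cabs (c k))) => // k.
rewrite (eq_nsum (g := fun i => cabs (c k * (inner (eta k) (e j))^*) * (cabs (xi k i) * cabs (f l i)))%R); last first.
  by move=> m; rewrite !cabsM !cabs_conj.
rewrite nsumZ ?cabs_ge0//; last by move=> m; rewrite mulr_ge0 ?cabs_ge0.
apply: (@le_trans _ _ ((cabs (c k * (inner (eta k) (e j))^*))%:E * 1%:E)%E).
  by rewrite lee_wpmul2l ?lee_fin ?cabs_ge0// nsum_unit// nrm1.
by rewrite mule1 lee_fin cabsM cabs_conj ler_piMr ?cabs_ge0.
Qed.

End RankOne.

(** * The spectral theorem for compact operators *)

Lemma cvg_ge0_eps (R : realType) (g : nat -> \bar R) : (forall n, (0 <= g n)%E) ->
  (g @ \oo --> 0%E) <->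
  (forall e : R, 0 < e -> exists N, forall n, (N <= n)%N -> (g n <= e%:E)%E).
Proof.
move=> g0; split.
  move=> /fine_cvgP[[N1 _ fg] /cvgrPdist_le cg] e e0.
  have [N2 _ hg] := cg e e0; exists (maxn N1 N2) => n; rewrite geq_max => /andP[n1 n2].
  have := hg n n2; rewrite /= sub0r normrN ger0_norm ?fine_ge0// => h.
  by rewrite -(fineK (fg n n1)) lee_fin.
move=> h; apply/fine_cvgP; split.
  have [N hN] := h 1 ltr01; exists N => // n /= /hN gn.
  by rewrite ge0_fin_numE// (le_lt_trans gn)// ltry.
apply/cvgrPdist_le => e /h[N hN]; exists N => // n /= /hN gn.
have fn : g n \is a fin_num by rewrite ge0_fin_numE// (le_lt_trans gn)// ltry.
by rewrite sub0r normrN ger0_norm ?fine_ge0// -lee_fin fineK.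
Qed.

Section Spectral.
Variables (R : realType) (I : choiceType).
Implicit Types (v w x y : I -> R[i]) (a u : opmat R I).

Lemma compact_subseq a (v : nat -> I -> R[i]) : compact_op a ->
  (forall n, (sqnorm (v n) <= 1)%E) ->
  exists (s : nat -> nat) w, [/\ {homo s : m n / (m < n)%N}, l2 w &
    forall e : R, 0 < e -> exists N, forall n, (N <= n)%N ->
      (sqnorm (fun i => opapp a (v (s n)) i - w i)%R <= e%:E)%E].
Proof.
move=> [_ ca] v1; have [s [w [smono lw cvw]]] := ca v v1.
exists s, w; split => //; apply/(cvg_ge0_eps (g := fun n => _)) => // n.
exact: sqnorm_ge0.
Qed.

Lemma homo_ltn_ge (s : nat -> nat) : {homo s : m n / (m < n)%N} -> forall n, (n <= s n)%N.
Proof. by move=> h; elim=> // n IH; rewrite (leq_ltn_trans IH)// h. Qed.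

Lemma nrm2_normalize v : l2 v -> nrm2 v != 0 ->
  let w := fun i => (Num.sqrt (nrm2 v))^-1%:C * v i in l2 w /\ nrm2 w = 1.
Proof.
move=> lv v0 w; have vp : 0 < nrm2 v by rewrite lt_neqAle eq_sym v0 nrm2_ge0.
split; first exact: l2Z.
rewrite nrm2Z// cabs_real ger0_norm ?invr_ge0 ?sqrtr_ge0// exprVn sqr_sqrtr ?ltW//.
by rewrite mulVf.
Qed.

Lemma nrm2D_le v w : l2 v -> l2 w -> nrm2 (fun i => v i + w i) <= 2 * nrm2 v + 2 * nrm2 w.
Proof.
by move=> lv lw; apply: nrm2_le; rewrite (le_trans (sqnormD_le _ _))// !sqnorm_fin.
Qed.

(** Otherwise some sequence of the unit ball has images of norms tending to infinity, and no
    subsequence of the images can converge. *)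
Lemma compact_op_bounded a : compact_op a -> exists C, bop a C.
Proof.
move=> ca; have la := ca.1; apply: contrapT => nb.
have H (n : nat) : exists v, (sqnorm v <= 1)%E /\ (n%:R%:E < sqnorm (opapp a v))%E.
  apply: contrapT => hn; apply: nb; exists n%:R; split => // v lv.
  have [v0|v0] := eqVneq (nrm2 v) 0.
    rewrite (nrm2_eq0 lv v0) (_ : opapp a _ = fun=> 0); last first.
      by apply/funext => i; rewrite opapp0.
    by rewrite sqnorm_fin ?nrm2_0 ?mulr0//; exact: l2_0.
  have vp : 0 < nrm2 v by rewrite lt_neqAle eq_sym v0 nrm2_ge0.
  set t := Num.sqrt (nrm2 v); have t0 : 0 < t by rewrite sqrtr_gt0.
  have t2 : t ^+ 2 = nrm2 v by rewrite sqr_sqrtr ?ltW.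
  have [lw w1] := nrm2_normalize lv v0; rewrite -/t in lw w1.
  have : (sqnorm (opapp a (fun i => t^-1%:C * v i)%R) <= n%:R%:E)%E.
    rewrite leNgt; apply/negP => hlt; apply: hn.
    by exists (fun i => t^-1%:C * v i); split => //; rewrite sqnorm_fin// w1.
  rewrite (_ : opapp a _ = fun i => t^-1%:C * opapp a v i); last first.
    by apply/funext => i; rewrite opappZ.
  rewrite sqnormZ cabs_real ger0_norm ?invr_ge0 ?(ltW t0)// exprVn t2 => h.
  rewrite -(@lee_pmul2l _ (nrm2 v)^-1%:E)// ?lte_fin ?invr_gt0//.
  by rewrite (le_trans h)// -EFinM lee_fin mulrCA mulVf// mulr1.
have [vs hvs] := choice H.
have [s [w [smono lw cvw]]] := compact_subseq ca (fun n => (hvs n).1).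
have [N NP] := cvw 1 ltr01.
(* Past [N] the image lies within squared distance 1 of w, so its squared norm is at most 2 + 2
   |w|^2; since n <= s n, a larger n contradicts the choice of [vs]. *)
pose n := maxn N (Num.bound (2 + 2 * nrm2 w)).
have h1 := NP n (leq_maxl _ _).
have h2 := (hvs (s n)).2.
have h3 : (sqnorm (opapp a (vs (s n))) <= (2 + 2 * nrm2 w)%:E)%E.
  rewrite (_ : opapp a _ = fun i => (opapp a (vs (s n)) i - w i) + w i); last first.
    by apply/funext => i; rewrite subrK.
  have lx := l2_le h1; rewrite sqnorm_fin; last exact: l2D.
  by rewrite lee_fin (le_trans (nrm2D_le lx lw))//; have := nrm2_le h1; lra.
have := lt_le_trans h2 h3; rewrite lte_fin ltNge => /negP; apply.
have b0 : 0 <= 2 + 2 * nrm2 w by rewrite addr_ge0 ?mulr_ge0 ?nrm2_ge0.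
rewrite (le_trans (ltW (archi_boundP b0)))// ler_nat.
by rewrite (leq_trans _ (homo_ltn_ge smono n))// leq_maxr.
Qed.

Lemma nrm2_ext_eps v : l2 v -> (forall e : R, 0 < e -> nrm2 v <= e) -> v = fun=> 0.
Proof.
move=> lv h; apply: nrm2_eq0 => //; apply/eqP; rewrite eq_le nrm2_ge0 andbT.
by apply/ler_addgt0Pr => e e0; rewrite add0r h.
Qed.

Variable a : opmat R I.
Hypothesis ca : compact_op a.
Let h := opmul (opadj a) a.

Lemma bop_gram : exists C, bop h C.
Proof. by have [C ba] := compact_op_bounded ca; exists (C * C); exact: bop_mul (bop_adj ba) ba. Qed.

Lemma gram_app v : l2 v -> opapp h v = opapp (opadj a) (opapp a v).
Proof.
move=> lv; have [C ba] := compact_op_bounded ca; have [_ ra _] := bop_adj ba.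
exact: opmul_app ra ba lv.
Qed.

Lemma inner_gram v w : l2 v -> l2 w -> inner (opapp h v) w = inner (opapp a v) (opapp a w).
Proof.
move=> lv lw; have [C ba] := compact_op_bounded ca.
by rewrite gram_app// (adjP (bop_adj ba)) ?opadjK//; exact: bop_l2 ba lv.
Qed.

Lemma gram_sa v w : l2 v -> l2 w -> inner (opapp h v) w = inner v (opapp h w).
Proof. by move=> lv lw; rewrite inner_gram// [RHS]innerC inner_gram// -innerC. Qed.

Definition eigvec v := exists l : R, opapp h v = fun i => l%:C * v i.

Definition orth_to (S : set (I -> R[i])) v := l2 v /\ forall w, S w -> inner v w = 0.

Lemma orth_toZ (S : set (I -> R[i])) c v : (forall z, S z -> l2 z) ->
  orth_to S v -> orth_to S (fun i => c * v i).
Proof.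
move=> lS [lv vS]; split; first exact: l2Z.
by move=> z Sz; rewrite innerZl ?vS ?mulr0//; exact: lS.
Qed.

Lemma orth_to_gram (S : set (I -> R[i])) v : (forall z, S z -> l2 z /\ eigvec z) ->
  orth_to S v -> orth_to S (opapp h v).
Proof.
have [C bh] := bop_gram.
move=> eS [lv vS]; split; first exact: bop_l2 bh lv.
move=> z Sz; have [lz [l ez]] := eS z Sz.
by rewrite gram_sa// ez innerZr// vS// mulr0.
Qed.

Lemma orth_to_lim (S : set (I -> R[i])) y : (forall z, S z -> l2 z) -> l2 y ->
  (forall e : R, 0 < e -> exists2 v, orth_to S v & nrm2 (fun i => v i - y i) <= e) ->
  orth_to S y.
Proof.
move=> lS ly H; split => // z Sz; have lz := lS z Sz.
apply/eqP; rewrite -cabs_eq0 eq_le cabs_ge0 andbT.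
apply/ler_addgt0Pr => e e0; rewrite add0r.
have d0 : 0 < e ^+ 2 / (nrm2 z + 1) by rewrite divr_gt0 ?exprn_gt0// ltr_wpDl ?nrm2_ge0.
have [v [lv vS] hv] := H _ d0.
have -> : inner y z = - inner (fun i => v i - y i) z by rewrite innerBl// vS// sub0r opprK.
rewrite cabsN (le_trans (inner_CS (l2B lv ly) lz))//.
rewrite -[leRHS]ger0_norm ?(ltW e0)// -sqrtr_sqr ler_wsqrtr//.
apply: (@le_trans _ _ (e ^+ 2 / (nrm2 z + 1) * nrm2 z)); first by rewrite ler_wpM2r ?nrm2_ge0.
rewrite mulrAC ler_pdivrMr ?ltr_wpDl ?nrm2_ge0//.
by rewrite ler_wpM2l ?exprn_ge0 ?(ltW e0)// lerDl.
Qed.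

(* A maximizing sequence of |a v|^2 on the unit ball of the complement of S
   consists of approximate eigenvectors of a^* a; compactness turns it into an
   eigenvector. *)
Lemma exists_eigvec (S : set (I -> R[i])) v0 : (forall z, S z -> l2 z /\ eigvec z) ->
  orth_to S v0 -> nrm2 v0 != 0 ->
  exists2 y, orth_to S y & nrm2 y = 1 /\ eigvec y.
Proof.
move=> eS ov0 v00; have lS z : S z -> l2 z by move=> /eS[].
have [C ba] := compact_op_bounded ca; have [C0 ra _] := ba.
have [D bh] := bop_gram; have [D0 rh _] := bh.
have lv0 := ov0.1.
have [lw0 w01] := nrm2_normalize lv0 v00.
set A := [set nrm2 (opapp a v) | v in [set v | orth_to S v /\ nrm2 v <= 1]].
have Aub : has_ubound A.
  exists C => _ [v [[lv _] v1] <-]; rewrite (le_trans (bop_nrm2 ba lv))//.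
  by rewrite ler_piMr.
have A0 : A !=set0.
  exists (nrm2 (opapp a (fun i => (Num.sqrt (nrm2 v0))^-1%:C * v0 i))).
  by exists (fun i => (Num.sqrt (nrm2 v0))^-1%:C * v0 i) => //; split; [exact: orth_toZ|rewrite w01].
have hasA : has_sup A by split.
set m := sup A.
have mle v : orth_to S v -> nrm2 (opapp a v) <= m * nrm2 v.
  move=> [lv vS]; have [z|z] := eqVneq (nrm2 v) 0.
    rewrite z mulr0 (nrm2_eq0 lv z) (_ : opapp a _ = fun=> 0) ?nrm2_0//.
    by apply/funext => i; rewrite opapp0.
  have [lw w1] := nrm2_normalize lv z.
  have vp : 0 < nrm2 v by rewrite lt_neqAle eq_sym z nrm2_ge0.
  have : nrm2 (opapp a (fun i => (Num.sqrt (nrm2 v))^-1%:C * v i)) <= m.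
    apply: ub_le_sup => //; exists (fun i => (Num.sqrt (nrm2 v))^-1%:C * v i) => //; split.
      exact: orth_toZ.
    by rewrite w1.
  rewrite (_ : opapp a _ = fun i => (Num.sqrt (nrm2 v))^-1%:C * opapp a v i); last first.
    by apply/funext => i; rewrite opappZ.
  rewrite nrm2Z; last exact: bop_l2 ba lv.
  rewrite cabs_real ger0_norm ?invr_ge0 ?sqrtr_ge0// exprVn sqr_sqrtr ?(ltW vp)//.
  by rewrite mulrC ler_pdivrMr.
set w0 := (fun i => _) in lw0 w01.
have ow0 : orth_to S w0 by exact: orth_toZ.
have m0 : 0 <= m by have := mle _ ow0; rewrite w01 mulr1; exact/le_trans/nrm2_ge0.
(* If m = 0, then a vanishes on the complement of S and every unit vector there is an eigenvector
   for 0. *)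
have [m00|mn0] := eqVneq m 0.
  exists w0 => //; split => //; exists 0.
  have aw0 : opapp a w0 = fun=> 0.
    apply: nrm2_eq0; first exact: bop_l2 ba lw0.
    by apply/eqP; rewrite eq_le nrm2_ge0 andbT; have := mle _ ow0; rewrite m00 mul0r.
  by rewrite gram_app// aw0; apply/funext => i; rewrite opapp0 mul0r.
have {m0 mn0} mp : 0 < m by rewrite lt_neqAle eq_sym mn0.
have H (n : nat) : exists v, [/\ orth_to S v, nrm2 v <= 1 & m - n.+1%:R^-1 < nrm2 (opapp a v)].
  have n0 : 0 < n.+1%:R^-1 :> R by rewrite invr_gt0.
  by have [_ [v [ov v1] <-] hv] := sup_adherent n0 hasA; exists v.
have [vs hvs] := choice H.
have vs1 n : (sqnorm (vs n) <= 1)%E.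
  by have [[lv _] v1 _] := hvs n; rewrite sqnorm_fin.
have [s [w [smono lw cvw]]] := compact_subseq ca vs1.
have ba' := bop_adj ba; have [_ ra' _] := ba'.
(* w is the limit of the a v_n along the subsequence, so y is the limit of the h v_n and the
   candidate eigenvector. *)
set y := opapp (opadj a) w; have ly : l2 y by exact: bop_l2 ba' lw.
have E1 (e : R) : 0 < e -> exists v, [/\ orth_to S v, nrm2 v <= 1,
    m - e <= nrm2 (opapp a v) & nrm2 (fun i => opapp h v i - y i) <= e].
  move=> e0; have ec0 : 0 < e / (C + 1) by rewrite divr_gt0// ltr_wpDl.
  have [N hN] := cvw _ ec0.
  pose n := maxn N (Num.bound e^-1); have [ov v1 va] := hvs (s n).
  have lv := ov.1.
  exists (vs (s n)); split => //.
    apply: le_trans (ltW va); rewrite lerD2l lerN2.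
    rewrite invf_ple ?posrE// (le_trans (ltW (archi_boundP _))) ?invr_ge0 ?(ltW e0)//.
    by rewrite ler_nat (leq_trans (leq_maxr N _))// (leq_trans (homo_ltn_ge smono n)).
  have hd := hN n (leq_maxl _ _); have ld := l2_le hd.
  rewrite gram_app// (_ : (fun i => _) = opapp (opadj a) (fun i => opapp a (vs (s n)) i - w i)).
    rewrite (le_trans (bop_nrm2 ba' ld))//.
    apply: (@le_trans _ _ (C * (e / (C + 1)))); first by rewrite ler_wpM2l// nrm2_le.
    rewrite mulrA ler_pdivrMr ?ltr_wpDl// mulrC ler_wpM2l ?(ltW e0)//; lra.
  by apply/funext => i; rewrite opappB//; exact: bop_l2 ba lv.
(* Expanding the square gives |hv|^2 - 2m |av|^2 + m^2 |v|^2. Since hv is again orthogonal to S,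
   Cauchy-Schwarz and the maximality of m yield |hv|^2 <= m |av|^2. *)
have E2 v : orth_to S v -> nrm2 v <= 1 ->
    nrm2 (fun i => opapp h v i - m%:C * v i) <= m * (m - nrm2 (opapp a v)).
  move=> ov v1; have lv := ov.1; have lhv := bop_l2 bh lv; have lav := bop_l2 ba lv.
  have ohv := orth_to_gram eS ov.
  have X1 : nrm2 (opapp h v) <= m * nrm2 (opapp a v).
    have e1 : (nrm2 (opapp h v))%:C = inner (opapp a v) (opapp a (opapp h v)).
      by rewrite -inner_self// inner_gram.
    have : nrm2 (opapp h v) <= Num.sqrt (nrm2 (opapp a v) * (m * nrm2 (opapp h v))).
      rewrite -[leLHS]ger0_norm ?nrm2_ge0// -cabs_real e1.
      rewrite (le_trans (inner_CS lav (bop_l2 ba lhv)))// ler_wsqrtr//.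
      by rewrite ler_wpM2l ?nrm2_ge0// mle.
    have q0 : 0 <= nrm2 (opapp a v) * (m * nrm2 (opapp h v)).
      by rewrite !mulr_ge0 ?nrm2_ge0// ltW.
    move=> hh; have : nrm2 (opapp h v) ^+ 2 <= nrm2 (opapp a v) * (m * nrm2 (opapp h v)).
      by rewrite -(sqr_sqrtr q0) ler_pXn2r ?nnegrE ?nrm2_ge0 ?sqrtr_ge0.
    have [->|xn0] := eqVneq (nrm2 (opapp h v)) 0.
      by rewrite mulr_ge0 ?nrm2_ge0 ?(ltW mp).
    rewrite mulrCA mulrA expr2 ler_pM2r// lt_neqAle eq_sym xn0 nrm2_ge0//.
  rewrite nrm2B//; last exact: l2Z.
  rewrite nrm2Z// innerZr// conjc_real Re_realM inner_gram// inner_self//= cabs_real.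
  rewrite ger0_norm ?(ltW mp)//.
  have := nrm2_ge0 v; nra.
(* The vector hv is close to y and to mv; hence z = mv is close to y, is almost an eigenvector, and
   has a norm bounded below. *)
have E3 (e : R) : 0 < e -> exists z, [/\ orth_to S z,
    nrm2 (fun i => z i - y i) <= e, nrm2 (fun i => opapp h z i - m%:C * z i) <= e &
    m ^+ 2 / 2 <= nrm2 z].
  (* [d] dominates the factors 2 + 2m and m^3 of [e1] in the two estimates below. *)
  move=> e0; set d := 3 + 2 * m + m ^+ 3.
  have d0 : 0 < d by rewrite /d; have := exprn_gt0 3 mp; lra.
  have e10 : 0 < Num.min (e / d) (m / 2) by rewrite lt_min !divr_gt0.
  have [v [ov v1 va vy]] := E1 _ e10; have lv := ov.1; have lhv := bop_l2 bh lv.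
  have e2 := E2 v ov v1; have lmv := l2Z m%:C lv.
  set e1 := Num.min _ _ in e10 va vy.
  have e1d : e1 * d <= e by rewrite -ler_pdivlMr// ge_min lexx.
  have e1m : e1 <= m / 2 by rewrite ge_min lexx orbT.
  have e2' : nrm2 (fun i => opapp h v i - m%:C * v i) <= m * e1.
    by rewrite (le_trans e2)// ler_wpM2l ?(ltW mp)//; lra.
  exists (fun i => m%:C * v i); split.
  - exact: orth_toZ.
  - rewrite (_ : (fun i => _) = fun i => (opapp h v i - y i) + - (opapp h v i - m%:C * v i)).
      rewrite (le_trans (nrm2D_le _ _))//; [exact: l2B|by apply: l2N; exact: l2B|].
      rewrite nrm2N; have : 0 <= e1 * m ^+ 3 by rewrite mulr_ge0 ?exprn_ge0 ?ltW.
      by move: e1d; rewrite /d; lra.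
    by apply/funext => i; ring.
  - rewrite (_ : (fun i => _) = fun i => m%:C * (opapp h v i - m%:C * v i)).
      rewrite nrm2Z; last exact: l2B.
      rewrite cabs_real ger0_norm ?(ltW mp)//.
      have : m ^+ 2 * nrm2 (fun i => opapp h v i - m%:C * v i) <= m ^+ 2 * (m * e1).
        by rewrite ler_wpM2l// exprn_ge0// ltW.
      have : m ^+ 2 * (m * e1) = e1 * m ^+ 3 by ring.
      have : 0 <= e1 * m by rewrite mulr_ge0 ?ltW.
      by move: e1d; rewrite /d; lra.
    by apply/funext => i; rewrite opappZ// mulrBr.
  - rewrite nrm2Z// cabs_real ger0_norm ?(ltW mp)// expr2 -mulrA -mulrA ler_wpM2l ?(ltW mp)//.
    by have := mle v ov; lra.
have oy : orth_to S y.
  by apply: orth_to_lim => // e /E3[z [oz zy _ _]]; exists z.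
have hy : opapp h y = fun i => m%:C * y i.
  have lhy := bop_l2 bh ly; have lmy := l2Z m%:C ly.
  suff : (fun i => opapp h y i - m%:C * y i) = fun=> 0.
    by move=> hy0; apply/funext => i; apply/eqP; rewrite -subr_eq0; apply/eqP; have := congr1 (fun f => f i) hy0.
  apply: nrm2_ext_eps; first exact: l2B.
  move=> e e0; have d0 : 0 < 2 * D + 4 + 4 * m ^+ 2.
    by have := exprn_gt0 2 mp; lra.
  have [z [[lz _] zy hz _]] := E3 _ (divr_gt0 e0 d0).
  have lzy := l2B lz ly; have lhz := bop_l2 bh lz; have lmz := l2Z m%:C lz.
  set d := e / _ in zy hz.
  rewrite (_ : (fun i => _) = fun i => - opapp h (fun i => z i - y i) i +
      ((opapp h z i - m%:C * z i) + m%:C * (z i - y i))); last first.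
    by apply/funext => i; rewrite opappB//; ring.
  have l1 := bop_l2 bh lzy; have l3 := l2Z m%:C lzy.
  rewrite (le_trans (nrm2D_le (l2N l1) (l2D (l2B lhz lmz) l3)))// nrm2N.
  have := nrm2D_le (l2B lhz lmz) l3; rewrite (nrm2Z _ lzy) cabs_real ger0_norm ?(ltW mp)//.
  have := bop_nrm2 bh lzy.
  have : D * nrm2 (fun i => z i - y i) <= D * d by rewrite ler_wpM2l.
  have : m ^+ 2 * nrm2 (fun i => z i - y i) <= m ^+ 2 * d.
    by rewrite ler_wpM2l// exprn_ge0// ltW.
  have : d * (2 * D + 4 + 4 * m ^+ 2) = e by rewrite divfK// gt_eqF.
  lra.
(* If y were 0, the vectors z would be arbitrarily small, against their lower bound m^2 / 2. *)
have y0 : nrm2 y != 0.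
  apply/negP => /eqP y0; have m4 : 0 < m ^+ 2 / 4 by rewrite divr_gt0// exprn_gt0.
  have [z [[lz _] zy _ hz]] := E3 _ m4.
  move: zy; rewrite (nrm2_eq0 ly y0); under [X in nrm2 X]eq_fun do rewrite subr0.
  by have := exprn_gt0 2 mp; lra.
have [lyn yn1] := nrm2_normalize ly y0.
exists (fun i => (Num.sqrt (nrm2 y))^-1%:C * y i); first exact: orth_toZ.
split => //; exists m; apply/funext => i; rewrite opappZ// hy; ring.
Qed.

End Spectral.

(** * An orthonormal eigenbasis indexed by the canonical index set *)

Section SpectralBasis.
Variables (R : realType) (I : countType).
Implicit Types (v w x y : I -> R[i]) (a u : opmat R I).
Local Notation VT := (I -> R[i]).

Definition onset (S : set VT) :=
  (forall v, S v -> l2 v /\ nrm2 v = 1) /\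
  forall v w, S v -> S w -> v != w -> inner v w = 0.

Lemma onset_bessel (S : set VT) (s : seq VT) x : onset S -> uniq s ->
  (forall v, v \in s -> S v) -> l2 x -> \sum_(v <- s) cabs (inner x v) ^+ 2 <= nrm2 x.
Proof.
move=> [S1 S2] us sS lx.
rewrite (big_nth 0) big_mkord; apply: (bessel (e := fun j : 'I_(size s) => s`_j)) => //.
have inS (j : 'I_(size s)) : S s`_j by apply: sS; rewrite mem_nth.
split => [j|j k]; first exact: (S1 _ (inS j)).1.
have [->|jk] := eqVneq j k.
  by have [l1 n1] := S1 _ (inS k); rewrite inner_self// n1.
by apply: S2 => //; rewrite nth_uniq.
Qed.

(** Every unit vector has a coordinate i with |v_i|^2 >= 1/(n+1) for some n, and Bessel for the i-th
    basis vector allows only finitely many members of S for each pair (i, n). *)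
Lemma onset_countable (S : set VT) : onset S -> countable S.
Proof.
move=> oS; have [S1 S2] := oS.
apply: (@sub_countable _ _ _ (\bigcup_(i in [set: I]) \bigcup_(n in [set: nat])
    [set v | S v /\ n.+1%:R^-1 <= cabs (v i) ^+ 2])).
  apply: subset_card_le => v Sv; have [lv v1] := S1 v Sv.
  have [i vi] : exists i, v i != 0.
    apply: contrapT => h; move: v1; rewrite (_ : v = fun=> 0) ?nrm2_0.
      by move/eqP; rewrite eq_sym oner_eq0.
    by apply/funext => i; apply/eqP/negPn/negP => vi; apply: h; exists i.
  exists i => //; exists (Num.bound (cabs (v i) ^+ 2)^-1) => //; split => //.
  have c0 : 0 < cabs (v i) ^+ 2.
    by rewrite exprn_gt0// lt_neqAle cabs_ge0 andbT eq_sym cabs_eq0.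
  rewrite invf_ple ?posrE// (le_trans (ltW (archi_boundP _))) ?invr_ge0 ?(ltW c0)//.
  by rewrite ler_nat.
apply: bigcup_countable => // i _; apply: bigcup_countable => // n _.
apply: finite_set_countable; apply: contrapT => inf.
(* n + 2 vectors contribute at least (n + 2)/(n + 1), more than the Bessel bound 1. *)
have [B Bsub Bn] := infinite_set_fset n.+2 inf.
have := @onset_bessel S (finmap.enum_fset B) (dvec R i) oS (finmap.fset_uniq _) _ (l2_dvec R i).
rewrite nrm2_dvec => /(_ (fun v vB => (Bsub v vB).1)).
apply/negP; rewrite -ltNge.
apply: (@lt_le_trans _ _ (\sum_(v <- finmap.enum_fset B) n.+1%:R^-1)); last first.
  rewrite big_seq [leRHS]big_seq; apply: ler_sum => v vB.
  by rewrite inner_dvecl cabs_conj; have [] := Bsub v vB.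
rewrite big_const_seq count_predT iter_addr_0 -[X in _ < X]mulr_natl ltr_pdivlMr// mul1r.
by rewrite ltr_nat.
Qed.

(** If a complete orthonormal set were finite with r elements, Parseval for r + 1 canonical vectors
    would give r + 1 <= r. *)
Lemma onset_infinite (S : set VT) : infinite_set [set: I] -> onset S ->
  (forall v, orth_to S v -> v = fun=> 0) -> infinite_set S.
Proof.
move=> infI oS comp; have [S1 S2] := oS => /finite_seqP[s0 Ss0].
set s := undup s0; have us : uniq s := undup_uniq s0.
have sS v : v \in s -> S v by rewrite mem_undup Ss0.
have Ss v : S v -> v \in s by rewrite mem_undup Ss0.
(* Parseval for the i-th canonical vector: its difference with its projection onto the span of s is
   orthogonal to S, hence 0. *)
have H i : \sum_(v <- s) cabs (v i) ^+ 2 = 1.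
  set F := fun v j => if v \in s then inner (dvec R i) v * v j else 0.
  have lF v : l2 (F v).
    have [vs|vs] := boolP (v \in s).
      rewrite (_ : F v = fun j => inner (dvec R i) v * v j).
        by apply: l2Z; exact: (S1 _ (sS _ vs)).1.
      by apply/funext => j; rewrite /F vs.
    rewrite (_ : F v = fun=> 0); first exact: l2_0.
    by apply/funext => j; rewrite /F (negPf vs).
  have lS : l2 (fun j => \sum_(v <- s) F v j) by exact: l2_sum.
  have /comp : orth_to S (fun j => dvec R i j - \sum_(v <- s) F v j).
    split; first by apply: l2B => //; exact: l2_dvec.
    move=> w Sw; have [lw w1] := S1 w Sw; have ws := Ss w Sw.
    rewrite innerBl//; last exact: l2_dvec.
    rewrite inner_suml// (bigD1_seq w)//= big_seq_cond big1 ?addr0.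
      by rewrite /F ws innerZl// inner_self// w1 mulr1 subrr.
    move=> v /andP[vs vw]; rewrite /F vs; have [lv _] := S1 _ (sS _ vs).
    by rewrite innerZl// (S2 v w) ?mulr0//; exact: sS.
  move=> /(congr1 (fun f => f i))/eqP; rewrite subr_eq0 /dvec eqxx => /eqP e.
  apply: complexI; rewrite realC_sum; transitivity (true%:R : R[i]) => //; rewrite e.
  rewrite big_seq [RHS]big_seq; apply: eq_bigr => v vs; rewrite /F vs inner_dvecl.
  by rewrite mulrC mulcJ.
have [B _ Bn] := infinite_set_fset (size s).+1 infI.
have : \sum_(i <- finmap.enum_fset B) \sum_(v <- s) cabs (v i) ^+ 2 <= \sum_(v <- s) 1.
  rewrite exchange_big big_seq [leRHS]big_seq; apply: ler_sum => v vs.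
  have [lv v1] := S1 _ (sS _ vs); rewrite -v1 -lee_fin -sqnorm_fin//.
  exact: (nsum_seq_le (fun i => cabs (v i) ^+ 2) (finmap.fset_uniq B)).
rewrite (eq_bigr (fun=> 1)) ?big_const_seq//.
by rewrite !count_predT !iter_addr_0 ler_nat leqNgt => /negP; apply.
Qed.

(** Zorn gives a maximal orthonormal set of eigenvectors, complete since [exists_eigvec] would
    otherwise enlarge it. To make it the columns of a unitary matrix over I it must be put in
    bijection with I. *)
Lemma spectral_gram a : infinite_set [set: I] -> compact_op a ->
  exists (u : opmat R I) (l : I -> R), unitary_op u /\
    opmul (opmul (opadj a) a) u = fun i j => u i j * (l j)%:C.
Proof.
move=> infI ca; set h := opmul _ a.
pose P (S : set VT) := onset S /\ forall v, S v -> eigvec a v.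
have [F FP Ft|S [[oS eS] Smax]] := @Zorn_bigcup VT P.
  split; last by move=> v [X FX Xv]; exact: (FP _ FX).2.
  split; first by move=> v [X FX Xv]; exact: (FP _ FX).1.1.
  move=> v w [X FX Xv] [Y FY Yw]; have [XY|YX] := Ft _ _ FX FY.
    by apply: (FP _ FY).1.2 => //; exact: XY.
  by apply: (FP _ FX).1.2 => //; exact: YX.
have [S1 S2] := oS.
have comp v : orth_to S v -> v = fun=> 0.
  move=> ov; apply: nrm2_eq0; first exact: ov.1.
  apply/eqP/negPn/negP => v0.
  have [|y oy [y1 ey]] := exists_eigvec ca _ ov v0.
    by move=> z Sz; split; [exact: (S1 z Sz).1|exact: eS].
  have ly := oy.1.
  have yS : ~ S y.
    move=> Sy; have := oy.2 y Sy; rewrite inner_self// y1.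
    by move/eqP; rewrite oner_eq0.
  apply: (Smax (S `|` [set y])).
    split; first by move=> z Sz; left.
    by move=> /(_ y (or_intror erefl)).
  split; last by move=> z [/eS//|->].
  split; first by move=> z [/S1//|->].
  move=> z w [Sz|->] [Sw|->] zw.
  - exact: S2.
  - by rewrite innerC oy.2// conjc0.
  - exact: oy.2.
  - by rewrite eqxx in zw.
(* Both sets are countable and infinite. *)
have SI : ([set: I] #= S)%card.
  have c1 := onset_countable oS; have i1 := onset_infinite infI oS comp.
  apply: Cantor_Bernstein.
    exact: card_le_trans (countableP _) (proj1 (infiniteP _) i1).
  exact: card_le_trans c1 (proj1 (infiniteP _) infI).
have /card_bijP[f [f' fK f'K]] := SI.
pose g (i : I) : VT := \val (f (to_setT i)).
have gS i : S (g i) by exact: set_mem (valP (f (to_setT i))).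
have gi i j : g i = g j -> i = j.
  by move=> /val_inj/(can_inj fK)/(congr1 \val).
have gsurj v : S v -> exists i, g i = v.
  move=> Sv; exists (\val (f' (SigSub (mem_set Sv)))).
  rewrite /g (_ : to_setT _ = f' (SigSub (mem_set Sv))) ?f'K//.
  by apply: val_inj.
have lg i : l2 (g i) := (S1 _ (gS i)).1.
have og i j : inner (g i) (g j) = (i == j)%:R.
  have [->|ij] := eqVneq i j; first by rewrite inner_self// (S1 _ (gS j)).2.
  by apply: S2 => //; apply: contra_neq ij; exact: gi.
have [l hl] := choice (fun i => eS _ (gS i)).
exists (fun i j => g j i), l; split; last first.
  apply/funext => i; apply/funext => j.
  by have := congr1 (fun x => x i) (hl j); rewrite /= mulrC.
set u := (fun i j => _).
have bu : bop u 1 by apply: bop_isometry.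
have bu' := bop_adj bu; have [_ ru _] := bu; have [_ ru' _] := bu'.
have uu : opmul (opadj u) u = @op1 R I.
  apply/funext => i; apply/funext => j; rewrite /op1 eq_sym -og /inner /opmul /opadj /u.
  by apply: eq_csum => k; rewrite mulrC.
(* The remaining identity expresses completeness: u applied to the coefficients of a canonical
   vector differs from that vector by something orthogonal to all columns. *)
split => //; apply/funext => i; apply/funext => k.
have lx : l2 (opapp (opadj u) (dvec R k)) by apply: bop_l2 bu' _; exact: l2_dvec.
have -> : opmul u (opadj u) i k = opapp u (opapp (opadj u) (dvec R k)) i.
  by apply: eq_csum => j; rewrite opapp_dvec.
set x := opapp (opadj u) _ in lx *; have lux := bop_l2 bu lx.
have /comp : orth_to S (fun i => opapp u x i - dvec R k i).
  split; first by apply: l2B => //; exact: l2_dvec.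
  move=> w /gsurj[j <-]; rewrite innerBl//; last exact: l2_dvec.
  have gE : g j = opapp u (dvec R j) by apply/funext => m; rewrite opapp_dvec.
  have e1 := adjP bu' lux (l2_dvec R j); have e2 := adjP bu' (l2_dvec R k) (l2_dvec R j).
  rewrite opadjK -gE in e1 e2.
  by rewrite -e1 -e2 -/x -(opmul_app ru' bu lx) uu opapp1 subrr.
move=> /(congr1 (fun f => f i))/eqP; rewrite subr_eq0 => /eqP ->.
by rewrite /dvec /op1.
Qed.

End SpectralBasis.

(** * The quantity tr |a|^p *)

Section Trpow.
Variables (R : realType) (I : countType).
Hypothesis infI : infinite_set [set: I].
Implicit Types (v w x y : I -> R[i]) (a b u : opmat R I).

Definition conjdiag u (d : I -> R) : opmat R I :=
  opmul (fun i j => u i j * (d j)%:C) (opadj u).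

Lemma l2_diag (d : I -> R) (D : R) v : (forall j, `|d j| <= D) -> l2 v ->
  l2 (fun j => (d j)%:C * v j).
Proof.
move=> dD lv; apply: (@l2_le _ _ _ (D ^+ 2 * nrm2 v)).
rewrite EFinM -sqnorm_fin// !sqnormE -nsumZ ?exprn_even_ge0//; last first.
  by move=> i; rewrite exprn_ge0 ?cabs_ge0.
apply: le_nsum => i; rewrite cabsM exprMn cabs_real ler_wpM2r ?exprn_ge0 ?cabs_ge0//.
by rewrite ler_pXn2r ?nnegrE// (le_trans (normr_ge0 _) (dD i)).
Qed.

Lemma conjdiag_app u d D v : unitary_op u -> (forall j, `|d j| <= D) -> l2 v ->
  opapp (conjdiag u d) v = opapp u (fun j => (d j)%:C * opapp (opadj u) v j).
Proof.
move=> Uu dD lv; have bu := unitary_bop Uu; have [_ ru _] := bu.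
rewrite (opmul_app _ (bop_adj bu) lv).
  by apply/funext => i; apply: eq_csum => j; rewrite mulrA.
move=> i; have := l2_diag dD (ru i).
by congr l2; apply/funext => j; rewrite mulrC.
Qed.

Lemma conjdiag_col u d D j : unitary_op u -> (forall j, `|d j| <= D) ->
  opapp (conjdiag u d) (u^~ j) = fun i => (d j)%:C * u i j.
Proof.
move=> Uu dD; have lu := unitary_cols Uu.
have uE : u^~ j = opapp u (dvec R j) by apply/funext => m; rewrite opapp_dvec.
rewrite (conjdiag_app Uu dD (lu j)) uE (unitary_Kadj Uu (l2_dvec R j)).
have -> : (fun j0 => (d j0)%:C * dvec R j j0) = fun j0 => (d j)%:C * dvec R j j0.
  by apply/funext => k; rewrite /dvec; case: eqP => [->|_]; rewrite ?mulr0.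
have [_ ru _] := unitary_bop Uu.
by apply/funext => i; rewrite opappZ ?opapp_dvec//; exact: l2_dvec.
Qed.

Lemma fcalc_spec (f : R -> R) a : (exists b, is_fcalc f a b) -> is_fcalc f a (fcalc f a).
Proof. by move=> [b hb]; apply: xgetPex; exists b. Qed.

Variables (p : R) (p0 : 0 < p) (p1 : p < 1).

(* The functional calculus chosen in [trpow] need not be analysed up to
   uniqueness: whichever diagonalization of |a| was chosen also diagonalizes
   a^* a, and the trace is computed in it. *)
Lemma trpow_eig a : compact_op a -> exists (u : opmat R I) (s : I -> R),
  [/\ unitary_op u, forall j, 0 <= s j,
      forall j, opapp (opmul (opadj a) a) (u^~ j) = fun i => (s j ^+ 2)%:C * u i j &
      trpow p a = nsum (fun j => s j `^ p)%R].
Proof.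
move=> ca; set h := opmul (opadj a) a.
have [C ba] := compact_op_bounded ca; have [C0 ra _] := ba.
have [D bh] := bop_gram ca; have [_ rh _] := bh; rewrite -/h in bh rh.
(* Eigenvalues of the Gram operator are squared norms, hence nonnegative and bounded, whichever
   eigenbasis was chosen. *)
have ev w (l : R) : l2 w -> nrm2 w = 1 -> opapp h w = (fun i => l%:C * w i) -> l = nrm2 (opapp a w).
  move=> lw w1 hw; apply: complexI; rewrite -inner_self; last exact: bop_l2 ba lw.
  by rewrite -(inner_gram ca)// -/h hw innerZl// inner_self// w1 mulr1.
have bnd u (l : I -> R) : unitary_op u -> opmul h u = (fun i j => u i j * (l j)%:C) ->
    forall j, 0 <= l j <= C.
  move=> Uu hu j; have lu := unitary_cols Uu j; have n1 := unitary_nrm2 Uu j.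
  have -> : l j = nrm2 (opapp a (u^~ j)).
    apply: ev => //; apply/funext => i.
    by have := congr1 (fun m : opmat R I => m i j) hu; rewrite mulrC.
  by rewrite nrm2_ge0 (le_trans (bop_nrm2 ba lu))// n1 mulr1.
have [u0 [l0 [Uu0 hu0]]] := spectral_gram infI ca.
have ex0 : exists b, is_fcalc Num.sqrt h b.
  by exists (conjdiag u0 (fun j => Num.sqrt (l0 j))), u0, l0.
have [u [l [Uu hu be]]] := fcalc_spec ex0; rewrite -/(opabs a) in be.
rewrite -/(conjdiag u (fun j => Num.sqrt (l j))) in be.
set b := opabs a in be *.
have lb := bnd _ _ Uu hu.
have sD j : `|Num.sqrt (l j)| <= Num.sqrt C.
  by rewrite ger0_norm ?sqrtr_ge0// ler_wsqrtr//; have /andP[] := lb j.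
have lu := unitary_cols Uu; have bu := unitary_bop Uu; have [_ ru _] := bu; have bu' := bop_adj bu.
have bcol j : opapp b (u^~ j) = fun i => (Num.sqrt (l j))%:C * u i j.
  by rewrite be (conjdiag_col j Uu sD).
have bapp v : l2 v -> opapp b v = opapp u (fun j => (Num.sqrt (l j))%:C * opapp (opadj u) v j).
  by move=> lv; rewrite be (conjdiag_app Uu sD lv).
have ex1 : exists b', is_fcalc (fun t => t `^ p) b b'.
  exists (conjdiag u (fun j => Num.sqrt (l j) `^ p)), u, (fun j => Num.sqrt (l j)); split => //.
  by apply/funext => i; apply/funext => j; have := congr1 (fun f => f i) (bcol j); rewrite mulrC.
have [u' [s [Uu' bu'e tre]]] := fcalc_spec ex1.
have lu' := unitary_cols Uu'.
have rb : l2rows b.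
  move=> i; have ld : l2 (fun j => (Num.sqrt (l j))%:C * u i j) by exact: l2_diag sD (ru i).
  have -> : b i = fun k => (opapp u (fun j => ((Num.sqrt (l j))%:C * u i j)^*) k)^*.
    apply/funext => k; rewrite be /conjdiag /opmul /opapp -csum_conj.
    apply: eq_csum => j; rewrite !conjM !conjc_real conjcK /opadj; ring.
  by apply: l2_conj; apply: bop_l2 bu _; exact: l2_conj.
have bs j : opapp b (u'^~ j) = fun i => (s j)%:C * u' i j.
  by apply/funext => i; have := congr1 (fun m : opmat R I => m i j) bu'e; rewrite mulrC.
(* s_j is the value of the quadratic form of |a| at a unit vector; in the first eigenbasis it is a
   sum of nonnegative terms. *)
have s0 j : 0 <= s j.
  set x := opapp (opadj u) (u'^~ j); have lx : l2 x by exact: bop_l2 bu' (lu' j).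
  have lsx : l2 (fun k => (Num.sqrt (l k))%:C * x k) by exact: l2_diag sD lx.
  have e : (s j)%:C = inner (fun k => (Num.sqrt (l k))%:C * x k) x.
    have := adjP bu lsx (lu' j); rewrite -(bapp _ (lu' j)) bs -/x => <-.
    by rewrite innerZl// (unitary_inner Uu') eqxx mulr1.
  have p0' k : 0 <= Num.sqrt (l k) * cabs (x k) ^+ 2 by rewrite mulr_ge0 ?sqrtr_ge0 ?exprn_ge0 ?cabs_ge0.
  have : inner (fun k => (Num.sqrt (l k))%:C * x k) x =
      (fine (nsum (fun k => Num.sqrt (l k) * cabs (x k) ^+ 2)%R))%:C.
    rewrite -csum_pos//.
      by apply: eq_csum => k; rewrite -mulrA mulcJ -realCM.
    have := asum_inner lsx lx; rewrite /asum.
    rewrite (eq_nsum (g := fun k => Num.sqrt (l k) * cabs (x k) ^+ 2)%R)// => k.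
    by rewrite !cabsM cabs_real cabs_conj ger0_norm ?sqrtr_ge0// -mulrA -expr2.
  by rewrite -e => /complexI ->; rewrite fine_ge0// nsum_ge0.
have lge0 j : 0 <= l j by have /andP[] := lb j.
(* |a| squares to the Gram operator, so the eigenbasis of |a| chosen second diagonalizes the Gram
   operator with eigenvalues s_j^2. *)
have hbb v : l2 v -> opapp h v = opapp b (opapp b v).
  move=> lv; have lx := bop_l2 bu' lv.
  have lsx : l2 (fun k => (Num.sqrt (l k))%:C * opapp (opadj u) v k) by exact: l2_diag sD lx.
  rewrite (bapp _ lv) bapp; last exact: bop_l2 bu lsx.
  rewrite (unitary_Kadj Uu lsx) -{1}(unitary_adjK Uu lv) -(opmul_app rh bu lx) hu.
  apply/funext => i; apply: eq_csum => j.
  by rewrite mulrA -realCM -expr2 sqr_sqrtr// mulrA.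
have hs j : opapp h (u'^~ j) = fun i => (s j ^+ 2)%:C * u' i j.
  rewrite hbb// bs; apply/funext => i; rewrite opappZ// bs mulrA.
  by rewrite -realCM expr2.
exists u', s; split => //.
have sC j : s j `^ p <= Num.sqrt C `^ p.
  apply: le_powR => //; apply: sqr_le_sqrt => //.
  rewrite (ev _ _ (lu' j) (unitary_nrm2 Uu' j) (hs j)).
  by rewrite (le_trans (bop_nrm2 ba (lu' j)))// (unitary_nrm2 Uu') mulr1.
have tn i : 0 <= nrm2 (u' i) by exact: nrm2_ge0.
have q0 i j : 0 <= s j `^ p * cabs (u' i j) ^+ 2.
  by rewrite mulr_ge0 ?powR_ge0 ?exprn_ge0 ?cabs_ge0.
rewrite /trpow /optr -/b.
(* The i-th diagonal entry is the sum over j of s_j^p |u'_ij|^2; summing over i first leaves the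
   s_j^p, because the columns are unit vectors. *)
transitivity (\esum_(i in [set: I]) nsum (fun j => s j `^ p * cabs (u' i j) ^+ 2)%R).
  apply: eq_esum => i _; rewrite tre.
  have fin : (nsum (fun j => s j `^ p * cabs (u' i j) ^+ 2)%R < +oo)%E.
    apply: (@le_lt_trans _ _ (nsum (fun j => Num.sqrt C `^ p * cabs (u' i j) ^+ 2)%R)).
      by apply: le_nsum => j; rewrite ler_wpM2r ?exprn_ge0 ?cabs_ge0.
    rewrite nsumZ ?powR_ge0//; last by move=> j; rewrite exprn_ge0 ?cabs_ge0.
    have [_ ru' _] := unitary_bop Uu'.
    by rewrite -sqnormE sqnorm_fin// -EFinM ltry.
  rewrite nsum_fin//; congr EFin.
  transitivity (complex.Re (fine (nsum (fun j => s j `^ p * cabs (u' i j) ^+ 2)%R))%:C) => //.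
  congr complex.Re; rewrite -csum_pos//; apply: eq_csum => j.
  by rewrite /opadj realCM -mulcJ; ring.
rewrite nsum_exchange//; apply: eq_esum => j _.
rewrite nsumZ ?powR_ge0//; last by move=> i; rewrite exprn_ge0 ?cabs_ge0.
by rewrite -(sqnormE (u'^~ j)) sqnorm_fin// (unitary_nrm2 Uu') mule1.
Qed.

(** A decomposition of a into rank one terms c_k xi_k eta_k^* over an arbitrary index type, which
    leaves room for merging two decompositions. *)
Definition atoms (K : choiceType) a (c : K -> R[i]) (xi eta : K -> I -> R[i]) :=
  [/\ forall k, (sqnorm (xi k) <= 1%:E)%E, forall k, (sqnorm (eta k) <= 1%:E)%E &
      forall i j, a i j = csum (fun k => c k * (xi k i * (eta k j)^*))].

Lemma trpow_ge0 a : compact_op a -> (0 <= trpow p a)%E.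
Proof.
by move=> /trpow_eig[u [s [_ s0 _ ->]]]; apply: nsum_ge0 => j; exact: powR_ge0.
Qed.

(** The left singular vectors. For s_k = 0 the inverse is 0 and so is the vector: this is why norms
    are only bounded by 1 and orthonormality is claimed for positive s_k only. *)
Let svdvec (a u : opmat R I) (s : I -> R) k i : R[i] := (s k)^-1%:C * opapp a (u^~ k) i.

Lemma trpow_svd a : compact_op a -> exists (u : opmat R I) (s : I -> R) (f : I -> I -> R[i]),
  [/\ unitary_op u, forall j, 0 <= s j, trpow p a = nsum (fun j => s j `^ p)%R,
      forall j, opapp a (u^~ j) = fun i => (s j)%:C * f j i &
      (forall j, (sqnorm (f j) <= 1%:E)%E) /\
      forall j k, 0 < s j -> 0 < s k -> inner (f j) (f k) = (j == k)%:R].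
Proof.
move=> ca; have [u [s [Uu s0 hs trs]]] := trpow_eig ca.
have [C ba] := compact_op_bounded ca.
have lu := unitary_cols Uu; have lau j := bop_l2 ba (lu j).
have iau j k : inner (opapp a (u^~ j)) (opapp a (u^~ k)) = (s j ^+ 2)%:C * (j == k)%:R.
  by rewrite -(inner_gram ca)// hs innerZl// (unitary_inner Uu).
have nau j : nrm2 (opapp a (u^~ j)) = s j ^+ 2.
  by apply: complexI; rewrite -inner_self// iau eqxx mulr1.
exists u, s, (svdvec a u s); split => //.
  move=> j; apply/funext => i; rewrite /svdvec.
  have [sj0|sj0] := eqVneq (s j) 0; last by rewrite mulrA -realCM mulfV// mul1r.
  rewrite sj0 mul0r (nrm2_eq0 (lau j))//.
  by rewrite nau sj0 expr0n.
split => [j|j k sj sk].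
  have lz : l2 (svdvec a u s j) by exact: l2Z.
  rewrite sqnorm_fin// lee_fin nrm2Z// nau cabs_real ger0_norm ?invr_ge0// exprVn.
  have [->|sj0] := eqVneq (s j) 0; first by rewrite expr0n mulr0.
  by rewrite mulVf// expf_neq0.
transitivity ((s j)^-1%:C * (((s k)^-1%:C)^* * inner (opapp a (u^~ j)) (opapp a (u^~ k)))).
  by rewrite -innerZr// -innerZl//; exact: l2Z.
rewrite iau conjc_real mulrA mulrA -!realCM.
have [->|jk] := eqVneq j k; last by rewrite !mulr0.
by rewrite mulr1 (_ : _ * _ * _ = 1)//; field; rewrite gt_eqF.
Qed.

Lemma trpow_atoms a : compact_op a -> exists (s : I -> R) (xi eta : I -> I -> R[i]),
  [/\ forall j, 0 <= s j, trpow p a = nsum (fun j => s j `^ p)%R &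
      atoms a (fun j => (s j)%:C) xi eta].
Proof.
move=> ca; have [u [s [f [Uu s0 trs af [f1 _]]]]] := trpow_svd ca.
have [C ba] := compact_op_bounded ca; have [_ ra _] := ba.
have lu := unitary_cols Uu; have bu := unitary_bop Uu; have [_ ru _] := bu.
exists s, f, (fun k i => u i k); split => //; split => // [k|i j].
  by rewrite sqnorm_fin; [rewrite (unitary_nrm2 Uu)|exact: lu].
(* Insert u times its adjoint between a and the j-th canonical vector. *)
rewrite -(opapp_dvec a j i) -(unitary_adjK Uu (l2_dvec R j)).
rewrite -(opmul_app ra bu); last by apply: bop_l2 (bop_adj bu) _; exact: l2_dvec.
apply: eq_csum => k; rewrite opapp_dvec mulrA; congr (_ * _).
by rewrite -(congr1 (fun f => f i) (af k)).
Qed.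

(** With [trpow_atoms], this identifies tr |a|^p with the least p-cost of a rank one decomposition.
    All later estimates of [trpow] from above exhibit a decomposition. *)
Lemma trpow_le_atoms (K : choiceType) a (c : K -> R[i]) (xi eta : K -> I -> R[i]) :
  compact_op a -> atoms a c xi eta -> (trpow p a <= nsum (fun k => cabs (c k) `^ p)%R)%E.
Proof.
move=> ca [xi1 eta1 rep]; have [u [s [f [Uu s0 -> af [f1 of_]]]]] := trpow_svd ca.
apply: nsum_le => r ur.
(* Zero singular values contribute nothing, and only the others have orthonormal left singular
   vectors. *)
rewrite (bigID (fun j => 0 < s j))/= [X in _ + X]big1 ?addr0; last first.
  move=> j; rewrite -leNgt => sj; have -> : s j = 0 by apply/eqP; rewrite eq_le sj s0.
  by rewrite powR0// gt_eqF.
rewrite -big_filter; set t := [seq j <- r | 0 < s j].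
have ut : uniq t by rewrite filter_uniq.
have : {in t, forall j, 0 < s j} by move=> j; rewrite mem_filter => /andP[].
move: ut; rewrite {}/t; case: [seq j <- r | 0 < s j] => [|j0 t'].
  by move=> _ _; rewrite big_nil nsum_ge0// => k; exact: powR_ge0.
set t := j0 :: t' => ut tin.
have tpos (k : 'I_(size t)) : 0 < s (nth j0 t k).
  by apply: tin; rewrite mem_nth.
rewrite (big_nth j0) big_mkord.
apply: (rank_one_ineq p0 p1 (e := fun k : 'I_(size t) => u^~ (nth j0 t k))
  (f := fun k : 'I_(size t) => f (nth j0 t k)) _ _ _ _ xi1 eta1 rep) => //.
- split => [k|k l]; first exact: unitary_cols Uu _.
  by rewrite (unitary_inner Uu) nth_uniq.
- split => [k|k l]; first exact: l2_le (f1 _).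
  by rewrite of_// nth_uniq.
Qed.

End Trpow.

(** * Families supported by the range of an injection *)

Section RangeSums.
Variables (R : realType) (I J : choiceType) (g : J -> I).
Hypothesis gi : injective g.

Lemma nsum_range (f : I -> R) : (forall i, (forall j, i != g j) -> f i = 0) ->
  nsum f = nsum (fun j => f (g j))%R.
Proof.
move=> f0; rewrite /nsum -(@reindex_esum _ _ _ [set: J] (range g) g (fun i => (f i)%:E)); last first.
  by split => // [x y _ _ /gi].
rewrite [RHS]esum_mkcond; apply: eq_esum => i _; case: ifPn => // /negP ni.
rewrite f0// => j; apply/eqP => e; apply: ni; rewrite inE; exists j => //.
Qed.

Lemma csum_range (f : I -> R[i]) : (forall i, (forall j, i != g j) -> f i = 0) ->
  csum f = csum (fun j => f (g j)).
Proof.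
move=> f0; have h (part : R[i] -> R) : part 0 = 0 ->
    rsum (fun i => part (f i)) = rsum (fun j => part (f (g j))).
  move=> p0; rewrite /rsum -/(nsum _) -/(nsum _) !nsum_range// => i /f0 ->.
    by rewrite p0 oppr0 maxxx.
  by rewrite p0 maxxx.
by rewrite /csum h// h.
Qed.

End RangeSums.

Lemma bounded_subseq (R : realType) (z : nat -> R) (M : R) : (forall n, `|z n| <= M) ->
  exists (s : nat -> nat) (l : R), {homo s : m n / (m < n)%N} /\
  forall e : R, 0 < e -> exists N, forall n, (N <= n)%N -> `|z (s n) - l| <= e.
Proof.
move=> zM; have [|s si /cvg_ex[/= l sl]] := @bolzano_weierstrass R z.
  by exists M; split; [exact: num_real|move=> x Mx n _ /=; rewrite (le_trans (zM n))// ltW].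
exists s, l; split; first by move=> m n mn; have := leW_mono si m n; rewrite !ltEnat/= mn.
move=> e e0; move/cvgrPdist_le : sl => /(_ e e0)[N _ hN].
by exists N => n Nn; rewrite distrC; exact: hN.
Qed.

Lemma bounded_subseqC (R : realType) (z : nat -> R[i]) (M : R) : (forall n, cabs (z n) <= M) ->
  exists (s : nat -> nat) (l : R[i]), {homo s : m n / (m < n)%N} /\
  forall e : R, 0 < e -> exists N, forall n, (N <= n)%N -> cabs (z (s n) - l) <= e.
Proof.
move=> zM.
have [s [x [sm sx]]] := @bounded_subseq R (fun n => complex.Re (z n)) M
  (fun n => le_trans (cabs_Re _) (zM n)).
have [t [y [tm ty]]] := @bounded_subseq R (fun n => complex.Im (z (s n))) M
  (fun n => le_trans (cabs_Im _) (zM (s n))).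
exists (s \o t), (x +i* y); split; first by move=> m n mn /=; apply/sm/tm.
move=> e e0; have e20 : 0 < e / 2 by rewrite divr_gt0.
have [N1 h1] := sx _ e20; have [N2 h2] := ty _ e20.
exists (maxn N1 N2) => n; rewrite geq_max => /andP[n1 n2] /=.
rewrite (le_trans (cabs_ReIm _))// ReD ReN ImD (_ : complex.Im (- _) = - y)//=.
have := h1 (t n) (leq_trans n1 (homo_ltn_ge tm n)); have := h2 n n2; lra.
Qed.

(** * Closure properties of compact operators *)

Section CompactClosure.
Variable R : realType.

Lemma compact_opP (I : choiceType) (a : opmat R I) : l2rows a ->
  (forall v : nat -> I -> R[i], (forall n, (sqnorm (v n) <= 1)%E) ->
  exists (s : nat -> nat) w, [/\ {homo s : m n / (m < n)%N}, l2 w &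
    forall e : R, 0 < e -> exists N, forall n, (N <= n)%N ->
      (sqnorm (fun i => opapp a (v (s n)) i - w i)%R <= e%:E)%E]) -> compact_op a.
Proof.
move=> la H; split => // v /H[s [w [sm lw h]]]; exists s, w; split => //.
by apply/(cvg_ge0_eps (g := fun n => _)) => // n; exact: sqnorm_ge0.
Qed.

Lemma compact_opZ (I : choiceType) (c : R[i]) (a : opmat R I) : compact_op a ->
  compact_op (fun i j => c * a i j).
Proof.
move=> ca; have ra : l2rows a := ca.1; apply: compact_opP => [i|v v1]; first exact: l2Z.
have [s [w [sm lw h]]] := compact_subseq ca v1.
exists s, (fun i => c * w i); split => //; first exact: l2Z.
move=> e e0; have d0 : 0 < e / (cabs c ^+ 2 + 1).
  by rewrite divr_gt0// ltr_wpDl ?exprn_ge0 ?cabs_ge0.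
have [N hN] := h _ d0; exists N => n /hN hn.
rewrite (_ : (fun i => _) = fun i => c * (opapp a (v (s n)) i - w i)); last first.
  apply/funext => i; rewrite mulrBr /opapp -csumZ.
    by congr (_ - _); apply: eq_csum => j; rewrite mulrA.
  exact: asum_mul (ra i) (l2_le (v1 _)).
rewrite sqnormZ (@le_trans _ _ ((cabs c ^+ 2)%:E * (e / (cabs c ^+ 2 + 1))%:E)%E)//.
  by rewrite lee_wpmul2l// lee_fin exprn_ge0 ?cabs_ge0.
rewrite -EFinM lee_fin mulrA ler_pdivrMr ?ltr_wpDl ?exprn_ge0 ?cabs_ge0//.
by rewrite mulrC ler_wpM2l ?(ltW e0)// lerDl.
Qed.

Lemma compact_opD (I : choiceType) (a b : opmat R I) : compact_op a -> compact_op b ->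
  compact_op (fun i j => a i j + b i j).
Proof.
move=> ca cb; have ra : l2rows a := ca.1; have rb : l2rows b := cb.1.
apply: compact_opP => [i|v v1]; first exact: l2D.
have [s [w [sm lw h]]] := compact_subseq ca v1.
have [t [x [tm lx k]]] := compact_subseq cb (fun n => v1 (s n)).
exists (s \o t), (fun i => w i + x i); split => //; first by move=> m n mn /=; apply/sm/tm.
  exact: l2D.
move=> e e0; have d0 : 0 < e / 4 by rewrite divr_gt0.
have [N1 h1] := h _ d0; have [N2 h2] := k _ d0.
exists (maxn N1 N2) => n; rewrite geq_max => /andP[n1 n2] /=.
rewrite (_ : (fun i => _) = fun i => (opapp a (v (s (t n))) i - w i) + (opapp b (v (s (t n))) i - x i)).
  have g1 := h1 (t n) (leq_trans n1 (homo_ltn_ge tm n)); have g2 := h2 n n2.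
  have l1 := l2_le g1; have l2' := l2_le g2.
  rewrite sqnorm_fin; last exact: l2D.
  rewrite lee_fin (le_trans (nrm2D_le l1 l2'))//.
  by have := nrm2_le g1; have := nrm2_le g2; lra.
apply/funext => i; rewrite addrACA -opprD; congr (_ - _).
have lv := l2_le (v1 (s (t n))).
rewrite /opapp -csumD; do ?exact: asum_mul.
by apply: eq_csum => j; rewrite mulrDl.
Qed.

Lemma compact_op0 (I : choiceType) : compact_op (fun _ _ : I => 0 : R[i]).
Proof.
apply: compact_opP => [i|v v1]; first exact: l2_0.
exists id, (fun=> 0); split => //; first exact: l2_0.
move=> e e0; exists 0%N => n _; rewrite (_ : (fun i => _) = fun=> 0).
  by rewrite sqnorm_fin ?nrm2_0 ?lee_fin ?(ltW e0)//; exact: l2_0.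
apply/funext => i; rewrite subr0 /opapp -[RHS](csum0 R I).
by apply: eq_csum => j; rewrite mul0r.
Qed.

Definition munit (I : choiceType) (i0 j0 : I) : opmat R I :=
  fun i j => ((i == i0) && (j == j0))%:R.

Lemma compact_munit (I : choiceType) (i0 j0 : I) : compact_op (munit i0 j0).
Proof.
have ra : l2rows (munit i0 j0).
  by move=> i; apply: (@l2_supp _ _ _ [:: j0]) => // j; rewrite inE /munit => /negPf ->; rewrite andbF.
apply: compact_opP => // v v1.
have [s [l [sm sl]]] := @bounded_subseqC R (fun n => v n j0) 1 (fun n => cabs_unit j0 (v1 n)).
exists s, (fun i => if i == i0 then l else 0); split => //.
  by apply: (@l2_supp _ _ _ [:: i0]) => // i; rewrite inE => /negPf ->.
(* The coordinate must be small in square: x <= min(e, 1) gives x^2 <= e. *)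
move=> e e0; have m0 : 0 < Num.min e 1 by rewrite lt_min e0 ltr01.
have [N hN] := sl _ m0.
exists N => n /hN hn.
rewrite (_ : (fun i => _) = fun i => if i == i0 then v (s n) j0 - l else 0).
  rewrite sqnormE (eq_nsum (g := fun i => if i == i0 then cabs (v (s n) j0 - l) ^+ 2 else 0)%R).
    rewrite nsum1 ?exprn_ge0 ?cabs_ge0// lee_fin.
    move: hn; rewrite le_min => /andP[h1 h2].
    by rewrite expr2 (le_trans _ h1)// ler_piMr ?cabs_ge0.
  by move=> i; case: ifP => // _; rewrite cabs0 expr0n.
apply/funext => i; rewrite /opapp.
transitivity (csum (fun j => if j == j0 then (i == i0)%:R * v (s n) j0 else 0) - (if i == i0 then l else 0)).
  congr (_ - _); apply: eq_csum => j; rewrite /munit.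
  by case: (eqVneq j j0) => [->|_]; rewrite ?andbT ?andbF ?mul0r.
by rewrite csum1; case: ifP => _; rewrite ?mul1r ?mul0r ?subr0.
Qed.

Section Embed.
Variables (I J : choiceType) (f g : J -> I) (f' g' : I -> option J).
Hypotheses (fK : pcancel f f') (gK : pcancel g g').
Hypotheses (fK' : ocancel f' f) (gK' : ocancel g' g).

(** Places a matrix over J in the rows of the range of f and the columns of the range of g, through
    their partial inverses. With slices of nat * int this is a single block of a block matrix. *)
Definition emb (a : opmat R J) : opmat R I := fun i j =>
  if f' i is Some n then if g' j is Some m then a n m else 0 else 0.

Let offrange (h : J -> I) (h' : I -> option J) (hK' : ocancel h' h) i :
  (forall j, i != h j) -> h' i = None.
Proof.
by move=> ni; case E : (h' i) => [j|//]; have := hK' i; rewrite E /= => e; have := ni j; rewrite e eqxx.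
Qed.

Lemma compact_emb a : compact_op a -> compact_op (emb a).
Proof.
move=> ca; have ra : l2rows a := ca.1; have gi := pcan_inj gK; have fi := pcan_inj fK.
apply: compact_opP => [i|v v1].
  rewrite /l2 sqnormE (nsum_range gi).
    rewrite /emb; case: (f' i) => [n|]; last first.
      by rewrite (eq_nsum (g := fun=> 0)%R) ?nsum0// => j; rewrite cabs0 expr0n.
    by have := ra n; rewrite /l2 sqnormE; under [X in _ -> (nsum X < _)%E]eq_fun do rewrite gK.
  move=> j /(offrange gK') gj; rewrite /emb gj.
  by case: (f' i) => [n|]; rewrite cabs0 expr0n.
have v1' n : (sqnorm (fun j => v n (g j)) <= 1)%E.
  apply: le_trans (v1 n); rewrite !sqnormE.
  by apply: (nsum_inj (f := fun i => cabs (v n i) ^+ 2)) => // i; rewrite exprn_ge0 ?cabs_ge0.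
have [s [w [sm lw h]]] := compact_subseq ca v1'.
exists s, (fun i => if f' i is Some n then w n else 0); split => //.
  rewrite /l2 sqnormE (nsum_range fi).
    by move: lw; rewrite /l2 sqnormE; under [X in _ -> (nsum X < _)%E]eq_fun do rewrite fK.
  by move=> j /(offrange fK') ->; rewrite cabs0 expr0n.
move=> e /h[N hN]; exists N => n /hN hn.
have E i : opapp (emb a) (v (s n)) i =
    if f' i is Some k then opapp a (fun j => v (s n) (g j)) k else 0.
  rewrite /opapp /emb; case: (f' i) => [k|]; last first.
    by rewrite -[RHS](csum0 R I); apply: eq_csum => j; rewrite mul0r.
  rewrite (csum_range gi); first by apply: eq_csum => j; rewrite gK.
  by move=> j /(offrange gK') ->; rewrite mul0r.
rewrite sqnormE (nsum_range fi).
  by move: hn; rewrite sqnormE; under [X in _ -> (nsum X <= _)%E]eq_fun do rewrite E fK.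
by move=> j /(offrange fK') fj; rewrite E fj subrr cabs0 expr0n.
Qed.

End Embed.
End CompactClosure.

(** * Homogeneity, unitary invariance and subadditivity of tr |a|^p *)

Section TrpowNorm.
Variables (R : realType) (I : countType).
Hypothesis infI : infinite_set [set: I].
Variables (p : R) (p0 : 0 < p) (p1 : p < 1).
Implicit Types (a b : opmat R I).

Lemma trpowZ a (c : R[i]) : compact_op a ->
  (trpow p (fun i j => c * a i j)%R <= (cabs c `^ p)%:E * trpow p a)%E.
Proof.
move=> ca; have [s [xi [eta [s0 -> [xi1 eta1 rep]]]]] := trpow_atoms infI p0 ca.
(* When tr |a|^p is infinite the bound is void unless c = 0; then the product is 0 and the zero
   decomposition is needed. *)
have [s_oo|] := eqVneq (nsum (fun j => s j `^ p)%R) +oo%E.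
  rewrite s_oo; have [->|c0] := eqVneq c 0; last first.
    by rewrite gt0_muley ?leey// lte_fin powR_gt0// lt_neqAle cabs_ge0 andbT eq_sym cabs_eq0.
  rewrite cabs0 powR0 ?gt_eqF// mul0e.
  apply: (le_trans (trpow_le_atoms infI p0 p1 (compact_opZ 0 ca)
    (c := fun _ : I => 0) (xi := fun _ _ => 0) (eta := fun _ _ => 0) _)).
    split => [k|k|i j]; try by rewrite sqnorm_fin ?nrm2_0 ?lee_fin//; exact: l2_0.
    by rewrite mul0r -[LHS](csum0 R I); apply: eq_csum => k; rewrite mul0r.
  by rewrite (eq_nsum (g := fun=> 0)%R) ?nsum0// => k; rewrite cabs0 powR0 ?gt_eqF.
rewrite -ltey => soo.
have ss := nsum_of_pow p0 p1 s0 soo.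
apply: (le_trans (trpow_le_atoms infI p0 p1 (compact_opZ c ca)
    (c := fun k => c * (s k)%:C) (xi := xi) (eta := eta) _)).
  split => // i j; rewrite rep -csumZ; first by apply: eq_csum => k; rewrite mulrA.
  apply: (@asum_le _ _ _ s) => // k.
  rewrite !cabsM cabs_conj cabs_real ger0_norm// ler_piMr// mulr_ile1 ?cabs_ge0 ?cabs_unit//.
rewrite -nsumZ ?powR_ge0//; last by move=> j; exact: powR_ge0.
apply: le_nsum => k; rewrite cabsM cabs_real ger0_norm// powRM ?cabs_ge0//.
Qed.

(** Unimodular row and column factors are absorbed in the vectors of the decomposition, whose norms
    they preserve. *)
Lemma trpow_twist a (al be : I -> R[i]) :
  (forall i, cabs (al i) = 1) -> (forall i, cabs (be i) = 1) -> compact_op a ->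
  compact_op (fun i j => al i * a i j * be j) ->
  (trpow p (fun i j => al i * a i j * be j)%R <= trpow p a)%E.
Proof.
move=> al1 be1 ca cb; have [s [xi [eta [s0 -> [xi1 eta1 rep]]]]] := trpow_atoms infI p0 ca.
have [->|] := eqVneq (nsum (fun j => s j `^ p)%R) +oo%E; first by rewrite leey.
rewrite -ltey => soo.
have ss := nsum_of_pow p0 p1 s0 soo.
apply: (le_trans (trpow_le_atoms infI p0 p1 cb
    (c := fun k => (s k)%:C) (xi := fun k i => al i * xi k i)
    (eta := fun k i => (be i)^* * eta k i) _)).
  split => [k|k|i j].
  - rewrite (_ : sqnorm _ = sqnorm (xi k))//; apply: eq_nsum => i.
    by rewrite cabsM al1 mul1r.
  - rewrite (_ : sqnorm _ = sqnorm (eta k))//; apply: eq_nsum => i.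
    by rewrite cabsM cabs_conj be1 mul1r.
  - rewrite rep mulrAC -csumZ.
      by apply: eq_csum => k; rewrite conjM conjcK; ring.
    apply: (@asum_le _ _ _ s) => // k.
    by rewrite !cabsM cabs_conj cabs_real ger0_norm// ler_piMr// mulr_ile1 ?cabs_ge0 ?cabs_unit.
by apply: le_nsum => k; rewrite cabs_real ger0_norm.
Qed.

(** Decompositions of a and b, put side by side over [bool * I], form one of a + b whose p-cost is
    the sum of the two. *)
Lemma trpowD a b : compact_op a -> compact_op b ->
  (trpow p (fun i j => a i j + b i j)%R <= trpow p a + trpow p b)%E.
Proof.
move=> ca cb; have ta0 := trpow_ge0 infI p0 ca; have tb0 := trpow_ge0 infI p0 cb.
have [sa [xia [etaa [sa0 ea [xia1 etaa1 repa]]]]] := trpow_atoms infI p0 ca.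
have [sb [xib [etab [sb0 eb [xib1 etab1 repb]]]]] := trpow_atoms infI p0 cb.
rewrite ea in ta0 *; rewrite eb in tb0 *.
have [A1|] := eqVneq (nsum (fun j => sa j `^ p)%R) +oo%E.
  by rewrite A1 addye ?leey// -ltNye; exact: lt_le_trans tb0.
rewrite -ltey => oa.
have [B1|] := eqVneq (nsum (fun j => sb j `^ p)%R) +oo%E.
  by rewrite B1 addey ?leey// -ltNye; exact: lt_le_trans ta0.
rewrite -ltey => ob.
have ssa := nsum_of_pow p0 p1 sa0 oa; have ssb := nsum_of_pow p0 p1 sb0 ob.
pose c (k : bool * I) : R[i] := if k.1 then (sa k.2)%:C else (sb k.2)%:C.
pose xi (k : bool * I) := if k.1 then xia k.2 else xib k.2.
pose eta (k : bool * I) := if k.1 then etaa k.2 else etab k.2.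
have two (F : bool -> R) : (forall t, 0 <= F t) -> nsum F = (F true + F false)%:E.
  move=> F0; rewrite (@nsum_supp _ _ _ [:: true; false])//; last by case.
  by rewrite big_cons big_seq1.
have Fsplit (F : bool * I -> R) : (forall k, 0 <= F k) ->
    (nsum (fun k => F (true, k))%R < +oo)%E -> (nsum (fun k => F (false, k))%R < +oo)%E ->
    nsum F = (nsum (fun k => F (true, k))%R + nsum (fun k => F (false, k))%R)%E.
  move=> F0 f1 f2.
  have -> : nsum F = \esum_(t in [set: bool]) nsum (fun k => F (t, k))%R.
    rewrite (nsum_pair (f := fun t k => F (t, k)))//; apply: eq_nsum; by case.
  transitivity (nsum (fun t => fine (nsum (fun k => F (t, k))))%R).
    by apply: eq_esum => -[] _; rewrite -nsum_fin.
  rewrite two; first by rewrite EFinD -!nsum_fin.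
  by move=> t; rewrite fine_ge0// nsum_ge0.
apply: (le_trans (trpow_le_atoms infI p0 p1 (compact_opD ca cb) (c := c) (xi := xi) (eta := eta) _)).
  split => [[[] k]|[[] k]|i j]; rewrite /xi/eta//=.
  have cz : asum (fun k : bool * I => c k * (xi k i * (eta k j)^*)).
    have le (s : I -> R) (x y : I -> I -> R[i]) k : (forall k, 0 <= s k) ->
        (forall k, (sqnorm (x k) <= 1%:E)%E) -> (forall k, (sqnorm (y k) <= 1%:E)%E) ->
        cabs ((s k)%:C * (x k i * (y k j)^*)) <= s k.
      move=> s0 x1 y1.
      by rewrite !cabsM cabs_conj cabs_real ger0_norm// ler_piMr// mulr_ile1 ?cabs_ge0 ?cabs_unit.
    have ga : (nsum (fun k => cabs ((sa k)%:C * (xia k i * (etaa k j)^*)))%R < +oo)%E.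
      by apply: le_lt_trans ssa; apply: le_nsum => k; exact: le.
    have gb : (nsum (fun k => cabs ((sb k)%:C * (xib k i * (etab k j)^*)))%R < +oo)%E.
      by apply: le_lt_trans ssb; apply: le_nsum => k; exact: le.
    rewrite /asum Fsplit//=; last by move=> k; exact: cabs_ge0.
    by rewrite lte_add_pinfty.
  rewrite -(csum_pair (f := fun t k => c (t, k) * (xi (t, k) i * (eta (t, k) j)^*))); last first.
    by move: cz; congr asum; apply/funext => -[].
  rewrite (@csum_supp _ _ _ [:: true; false])//; last by case.
  by rewrite big_cons big_seq1 repa repb.
rewrite Fsplit/c/=.
- by apply: leeD; apply: le_nsum => k; rewrite cabs_real ger0_norm.
- by move=> k; exact: powR_ge0.
- by apply: le_lt_trans oa; apply: le_nsum => k; rewrite cabs_real ger0_norm.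
- by apply: le_lt_trans ob; apply: le_nsum => k; rewrite cabs_real ger0_norm.
Qed.

End TrpowNorm.

(** * Integration on the circle *)

Section Cis.
Variable R : realType.
Implicit Types (s t x : R) (k : int) (g : R[i]).

Definition cis t : R[i] := cos (2 * pi * t) +i* sin (2 * pi * t).

Lemma cisD s t : cis (s + t) = cis s * cis t.
Proof.
rewrite /cis mulrDr cosD sinD; apply/eqP; rewrite eq_complex; apply/andP; split; apply/eqP => /=.
  by [].
by rewrite addrC [cos _ * sin _]mulrC [sin _ * cos _]mulrC [X in _ + X]mulrC addrC; ring.
Qed.

Lemma cis0 : cis 0 = 1.
Proof. by rewrite /cis mulr0 cos0 sin0. Qed.

Lemma cis1 : cis 1 = 1.
Proof. by rewrite /cis mulr1 mulr_natl cos2pi sin2pi. Qed.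

Lemma cabs_cis t : cabs (cis t) = 1.
Proof.
apply/eqP; rewrite -(@eqrXn2 _ 2) ?cabs_ge0// sqr_cabs expr1n /=.
by rewrite cos2Dsin2.
Qed.

Lemma cis_neq0 t : cis t != 0.
Proof. by rewrite -cabs_eq0 cabs_cis oner_neq0. Qed.

Lemma cisN t : cis (- t) = (cis t)^-1.
Proof.
apply: (mulfI (cis_neq0 t)); rewrite -cisD subrr cis0 mulfV//.
exact: cis_neq0.
Qed.

Lemma cis_conj t : (cis t)^* = cis (- t).
Proof. by rewrite /cis mulrN cosN sinN. Qed.

Lemma cisXn t n : cis t ^+ n = cis (n%:R * t).
Proof.
elim: n => [|n IH]; first by rewrite expr0 mul0r cis0.
by rewrite exprS IH -cisD -nat1r mulrDl mul1r.
Qed.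

Lemma cisX t k : cis t ^ k = cis (k%:~R * t).
Proof.
case: k => n; first by rewrite -exprnP cisXn.
by rewrite NegzE -exprnN cisXn -cisN mulrNz mulNr.
Qed.

Lemma cis_int k : cis k%:~R = 1.
Proof. by rewrite -[k%:~R]mulr1 -cisX cis1 exp1rz. Qed.

Lemma cis_period t : cis (t + 1) = cis t.
Proof. by rewrite cisD cis1 mulr1. Qed.

Lemma cis_neq1 t : 0 < t < 1 -> cis t != 1.
Proof.
move=> /andP[t0 t1]; apply/negP => /eqP /(congr1 (@complex.Re R))/=.
have -> : 2 * pi * t = (pi * t) *+ 2 by ring.
rewrite cos_mulr2n cos2sin2 => h.
have : 0 < sin (pi * t).
  by rewrite sin_gt0_pi// mulr_gt0 ?pi_gt0//= gtr_pMr ?pi_gt0.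
have : sin (pi * t) ^+ 2 = 0 by lra.
by move/eqP; rewrite expf_eq0/= => /eqP ->; rewrite ltxx.
Qed.

Lemma cis_surj g : cabs g = 1 -> exists2 s, 0 <= s <= 1 & cis s = g.
Proof.
case: g => a b g1.
have ab : a ^+ 2 + b ^+ 2 = 1 by have := sqr_cabs (a +i* b); rewrite g1 expr1n.
have a1 : -1 <= a <= 1.
  by rewrite -ler_norml -(@ler_pXn2r _ 2)// ?nnegrE// expr1n real_normK ?num_real//; have := sqr_ge0 b; lra.
have t0 := acos_ge0 a1; have tpi := acos_lepi a1.
have ca : cos (acos a) = a by apply: acosK; rewrite in_itv.
have sa : sin (acos a) = `|b|.
  by rewrite sin_acos// (_ : 1 - a ^+ 2 = b ^+ 2) ?sqrtr_sqr//; lra.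
have pp := @pi_gt0 R; have p2 : 0 < 2 * pi :> R by rewrite mulr_gt0.
set th := acos a in t0 tpi ca sa.
have q1 : 2 * pi * (th / (2 * pi)) = th by rewrite mulrC divfK// gt_eqF.
have q0 : 0 <= th / (2 * pi) by rewrite divr_ge0// ltW.
have q2 : th / (2 * pi) <= 1 by rewrite ler_pdivrMr//; lra.
have [b0|b0] := leP 0 b.
  exists (th / (2 * pi)); first by rewrite q0.
  by rewrite /cis q1 ca sa ger0_norm.
exists (1 - th / (2 * pi)); first by rewrite subr_ge0 q2 gerBl.
rewrite cisD cis1 mul1r -cis_conj /cis q1 ca sa ltr0_norm//=.
by rewrite opprK.
Qed.

Lemma cis_near0 (e : R) : 0 < e -> exists2 d : R, 0 < d &
  forall u, `|u| < d -> cabs (cis u - 1) <= e.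
Proof.
move=> e0; have e2 : 0 < e / 2 by rewrite divr_gt0.
have cc : (fun u : R => cos (2 * pi * u)) u @[u --> 0] --> (1 : R).
  rewrite -[X in _ --> X]cos0 -[X in cos X](mulr0 (2 * pi)).
  apply: continuous_cvg; first exact: continuous_cos.
  by apply: cvgM; [exact: cvg_cst|exact: cvg_id].
have cs : (fun u : R => sin (2 * pi * u)) u @[u --> 0] --> (0 : R).
  rewrite -[X in _ --> X]sin0 -[X in sin X](mulr0 (2 * pi)).
  apply: continuous_cvg; first exact: continuous_sin.
  by apply: cvgM; [exact: cvg_cst|exact: cvg_id].
move/cvgrPdist_le : cc => /(_ _ e2)/nbhs_ballP[d1 /= d10 h1].
move/cvgrPdist_le : cs => /(_ _ e2)/nbhs_ballP[d2 /= d20 h2].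
exists (Num.min d1 d2); first by rewrite lt_min d10.
move=> u; rewrite lt_min => /andP[u1 u2].
rewrite (le_trans (cabs_ReIm _))//= subr0.
have := h1 u; rewrite /ball/= sub0r normrN => /(_ u1); rewrite distrC.
have := h2 u; rewrite /ball/= sub0r normrN => /(_ u2); rewrite sub0r normrN.
lra.
Qed.

Lemma root_sum N k : (0 < N)%N ->
  \sum_(j < N) cis (k%:~R * (j%:R / N%:R)) = if (N %| k)%Z then N%:R else 0.
Proof.
move=> N0; have NR : N%:R != 0 :> R by rewrite pnatr_eq0 -lt0n.
case: ifPn => [/dvdzP[q ->]|Nk].
  rewrite (eq_bigr (fun=> 1)) ?big_const_ord ?iter_addr_0// => j _.
  rewrite (_ : _ * _ = (q * j)%:~R) ?cis_int//.
  by rewrite !intrM -!pmulrn; field.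
set w := cis (k%:~R / N%:R).
have w1 : w != 1.
  have r0 : (k %% N)%Z != 0 by apply: contra Nk => /eqP/dvdz_mod0P.
  have Nz : (N : int) != 0 by rewrite eqz_nat -lt0n.
  have -> : w = cis ((k %% N)%Z%:~R / N%:R).
    rewrite /w {1}(divz_eq k N) intrD intrM mulrDl cisD.
    by rewrite -pmulrn mulfK// cis_int mul1r.
  apply: cis_neq1; have := modz_ge0 k Nz; have := ltz_pmod k (d := N); rewrite ltz_nat N0 => /(_ isT) h1 h2.
  rewrite divr_gt0 ?ltr0n//=; last by rewrite ltr0z lt_neqAle eq_sym r0.
  by rewrite ltr_pdivrMr ?ltr0n// mul1r pmulrn ltr_int.
have e : \sum_(j < N) cis (k%:~R * (j%:R / N%:R)) = \sum_(j < N) w ^+ j.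
  by apply: eq_bigr => j _; rewrite /w cisXn; congr cis; ring.
apply: (mulfI (_ : w - 1 != 0)); first by rewrite subr_eq0.
rewrite mulr0 e -subrX1 /w cisXn mulrCA mulfV// mulr1 cis_int subrr//.
Qed.

End Cis.

Section CircleIntegral.
Variable R : realType.
Local Notation mu := (@lebesgue_measure R).
Implicit Types f g : R -> R.

Lemma eps_continuous f :
  (forall x (e : R), 0 < e -> exists2 d : R, 0 < d & forall y, `|y - x| < d -> `|f y - f x| <= e) ->
  continuous f.
Proof.
move=> h x; apply/cvgrPdist_le => e /h -/(_ x)[d d0 hd].
apply/nbhs_ballP; exists d => // y; rewrite /ball/= distrC => /hd.
by rewrite distrC.
Qed.

Definition cint f : R := (\int[mu]_(t in `[0%R, 1%R]) f t)%R.

Lemma cont_integrable f (a b : R) : continuous f -> mu.-integrable `[a, b] (EFin \o f).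
Proof.
move=> cf; apply: continuous_compact_integrable; first exact: segment_compact.
exact: continuous_subspaceT.
Qed.

Lemma cint_fin f : continuous f ->
  (\int[mu]_(t in `[0%R, 1%R]) (f t)%:E)%E = (cint f)%:E.
Proof.
move=> cf; rewrite /cint /Rintegral fineK//.
by apply: integrable_fin_num => //; exact: cont_integrable.
Qed.

Lemma cintD f g : continuous f -> continuous g ->
  cint (fun t => f t + g t) = cint f + cint g.
Proof. by move=> cf cg; rewrite /cint RintegralD//; exact: cont_integrable. Qed.

Lemma cintZ (c : R) f : continuous f -> cint (fun t => c * f t) = c * cint f.
Proof. by move=> cf; rewrite /cint RintegralZl//; exact: cont_integrable. Qed.

Lemma cint_le f g : continuous f -> continuous g -> (forall t, f t <= g t) -> cint f <= cint g.
Proof. by move=> cf cg fg; apply: le_Rintegral => //; exact: cont_integrable. Qed.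

Lemma cint_ge0 f : (forall t, 0 <= f t) -> 0 <= cint f.
Proof. by move=> f0; apply: Rintegral_ge0. Qed.

Lemma cint_cst (c : R) : cint (fun=> c) = c.
Proof.
have m1 : @lebesgue_measure R `[0, 1] = 1%E.
  by rewrite lebesgue_measure_itv/= lte_fin ltr01 -EFinB subr0.
rewrite /cint Rintegral_cst//.
by transitivity (c * fine 1%E); [congr (c * fine _)|rewrite /= mulr1].
Qed.

Lemma continuous_sum (T : Type) (r : seq T) (F : T -> R -> R) :
  (forall t, continuous (F t)) -> continuous (fun x => \sum_(t <- r) F t x).
Proof.
move=> cF; elim: r => [|t r IH].
  by rewrite (_ : (fun x => _) = cst 0); [exact: cst_continuous|apply/funext => x; rewrite big_nil].
rewrite (_ : (fun x => _) = (F t) \+ (fun x => \sum_(u <- r) F u x)).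
  by move=> x; apply: cvgD; [exact: cF|exact: IH].
by apply/funext => x; rewrite big_cons.
Qed.

Lemma continuousMc (c : R) f : continuous f -> continuous (fun t => c * f t).
Proof. by move=> cf x; apply: cvgM; [exact: cvg_cst|exact: cf]. Qed.

Lemma continuousDf f g : continuous f -> continuous g -> continuous (fun t => f t + g t).
Proof. by move=> cf cg x; apply: cvgD; [exact: cf|exact: cg]. Qed.

Lemma cint_sum (T : Type) (r : seq T) (F : T -> R -> R) :
  (forall t, continuous (F t)) ->
  cint (fun x => \sum_(t <- r) F t x) = \sum_(t <- r) cint (F t).
Proof.
move=> cF; elim: r => [|t r IH].
  rewrite big_nil -[RHS](cint_cst 0); congr cint; apply/funext => x; by rewrite big_nil.
rewrite big_cons -IH -cintD//; last exact: continuous_sum.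
by congr cint; apply/funext => x; rewrite big_cons.
Qed.

Lemma continuous_shift f s : continuous f -> continuous (fun t => f (t + s)).
Proof.
move=> cf x; apply: (@continuous_cvg _ _ _ _ _ (fun t => t + s) f); first exact: cf.
by apply: cvgD; [exact: cvg_id|exact: cvg_cst].
Qed.

Lemma Rint_shift f (a b s : R) : a <= b -> continuous f ->
  (\int[mu]_(t in `[a + s, b + s]) f t)%R = (\int[mu]_(t in `[a, b]) f (t + s)%R)%R.
Proof.
move=> ab cf; rewrite /Rintegral; congr fine.
have D : derive1 (fun t : R => t + s) = cst 1.
  apply/funext => x; rewrite derive1E deriveD//= derive_id derive_cst addr0//.
rewrite (@integration_by_substitution_increasing _ (fun t => t + s) f a b ab).
- by apply: eq_integral => x _ /=; rewrite D mulr1.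
- by move=> x y _ _ xy; rewrite ltrD2r.
- by rewrite D => x _; exact: cst_continuous.
- by rewrite D; exact: is_cvg_cst.
- by rewrite D; exact: is_cvg_cst.
- have cs : continuous (fun t : R => t + s).
    by move=> x; apply: cvgD; [exact: cvg_id|exact: cvg_cst].
  split; first by move=> x _.
    by apply: cvg_at_right_filter; exact: cs.
  by apply: cvg_at_left_filter; exact: cs.
- exact: continuous_subspaceT.
Qed.

Lemma Rint_split f (a b c : R) : a <= b -> b <= c -> continuous f ->
  (\int[mu]_(t in `[a, c]) f t = \int[mu]_(t in `[a, b]) f t + \int[mu]_(t in `[b, c]) f t)%R.
Proof.
move=> ab bc cf.
have := @Rintegral_itvB R f (BLeft a) (BRight c) b (cont_integrable a c cf).
rewrite !bnd_simp => /(_ ab bc) h.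
rewrite -[X in _ + X]Rintegral_itv_obnd_cbnd -?h; first by rewrite subrKC.
apply: integrableS (cont_integrable b c cf) => //.
exact: subset_itv_oc_cc.
Qed.

(** The translated interval [s, s+1] is cut at 1, and periodicity moves the piece beyond 1 back to
    [0, s]. *)
Lemma cint_shift f s : 0 <= s <= 1 -> continuous f -> (forall t, f (t + 1) = f t) ->
  cint (fun t => f (t + s)) = cint f.
Proof.
move=> /andP[s0 s1] cf per; rewrite /cint -(@Rint_shift f 0 1 s)// add0r.
have -> : (1 + s) = s + 1 by rewrite addrC.
rewrite (@Rint_split f s 1 (s + 1))//; last by rewrite lerDr.
rewrite (@Rint_split f 0 s 1)// addrC; congr (_ + _).
rewrite -{1}(add0r 1) (@Rint_shift f 0 s 1)//.
by apply: eq_Rintegral => t _; rewrite per.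
Qed.

(** This passes between integrals and sums over roots of unity: a bound on the sampled sums that is
    uniform in t becomes one on the integral, and some t does no worse than the mean. *)
Lemma cint_roots f N : (0 < N)%N -> continuous f -> (forall t, f (t + 1) = f t) ->
  cint (fun t => \sum_(j < N) f (t + j%:R / N%:R)) = N%:R * cint f.
Proof.
move=> N0 cf per; rewrite cint_sum; last by move=> j; exact: continuous_shift.
rewrite (eq_bigr (fun=> cint f)) ?big_const_ord ?iter_addr_0 ?mulr_natl// => j _.
apply: cint_shift => //.
by rewrite divr_ge0//= ler_pdivrMr ?ltr0n// mul1r ler_nat ltnW.
Qed.

End CircleIntegral.

(** * Atomic measures are contractive multipliers *)

Section Psemi.
Variables (R : realType) (p : R).
Hypotheses (p0 : 0 < p) (p1 : p < 1).

Section Def.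
Variables (K : choiceType) (s : seq K).
Implicit Types (c d : K -> R[i]) (Q : (K -> R[i]) -> R).

(** The common features of c |-> |sum c_k x_k|^p and c |-> tr |sum c_k X_k|^p for a fixed test
    element supported by s, with the multiplier c as variable. The last clause is continuity at 0 in
    the coordinates of s. *)
Definition psemi Q := [/\ forall c, 0 <= Q c,
  forall c d, Q (fun k => c k + d k) <= Q c + Q d,
  forall (z : R[i]) c, Q (fun k => z * c k) <= cabs z `^ p * Q c &
  exists2 B : R, 0 <= B & forall c (e : R), 0 <= e -> (forall k, k \in s -> cabs (c k) <= e) ->
    Q c <= e `^ p * B].

Lemma psemi0 Q : psemi Q -> Q (fun=> 0) = 0.
Proof.
move=> [Q0 _ Qz _]; apply/eqP; rewrite eq_le Q0 andbT.
have := Qz 0 (fun=> 0); by rewrite cabs0 powR0 ?gt_eqF// !mul0r.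
Qed.

Lemma psemi_sum Q (T : Type) (r : seq T) (F : T -> K -> R[i]) : psemi Q ->
  Q (fun k => \sum_(t <- r) F t k) <= \sum_(t <- r) Q (F t).
Proof.
move=> hQ; have [_ Qd _ _] := hQ; elim: r => [|t r IH].
  by rewrite big_nil -(psemi0 hQ); under [X in Q X]eq_fun do rewrite big_nil.
rewrite big_cons; under [X in Q X]eq_fun do rewrite big_cons.
by rewrite (le_trans (Qd _ _))// lerD2l.
Qed.

Lemma psemi_dist Q c d : psemi Q -> `|Q c - Q d| <= Q (fun k => c k - d k).
Proof.
move=> [_ Qd Qz _].
have h x y : Q x <= Q y + Q (fun k => x k - y k).
  have := Qd y (fun k => x k - y k).
  by rewrite (_ : (fun k => _) = x)//; apply/funext => k; rewrite subrKC.
have n : Q (fun k => d k - c k) <= Q (fun k => c k - d k).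
  have := Qz (-1) (fun k => c k - d k); rewrite cabsN cabs1 powR1 mul1r.
  by under [X in Q X]eq_fun do rewrite mulN1r opprB.
by rewrite ler_norml lerBlDr; have := h c d; have := h d c; lra.
Qed.

Lemma small_pow (B e : R) : 0 <= B -> 0 < e -> exists2 d : R, 0 < d & d `^ p * B <= e.
Proof.
move=> B0 e0; have b0 : 0 < B + 1 by rewrite ltr_wpDl.
have eb : 0 < e / (B + 1) by rewrite divr_gt0.
exists ((e / (B + 1)) `^ p^-1); first exact: powR_gt0.
rewrite -powRrM mulVf ?gt_eqF// powRr1 ?(ltW eb)// mulrAC ler_pdivrMr//.
by rewrite ler_wpM2l ?(ltW e0)// lerDl.
Qed.

(* A p-seminorm of an absolutely convergent combination of unimodular
   characters: finite partial sums are controlled by p-subadditivity, the tail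
   by continuity. *)
Lemma psemi_atomic Q (G : choiceType) (chi : G -> K -> R[i]) (a : G -> R[i]) (T q : R) :
  psemi Q -> 0 <= q -> (forall g k, cabs (chi g k) <= 1) -> (forall g, Q (chi g) <= q) ->
  (nsum (fun g => cabs (a g) `^ p)%R <= T%:E)%E ->
  Q (fun k => csum (fun g => a g * chi g k)) <= T * q.
Proof.
move=> hQ q0 chi1 Qq aT; have [Q0 Qd Qz [B B0 QB]] := hQ.
have as_ : asum a.
  apply: (nsum_of_pow p0 p1) => [g|]; first exact: cabs_ge0.
  by rewrite (le_lt_trans aT)// ltry.
have ac k : asum (fun g => a g * chi g k).
  by apply: (@asum_le _ _ _ (fun g => cabs (a g))) => // g; rewrite cabsM ler_piMr ?cabs_ge0.
apply/ler_addgt0Pr => e e0; have [d d0 dB] := small_pow B0 e0.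
have [|r ur rd] := @nsum_tail _ _ (fun g => cabs (a g)) d _ as_ d0.
  by move=> g; exact: cabs_ge0.
rewrite (_ : (fun k => _) = fun k => (\sum_(g <- r) a g * chi g k) +
    csum (fun g => if g \in r then 0 else a g * chi g k)); last first.
  by apply/funext => k; rewrite (csum_restrict (ac k) ur).
rewrite (le_trans (Qd _ _))// lerD//; last first.
  rewrite (le_trans _ dB)//; apply: QB; first exact: ltW.
  move=> k _; rewrite -lee_fin.
  have tk : asum (fun g => if g \in r then 0 else a g * chi g k).
    apply: (@asum_le _ _ _ (fun g => cabs (a g * chi g k))) => [g|]; last exact: ac.
    by case: ifP => _; rewrite ?cabs0 ?cabs_ge0.
  rewrite (le_trans (cabs_csum tk))// (le_trans _ rd)//; apply: le_nsum => g.
  by case: ifP => _; rewrite ?cabs0// cabsM ler_piMr ?cabs_ge0.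
rewrite (le_trans (psemi_sum _ _ hQ))//.
apply: (@le_trans _ _ (\sum_(g <- r) cabs (a g) `^ p * q)).
  apply: ler_sum => g _; rewrite (le_trans (Qz _ _))// ler_wpM2l ?powR_ge0//.
rewrite -mulr_suml ler_wpM2r// -lee_fin (le_trans _ aT)//.
exact: (nsum_seq_le (fun g => cabs (a g) `^ p) ur).
Qed.

End Def.

Section Fourier.
Variable s : seq int.
Variable Q : (int -> R[i]) -> R.
Hypothesis hQ : psemi s Q.
Implicit Types (c d : int -> R[i]).

Definition modul c (t : R) : int -> R[i] := fun k => c k * cis t ^ k.

Lemma psemi_continuous c : continuous (fun t => Q (modul c t)).
Proof.
have [Q0 Qd Qz [B B0 QB]] := hQ.
apply: eps_continuous => x e e0; have [d d0 dB] := small_pow B0 e0.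
(* Bounds on the coefficients and on the frequencies; the added 1 makes them positive, so that the
   radius u / Kc moves every coordinate of s by at most [d]. *)
pose Cc := \sum_(k <- s) cabs (c k) + 1; pose Kc : R := \sum_(k <- s) `|k%:~R| + 1.
have c0 : 0 < Cc by rewrite ltr_wpDl// sumr_ge0// => k _; exact: cabs_ge0.
have k0 : 0 < Kc by rewrite ltr_wpDl// sumr_ge0.
have [u u0 hu] := @cis_near0 R (d / Cc) (divr_gt0 d0 c0).
exists (u / Kc); first exact: divr_gt0.
move=> y yx; rewrite (le_trans (psemi_dist _ _ hQ))// (le_trans _ dB)//.
apply: QB; first exact: ltW.
have ge_mem (F : int -> R) k : (forall j, 0 <= F j) -> k \in s -> F k <= \sum_(j <- s) F j.
  move=> F0 ks; rewrite (big_rem k)//= lerDl sumr_ge0//.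
move=> k ks; rewrite /modul -mulrBr cabsM !cisX.
rewrite (_ : cis (k%:~R * y) - _ = cis (k%:~R * x) * (cis (k%:~R * (y - x)) - 1)); last first.
  by rewrite mulrBr mulr1 -cisD; congr (cis _ - _); ring.
rewrite cabsM cabs_cis mul1r.
have h1 : cabs (c k) <= Cc.
  by rewrite (le_trans (ge_mem (fun k => cabs (c k)) k _ ks))// ?lerDl// => j; exact: cabs_ge0.
have h2 : cabs (cis (k%:~R * (y - x)) - 1) <= d / Cc.
  apply: hu; rewrite normrM.
  have h3 : `|k%:~R| <= Kc by rewrite (le_trans (ge_mem (fun k => `|k%:~R|) k _ ks))// lerDl.
  rewrite (le_lt_trans (ler_wpM2r (normr_ge0 _) h3))//.
  by rewrite mulrC -ltr_pdivlMr.
by rewrite (le_trans (ler_pM (cabs_ge0 _) (cabs_ge0 _) h1 h2))// mulrC divfK// gt_eqF.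
Qed.

(** For the scalar functional this is the integral of |.|^p of the test polynomial after
    multiplication by c. Averaging creates the rotation invariance that Q itself lacks. *)
Definition circle_avg c : R := cint (fun t => Q (modul c t)).

Lemma psemi_avg : psemi s circle_avg.
Proof.
have [Q0 Qd Qz [B B0 QB]] := hQ; split.
- by move=> c; apply: cint_ge0 => t; exact: Q0.
- move=> c d; rewrite -cintD; do ?exact: psemi_continuous.
  apply: cint_le; [exact: psemi_continuous|apply: continuousDf; exact: psemi_continuous|].
  move=> t; rewrite (le_trans _ (Qd _ _))//.
  by rewrite le_eqVlt; apply/orP; left; apply/eqP; congr Q; apply/funext => k; rewrite /modul mulrDl.
- move=> z c; rewrite -cintZ; last exact: psemi_continuous.
  apply: cint_le; [exact: psemi_continuous|apply: continuousMc; exact: psemi_continuous|].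
  move=> t; rewrite (le_trans _ (Qz _ _))//.
  by rewrite le_eqVlt; apply/orP; left; apply/eqP; congr Q; apply/funext => k; rewrite /modul mulrA.
- exists B => // c e e0 ce; rewrite -[leRHS]cint_cst; apply: cint_le.
  + exact: psemi_continuous.
  + exact: cst_continuous.
  + move=> t; apply: QB => // k ks; rewrite /modul cabsM cabsXz cabs_cis exp1rz mulr1.
    exact: ce.
Qed.

Lemma modul_period c t : modul c (t + 1) = modul c t.
Proof. by rewrite /modul cis_period. Qed.

Lemma circle_avg_rot c (g : R[i]) : cabs g = 1 ->
  circle_avg (fun k => c k * g ^ k) = circle_avg c.
Proof.
move=> /cis_surj[u u01 <-]; rewrite /circle_avg.
rewrite -(@cint_shift _ (fun t => Q (modul c t)) u u01); last 2 first.
- exact: psemi_continuous.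
- by move=> t; rewrite modul_period.
have E t : modul (fun k => c k * cis u ^ k) t = modul c (t + u).
  by apply/funext => k; rewrite /modul cisD expfzMl [cis t ^ k * _]mulrC mulrA.
by under [X in cint X = _]eq_fun do rewrite E.
Qed.

(** By rotation invariance every character has the same average as the multiplier 1, so
    [psemi_atomic] applies to the averaged functional. *)
Lemma fourier_atomic_bound (a : circle R -> R[i]) (T : R) :
  (nsum (fun g : circle R => cabs (a g) `^ p)%R <= T%:E)%E ->
  circle_avg (fourier_atomic a) <= T * circle_avg (fun=> 1).
Proof.
move=> aT; have cg (g : circle R) : cabs (\val g) = 1.
  by apply: complexI; rewrite cabsE; exact/eqP/(valP g).
have [Q0 _ _ _] := hQ.
apply: (psemi_atomic (chi := fun (g : circle R) k => sval g ^ (- k)) psemi_avg _ _ _ aT).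
- by apply: cint_ge0 => t.
- by move=> g k; rewrite cabsXz cg exp1rz.
- move=> g; rewrite -(@circle_avg_rot (fun=> 1) (\val g)^-1); last by rewrite cabsV cg invr1.
  have -> : (fun k => sval g ^ (- k)) = (fun k => 1 * (\val g)^-1 ^ k).
    by apply/funext => k; rewrite mul1r exprz_inv.
  exact: lexx.
Qed.

End Fourier.
End Psemi.

Opaque trpow compact_op.

Lemma infinite_setT_inj (J : Type) (f : nat -> J) : injective f -> infinite_set [set: J].
Proof.
move=> fi fJ; apply: infinite_nat; apply: (@sub_finite_set _ _ (f @^-1` [set: J])) => //.
by apply: finite_preimage => // x y _ _; exact: fi.
Qed.

Lemma infinite_int : infinite_set [set: int].
Proof. by apply: (@infinite_setT_inj _ Posz) => x y []. Qed.

Lemma infinite_nat_int : infinite_set [set: nat * int].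
Proof. by apply: (@infinite_setT_inj _ (fun n => (n, 0))) => x y []. Qed.

Lemma finsupp_seq (K : choiceType) (V : zmodType) (x : K -> V) : finsupp_fun x ->
  exists2 s : seq K, uniq s & forall k, k \notin s -> x k = 0.
Proof.
move=> fx; exists (finmap.enum_fset (fset_set [set k | x k != 0])); first exact: finmap.fset_uniq.
move=> k; apply: contraNeq => xk.
by have := in_fset_set fx k; rewrite [RHS]mem_set.
Qed.

Lemma trigpolyE (R : realType) (s : seq int) (x : int -> R[i]) z : uniq s ->
  (forall k, k \notin s -> x k = 0) -> trigpoly x z = \sum_(k <- s) x k * z ^ k.
Proof.
move=> us xs; rewrite /trigpoly (fsbigE s)//.
  by apply: eq_bigl => k; rewrite in_setT.
by move=> k _ /xs ->; rewrite mul0r.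
Qed.

Lemma le_Fnorm (R : realType) (p : R) (x y : \bar R) : 0 < p ->
  (0 <= x)%E -> (x <= y)%E -> (Fnorm p x <= Fnorm p y)%E.
Proof.
move=> p0 x0 xy; apply: gt0_ler_poweR => //; rewrite ?in_itv/= ?x0 ?(le_trans x0 xy) ?leey//.
by rewrite invr_ge0 addr_ge0// ltW.
Qed.

Lemma Fnorm_le (R : realType) (p x y : R) : 0 < p -> 0 <= x -> 0 <= y -> (Fnorm p x%:E <= Fnorm p y%:E)%E -> x <= y.
Proof.
move=> p0 x0 y0; rewrite /Fnorm !poweR_EFin lee_fin; apply: contraTT; rewrite -!ltNge => yx.
by apply: gt0_ltr_powR; rewrite ?nnegrE// invr_gt0 addr_gt0.
Qed.

(** * Finite combinations of Schatten class operators *)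

Section OpComb.
Variables (R : realType) (I : countType).
Hypothesis infI : infinite_set [set: I].
Variables (p : R) (p0 : 0 < p) (p1 : p < 1).

Lemma schatten_trpow (a : opmat R I) : schatten p a -> trpow p a = (fine (trpow p a))%:E.
Proof.
by move=> [ca fa]; rewrite fineK// ge0_fin_numE//; exact: trpow_ge0.
Qed.

Lemma fine_trpow_le (a b : opmat R I) : schatten p a -> schatten p b ->
  (trpow p a <= trpow p b)%E -> fine (trpow p a) <= fine (trpow p b).
Proof. by move=> sa sb; rewrite {1}(schatten_trpow sa) {1}(schatten_trpow sb). Qed.

Lemma schattenZ (c : R[i]) (a : opmat R I) : schatten p a -> schatten p (fun i j => c * a i j).
Proof.
move=> ha; have [ca fa] := ha; split; first exact: compact_opZ.
by apply: (le_lt_trans (trpowZ infI p0 p1 c ca)); rewrite schatten_trpow// -EFinM ltry.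
Qed.

Lemma schattenD (a b : opmat R I) : schatten p a -> schatten p b ->
  schatten p (fun i j => a i j + b i j).
Proof.
move=> [ca fa] [cb fb]; split; first exact: compact_opD.
by apply: (le_lt_trans (trpowD infI p0 p1 ca cb)); apply: lte_add_pinfty; [exact: fa|exact: fb].
Qed.

Lemma trpow0 : trpow p (fun _ _ : I => 0 : R[i]) = 0%E.
Proof.
apply/eqP; rewrite eq_le trpow_ge0//; last exact: compact_op0.
rewrite andbT; have := trpowZ infI p0 p1 0 (compact_op0 R I).
rewrite cabs0 powR0 ?gt_eqF// mul0e; apply: le_trans.
by rewrite le_eqVlt; apply/orP; left; apply/eqP; congr (trpow p _); apply/funext => i; apply/funext => j; rewrite mul0r.
Qed.

Lemma schatten0 : schatten p (fun _ _ : I => 0 : R[i]).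
Proof. by split; [exact: compact_op0|rewrite trpow0 ltry]. Qed.

Variables (K : choiceType) (s : seq K) (X : K -> opmat R I).
Hypothesis sX : forall k, schatten p (X k).

Definition opcomb (c : K -> R[i]) : opmat R I := fun i j => \sum_(k <- s) c k * X k i j.

Lemma schatten_opcomb c : schatten p (opcomb c).
Proof.
rewrite /opcomb; elim: s => [|k r IH].
  rewrite (_ : (fun i j => _) = fun _ _ => 0); first exact: schatten0.
  by apply/funext => i; apply/funext => j; rewrite big_nil.
rewrite (_ : (fun i j => _) = fun i j => c k * X k i j + \sum_(k <- r) c k * X k i j).
  exact: schattenD (schattenZ (c k) (sX k)) IH.
by apply/funext => i; apply/funext => j; rewrite big_cons.
Qed.

Lemma trpow_sum_le (r : seq K) (Y : K -> opmat R I) : (forall k, schatten p (Y k)) ->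
  (trpow p (fun i j => \sum_(k <- r) Y k i j)%R <= (\sum_(k <- r) fine (trpow p (Y k)))%:E)%E.
Proof.
move=> sY.
suff: schatten p (fun i j => \sum_(k <- r) Y k i j) /\
  (trpow p (fun i j => \sum_(k <- r) Y k i j)%R <= (\sum_(k <- r) fine (trpow p (Y k)))%:E)%E by case.
elim: r => [|k r [IH1 IH2]].
  rewrite (_ : (fun i j => _) = fun _ _ => 0); last first.
    by apply/funext => i; apply/funext => j; rewrite big_nil.
  by split; [exact: schatten0|rewrite trpow0 big_nil].
rewrite (_ : (fun i j => _) = fun i j => Y k i j + \sum_(k <- r) Y k i j); last first.
  by apply/funext => i; apply/funext => j; rewrite big_cons.
split; first exact: (schattenD (sY k) IH1).
apply: (le_trans (trpowD infI p0 p1 (sY k).1 IH1.1)).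
by rewrite big_cons EFinD -(schatten_trpow (sY k)) leeD2l.
Qed.

Lemma psemi_opcomb : psemi p s (fun c => fine (trpow p (opcomb c))).
Proof.
have sc := schatten_opcomb.
split.
- by move=> c; rewrite fine_ge0// trpow_ge0//; exact: (sc c).1.
- move=> c d; have := trpowD infI p0 p1 (sc c).1 (sc d).1.
  have <- : opcomb (fun k => c k + d k) = fun i j => opcomb c i j + opcomb d i j.
    by apply/funext => i; apply/funext => j; rewrite /opcomb -big_split; apply: eq_bigr => k _; rewrite mulrDl.
  rewrite (schatten_trpow (sc c)) (schatten_trpow (sc d)) (schatten_trpow (sc (fun k => c k + d k))).
  by rewrite -EFinD lee_fin.
- move=> z c; have := trpowZ infI p0 p1 z (sc c).1.
  have <- : opcomb (fun k => z * c k) = fun i j => z * opcomb c i j.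
    by apply/funext => i; apply/funext => j; rewrite /opcomb mulr_sumr; apply: eq_bigr => k _; rewrite mulrA.
  rewrite (schatten_trpow (sc c)) (schatten_trpow (sc (fun k => z * c k))).
  by rewrite -EFinM lee_fin.
- exists (\sum_(k <- s) fine (trpow p (X k))).
    by apply: sumr_ge0 => k _; rewrite fine_ge0// trpow_ge0//; exact: (sX k).1.
  move=> c e e0 ce; rewrite -lee_fin -(schatten_trpow (sc _)).
  apply: (le_trans (trpow_sum_le s (Y := fun k i j => c k * X k i j) _)) => [k|].
    exact: schattenZ.
  rewrite lee_fin mulr_sumr big_seq [leRHS]big_seq; apply: ler_sum => k ks.
  have t0 : 0 <= fine (trpow p (X k)) by rewrite fine_ge0// trpow_ge0//; exact: (sX k).1.
  apply: (@le_trans _ _ (cabs (c k) `^ p * fine (trpow p (X k)))).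
    have := trpowZ infI p0 p1 (c k) (sX k).1.
    rewrite (schatten_trpow (sX k)) (schatten_trpow (schattenZ (c k) (sX k))).
    by rewrite -EFinM lee_fin.
  by rewrite ler_wpM2r// ge0_ler_powR ?nnegrE ?cabs_ge0 ?(ltW p0)// ce.
Qed.

End OpComb.

Lemma psemi_scalcomb (R : realType) (p : R) (s : seq int) (x : int -> R[i]) : 0 < p -> p < 1 ->
  psemi p s (fun c => cabs (\sum_(k <- s) c k * x k) `^ p).
Proof.
move=> p0 p1; split.
- by move=> c; exact: powR_ge0.
- move=> c d; rewrite (eq_bigr (fun k => c k * x k + d k * x k)); last by move=> k _; rewrite mulrDl.
  rewrite big_split/= (le_trans _ (powRD_le _ _ _ _))// ?(ltW p0) ?(ltW p1) ?cabs_ge0//.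
  by rewrite ge0_ler_powR ?nnegrE ?addr_ge0 ?cabs_ge0 ?cabsD// ltW.
- move=> z c; rewrite (eq_bigr (fun k => z * (c k * x k))); last by move=> k _; rewrite mulrA.
  by rewrite -mulr_sumr cabsM powRM ?cabs_ge0.
- exists ((\sum_(k <- s) cabs (x k)) `^ p); first exact: powR_ge0.
  have xs0 : 0 <= \sum_(k <- s) cabs (x k) by apply: sumr_ge0 => k _; exact: cabs_ge0.
  move=> c e e0 ce; rewrite -powRM//.
  rewrite ge0_ler_powR ?nnegrE ?cabs_ge0 ?mulr_ge0 ?(ltW p0)//.
  rewrite (le_trans (cabs_sum _ _ _))// mulr_sumr big_seq [leRHS]big_seq.
  by apply: ler_sum => k ks; rewrite cabsM ler_wpM2r ?cabs_ge0// ce.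
Qed.

Lemma schatten_munit (R : realType) (I : countType) (p : R) (i0 j0 : I) :
  infinite_set [set: I] -> 0 < p -> p < 1 ->
  schatten p (munit R i0 j0) /\ (trpow p (munit R i0 j0) <= 1)%E.
Proof.
move=> infI p0 p1; have cm := compact_munit R i0 j0.
have d1 (j : I) : (sqnorm (dvec R j) <= 1%:E)%E.
  by rewrite sqnorm_fin ?nrm2_dvec ?lee_fin//; exact: l2_dvec.
suff le1 : (trpow p (munit R i0 j0) <= 1)%E by do 2 split => //; rewrite (le_lt_trans le1)// ltry.
apply: (le_trans (trpow_le_atoms infI p0 p1 cm (c := fun _ : unit => 1)
   (xi := fun=> dvec R i0) (eta := fun=> dvec R j0) _)).
  split => // i j; rewrite (@csum_supp _ _ _ [:: tt])//.
  by rewrite big_seq1 mul1r /munit /dvec rmorph_nat -natrM mulnb.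
rewrite (@nsum_supp _ _ _ [:: tt])//.
  by rewrite big_seq1 cabs1 powR1.
by move=> ?; exact: powR_ge0.
Qed.

(** A rank one decomposition of the block, with its vectors extended by 0, decomposes the embedded
    operator at the same cost. *)
Lemma schatten_emb (R : realType) (I J : countType) (p : R) (f g : J -> I)
    (f' g' : I -> option J) (a : opmat R J) :
  infinite_set [set: I] -> infinite_set [set: J] -> 0 < p -> p < 1 ->
  pcancel f f' -> pcancel g g' -> ocancel f' f -> ocancel g' g ->
  schatten p a -> schatten p (emb f' g' a).
Proof.
move=> infI infJ p0 p1 fK gK fK' gK' sa; have [ca ta] := sa.
have ce : compact_op (emb f' g' a) by exact: (compact_emb fK gK fK' gK').
split; first exact: ce.
have [s [xi [eta [s0 e [xi1 eta1 rep]]]]] := trpow_atoms infJ p0 ca.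
rewrite e in ta.
pose ext (h : I -> option J) (v : J -> R[i]) i := if h i is Some n then v n else 0.
have ext1 (h : J -> I) (h' : I -> option J) v : pcancel h h' -> ocancel h' h ->
    (sqnorm v <= 1%:E)%E -> (sqnorm (ext h' v) <= 1%:E)%E.
  move=> hK hK'; rewrite !sqnormE (nsum_range (pcan_inj hK)).
    by under [X in _ -> (nsum X <= _)%E]eq_fun do rewrite /ext hK.
  move=> i ni; rewrite /ext; case E : (h' i) => [j|]; last by rewrite cabs0 expr0n.
  by have := hK' i; rewrite E /= => eq; have := ni j; rewrite eq eqxx.
apply: (le_lt_trans (trpow_le_atoms infI p0 p1 ce (c := fun k => (s k)%:C)
   (xi := fun k => ext f' (xi k)) (eta := fun k => ext g' (eta k)) _)).
  split => [k|k|i j]; [exact: (ext1 f)|exact: (ext1 g)|].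
  rewrite /emb /ext; case: (f' i) => [n|]; last first.
    by rewrite -[LHS](csum0 R J); apply: eq_csum => k; rewrite mul0r mulr0.
  case: (g' j) => [m|]; first exact: rep.
  by rewrite -[LHS](csum0 R J); apply: eq_csum => k; rewrite conjc0 !mulr0.
by apply: le_lt_trans ta; apply: le_nsum => k; rewrite cabs_real ger0_norm.
Qed.

(** * From atomic measures to the four contractivity statements *)

Section AtomicImplies.
Variables (R : realType) (p : R) (p0 : 0 < p) (p1 : p < 1) (phi : int -> R[i]).

Lemma haar_int_avg (s : seq int) Q (F : R[i] -> \bar R) c : psemi p s Q ->
  (forall t, F (cis t) = (Q (modul c t))%:E) -> haar_int F = (circle_avg Q c)%:E.
Proof.
move=> hQ FQ; rewrite /haar_int.
under eq_integral => t _ do rewrite -[F _]/(F (cis t)) FQ.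
by rewrite cint_fin//; exact: (psemi_continuous p0 hQ).
Qed.

Lemma le_Fnorm_avg (s : seq int) Q (F G : R[i] -> \bar R) c d : psemi p s Q ->
  (forall t, F (cis t) = (Q (modul c t))%:E) ->
  (forall t, G (cis t) = (Q (modul d t))%:E) ->
  circle_avg Q c <= circle_avg Q d -> (Fnorm p (haar_int F) <= Fnorm p (haar_int G))%E.
Proof.
move=> hQ hF hG cd; rewrite (haar_int_avg hQ hF) (haar_int_avg hQ hG).
have [Q0 _ _ _] := psemi_avg p0 hQ.
by apply: (le_Fnorm p0); rewrite lee_fin.
Qed.

(** For a fixed test polynomial, contractivity compares the multiplier [psi] with the multiplier 1
    under one averaged functional. *)
Lemma Lp_norm_le_avg (psi : int -> R[i]) (s : seq int) (x : int -> R[i]) :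
  uniq s -> (forall k, k \notin s -> x k = 0) ->
  (Lp_norm p (fun k => psi k * x k)%R <= Lp_norm p x)%E =
  (circle_avg (fun c => cabs (\sum_(k <- s) c k * x k) `^ p) psi <=
   circle_avg (fun c => cabs (\sum_(k <- s) c k * x k) `^ p) (fun=> 1)).
Proof.
move=> us xs; have hQ := psemi_scalcomb s x p0 p1.
have [Q0 _ _ _] := psemi_avg p0 hQ.
have E c y : (forall k, y k = c k * x k) -> Lp_norm p y =
    Fnorm p (circle_avg (fun c => cabs (\sum_(k <- s) c k * x k) `^ p) c)%:E.
  move=> yE; congr (Fnorm p _); apply: (haar_int_avg hQ) => t.
  rewrite (trigpolyE _ us) => [|k /xs xk]; last by rewrite yE xk mulr0.
  by congr ((cabs _ `^ p)%:E); apply: eq_bigr => k _; rewrite yE /modul mulrAC.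
rewrite (E psi)// (E (fun=> 1)) => [|k]; last by rewrite mul1r.
apply/idP/idP => [h|h]; first exact: (Fnorm_le p0 (Q0 _) (Q0 _) h).
by apply: (le_Fnorm p0); rewrite lee_fin; [exact: Q0|exact: h].
Qed.

Lemma atomic_Lp : atomic_fourier_transform p phi -> fourier_contractive_Lp p phi.
Proof.
move=> [a [a1 /funext ->]] x /finsupp_seq[s us xs]; rewrite (Lp_norm_le_avg _ us xs).
have := fourier_atomic_bound p0 p1 (psemi_scalcomb s x p0 p1) a1; rewrite mul1r; exact.
Qed.

Lemma atomic_LpSp : atomic_fourier_transform p phi -> fourier_contractive_LpSp p phi.
Proof.
move=> [a [a1 /funext ->]] x /finsupp_seq[s us xs] sx.
have hQ := psemi_opcomb infinite_nat p0 p1 s sx.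
have sc := schatten_opcomb infinite_nat p0 p1 s sx.
have xs' k : k \notin s -> forall i j, x k i j = 0 by move=> /xs ->.
apply: (le_Fnorm_avg (c := fourier_atomic a) (d := fun=> 1) hQ).
- move=> t; rewrite -(schatten_trpow infinite_nat p0 (sc _)).
  congr (trpow p _); apply/funext => i; apply/funext => j; rewrite /trigpoly_op.
  rewrite (trigpolyE _ us); last by move=> k /xs' ->; rewrite mulr0.
  apply: eq_bigr => k _; rewrite /modul; ring.
- move=> t; rewrite -(schatten_trpow infinite_nat p0 (sc _)).
  congr (trpow p _); apply/funext => i; apply/funext => j; rewrite /trigpoly_op.
  rewrite (trigpolyE _ us); last by move=> k /xs' ->.
  apply: eq_bigr => k _; rewrite /modul; ring.
- have := fourier_atomic_bound p0 p1 hQ a1; rewrite mul1r; exact.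
Qed.

(* Unimodular characters act on Schur blocks by conjugation with diagonal
   unitaries, so they are isometric. *)
Lemma atomic_schur (I : countType) (rho : I -> int) (s : seq (int * int))
    (X : int * int -> opmat R I) :
  infinite_set [set: I] -> (forall rc, schatten p (X rc)) ->
  (forall rc i j, rc != (rho i, rho j) -> X rc i j = 0) ->
  atomic_fourier_transform p phi ->
  (trpow p (opcomb s X (fun rc => phi (rc.1 - rc.2)))%R <= trpow p (opcomb s X (fun=> 1))%R)%E.
Proof.
move=> infI sX rX [a [a1 /funext ->]].
have hQ := psemi_opcomb infI p0 p1 s sX.
have sc := schatten_opcomb infI p0 p1 s sX.
have cg (g : circle R) : cabs (\val g) = 1.
  by apply: complexI; rewrite cabsE; exact/eqP/(valP g).
rewrite (schatten_trpow infI p0 (sc _)) [leRHS](schatten_trpow infI p0 (sc _)) lee_fin.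
rewrite -[leRHS]mul1r.
apply: (psemi_atomic p0 p1 (chi := fun (g : circle R) (rc : int * int) => sval g ^ (- (rc.1 - rc.2))) hQ _ _ _ a1).
- by have [Q0 _ _ _] := hQ.
- by move=> g k; rewrite cabsXz cg exp1rz.
- move=> g; apply: (fine_trpow_le infI p0 (sc _) (sc _)).
  have g0 : sval g != 0 by rewrite -cabs_eq0 cg oner_eq0.
  have E : opcomb s X (fun rc => sval g ^ (- (rc.1 - rc.2))) =
      fun i j => (sval g ^ (- rho i) * opcomb s X (fun=> 1) i j) * sval g ^ (rho j).
    apply/funext => i; apply/funext => j; rewrite /opcomb mulr_sumr mulr_suml.
    apply: eq_bigr => rc _; have [->|/rX ->] := eqVneq rc (rho i, rho j); last by rewrite !(mulr0, mul0r).
    by rewrite /= opprB addrC expfzDr// mul1r mulrAC.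
  have := (sc (fun rc => sval g ^ (- (rc.1 - rc.2)))).1; rewrite E => cE.
  apply: trpow_twist => //; [| |exact: (sc _).1].
  + by move=> i; rewrite cabsXz cg exp1rz.
  + by move=> i; rewrite cabsXz cg exp1rz.
Qed.

Lemma atomic_Sp : atomic_fourier_transform p phi ->
  schur_contractive_Sp p (fun r c => phi (r - c)).
Proof.
move=> aphi x /finsupp_seq[s us xs].
pose X (rc : int * int) : opmat R int := fun i j => x rc.1 rc.2 * munit R rc.1 rc.2 i j.
have sX rc : schatten p (X rc).
  by apply: (schattenZ infinite_int p0 p1); exact: (schatten_munit _ _ infinite_int p0 p1).1.
have rX (rc : int * int) i j : rc != (i, j) -> X rc i j = 0.
  case: rc => r c; rewrite xpair_eqE /X /munit /= [i == r]eq_sym [j == c]eq_sym => /negPf ->.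
  by rewrite mulr0.
have E c : opcomb s X c = fun i j => c (i, j) * x i j.
  apply/funext => i; apply/funext => j; rewrite /opcomb.
  have [ijs|ijs] := boolP ((i, j) \in s); last first.
    rewrite (xs (i, j) ijs) mulr0 big_seq big1// => rc rcs; rewrite rX ?mulr0//.
    by apply: contraNneq ijs => <-.
  rewrite (bigD1_seq (i, j))//= big1 ?addr0 => [|rc rcij]; last by rewrite rX ?mulr0.
  by rewrite /X /munit /= !eqxx mulr1.
have := atomic_schur (rho := id) s infinite_int sX rX aphi.
have sc := schatten_opcomb infinite_int p0 p1 s sX.
move: (sc (fun rc => phi (rc.1 - rc.2))); rewrite !E /=.
rewrite (_ : (fun i j => 1 * x i j) = x); last first.
  by apply/funext => i; apply/funext => j; rewrite mul1r.
by move=> sx; apply: (le_Fnorm p0); apply: (trpow_ge0 infinite_int p0 sx.1).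
Qed.

Lemma atomic_SpSp : atomic_fourier_transform p phi ->
  schur_contractive_SpSp p (fun r c => phi (r - c)).
Proof.
move=> aphi x /finsupp_seq[s us xs] sx.
(* [col r] is the r-th copy of l^2 in the tensor product; the block matrix is the sum of its blocks
   embedded along these copies. *)
pose col (r : int) (n : nat) := (n, r).
pose col' (r : int) (i : nat * int) := if i.2 == r then Some i.1 else None.
have colK r : pcancel (col r) (col' r) by move=> n; rewrite /col' eqxx.
have colK' r : ocancel (col' r) (col r).
  by case=> n k; rewrite /col' /=; case: eqP => //= ->.
pose X (rc : int * int) := emb (col' rc.1) (col' rc.2) (x rc.1 rc.2).
have sX rc : schatten p (X rc).
  by apply: (schatten_emb infinite_nat_int infinite_nat p0 p1 (colK _) (colK _)).
have rX (rc : int * int) (i j : nat * int) : rc != (i.2, j.2) -> X rc i j = 0.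
  case: rc => r c; rewrite xpair_eqE /X /emb /col' /= [i.2 == r]eq_sym [j.2 == c]eq_sym.
  by case: eqP => //= _ /negPf ->.
have E c : opcomb s X c = block_op (fun r k i j => c (r, k) * x r k i j).
  apply/funext => -[n i]; apply/funext => -[m j]; rewrite /opcomb /block_op /=.
  have [ijs|ijs] := boolP ((i, j) \in s); last first.
    rewrite (xs (i, j) ijs) mulr0 big_seq big1// => rc rcs; rewrite rX ?mulr0//.
    by apply: contraNneq ijs => <-.
  rewrite (bigD1_seq (i, j))//= big1 ?addr0 => [|rc rcij]; last by rewrite rX ?mulr0.
  by rewrite /X /emb /col' /= !eqxx.
have := atomic_schur (rho := snd) s infinite_nat_int sX rX aphi.
have sc := schatten_opcomb infinite_nat_int p0 p1 s sX.
move: (sc (fun rc => phi (rc.1 - rc.2))); rewrite !E /=.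
rewrite (_ : (fun r k i j => 1 * x r k i j) = x); last first.
  by do 4 apply/funext => ?; rewrite mul1r.
by move=> sy; apply: (le_Fnorm p0); apply: (trpow_ge0 infinite_nat_int p0 sy.1).
Qed.

End AtomicImplies.

(** * From matrices to trigonometric polynomials *)

Lemma dvdz_small (N : nat) (x : int) : (N %| x)%Z -> (`|x| < N)%N -> x = 0.
Proof.
move=> Nx xN; apply/eqP; rewrite -absz_eq0 -leqn0 leqNgt; apply/negP => x0.
by move: xN; rewrite ltnNge (dvdn_leq x0 Nx).
Qed.

Lemma mul_invNC (R : realType) N : (0 < N)%N -> N%:R^-1%:C * N%:R = 1 :> R[i].
Proof.
move=> N0; have -> : N%:R = N%:R%:C :> R[i] by rewrite rmorph_nat.
by rewrite -realCM mulVf// pnatr_eq0 -lt0n.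
Qed.

(** * Finite Toeplitz sections and circulant matrices *)

Section FinSection.
Variables (R : realType) (p : R) (p0 : 0 < p) (p1 : p < 1).
Variables (I : countType) (infI : infinite_set [set: I]).
(** [iota_] places the indices below L in I, and [rho] sends the remaining elements of I to values
    at least L. This serves both Z and the product of N and Z. *)
Variables (L : nat) (iota_ : nat -> I) (rho : I -> nat).
Hypotheses (rhoK : forall n, (n < L)%N -> rho (iota_ n) = n)
  (iotaK : forall i, (rho i < L)%N -> iota_ (rho i) = i).
Implicit Types (a : nat -> nat -> R[i]) (b : int -> R[i]) (w : nat -> R[i]).

Definition finop a : opmat R I := fun i j =>
  if (rho i < L)%N && (rho j < L)%N then a (rho i) (rho j) else 0.

Definition finvec w : I -> R[i] := fun i => if (rho i < L)%N then w (rho i) else 0.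

Lemma csum_finvec w : csum (finvec w) = \sum_(n < L) w n.
Proof.
have us : uniq [seq iota_ n | n <- iota 0 L].
  rewrite map_inj_in_uniq ?iota_uniq// => m n.
  by rewrite !mem_iota !add0n /= => mL nL e; rewrite -(rhoK mL) e rhoK.
rewrite (csum_supp us); last first.
  move=> i; rewrite /finvec; case: ifP => // iL /negP[].
  by rewrite -(iotaK iL) map_f// mem_iota.
rewrite big_map (_ : iota 0 L = index_iota 0 L) ?big_mkord; last by rewrite /index_iota subn0.
apply: eq_bigr => n _.
by rewrite /finvec rhoK// ltn_ord.
Qed.

Lemma nrm2_finvec w : l2 (finvec w) /\ nrm2 (finvec w) = \sum_(n < L) cabs (w n) ^+ 2.
Proof.
have l : l2 (finvec w).
  apply: (@l2_supp _ _ _ (undup [seq iota_ n | n <- iota 0 L])); first exact: undup_uniq.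
  move=> i; rewrite mem_undup /finvec; case: ifP => // iL /negP[].
  by rewrite -(iotaK iL) map_f// mem_iota.
split => //; apply: complexI; rewrite -inner_self// /inner.
rewrite (_ : (fun i => _) = finvec (fun n => (cabs (w n) ^+ 2)%:C)).
  by rewrite csum_finvec realC_sum.
by apply/funext => i; rewrite /finvec mulcJ; case: ifP; rewrite ?cabs0 ?expr0n.
Qed.

Lemma inner_finvec w v : inner (finvec w) (finvec v) = \sum_(n < L) w n * (v n)^*.
Proof.
rewrite -(csum_finvec (fun n => w n * (v n)^*)); apply: eq_csum => i; rewrite /finvec.
by case: ifP; rewrite ?mul0r.
Qed.

Lemma opapp_finop a w : opapp (finop a) (finvec w) = finvec (fun r => \sum_(c < L) a r c * w c).
Proof.
apply/funext => i; rewrite /opapp /finop {2}/finvec; case: ifP => iL; last first.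
  by rewrite -[RHS](csum0 R I); apply: eq_csum => j; rewrite /= mul0r.
rewrite -(csum_finvec (fun c => a (rho i) c * w c)); apply: eq_csum => j; rewrite /finvec.
by case: (rho j < L)%N; rewrite ?mul0r.
Qed.

(** A crude count: at most |S|^2 entries, each a multiple of a matrix unit. It controls a corner
    correction whose size does not grow with L. *)
Lemma schatten_finop a (S : seq nat) (B : R) :
  uniq S -> (forall n, n \in S -> n < L)%N -> 0 <= B ->
  (forall r c, r \in S -> c \in S -> cabs (a r c) <= B) ->
  (forall r c, (r < L)%N -> (c < L)%N -> ~~ ((r \in S) && (c \in S)) -> a r c = 0) ->
  schatten p (finop a) /\ (trpow p (finop a) <= ((size S ^ 2)%:R * B `^ p)%:E)%E.
Proof.
move=> uS SL B0 aB aS; pose s := [seq (r, c) | r <- S, c <- S].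
pose X (rc : nat * nat) := munit R (iota_ rc.1) (iota_ rc.2).
have sX rc : schatten p (X rc) := (schatten_munit _ _ infI p0 p1).1.
have E : finop a = opcomb s X (fun rc => a rc.1 rc.2).
  apply/funext => i; apply/funext => j; rewrite /opcomb /finop.
  have us : uniq s by rewrite allpairs_uniq// => -[? ?] [? ?].
  have ms r c : ((r, c) \in s) = (r \in S) && (c \in S).
    apply/allpairsP/andP => [[[r' c'] /= [? ? [-> ->]]]//|[rS cS]].
    by exists (r, c).
  have X0 rc : rc \in s -> rc != (rho i, rho j) -> X rc i j = 0.
    case: rc => r c; rewrite ms => /andP[/SL rL /SL cL]; rewrite xpair_eqE /X /munit /=.
    apply: contraNeq; rewrite pnatr_eq0 eqb0 negbK => /andP[/eqP -> /eqP ->].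
    by rewrite !rhoK// !eqxx.
  have [ijs|ijs] := boolP ((rho i, rho j) \in s).
    move: (ijs); rewrite ms => /andP[/SL iL /SL jL]; rewrite iL jL/=.
    rewrite (bigD1_seq (rho i, rho j))//= big_seq_cond big1 ?addr0 => [|rc /andP[rcs rcij]].
      by rewrite /X /munit/= !iotaK// !eqxx mulr1.
    by rewrite X0 ?mulr0.
  rewrite big_seq big1 => [|rc rcs]; last first.
    by rewrite X0 ?mulr0//; apply: contraNneq ijs => <-.
  by case: ifP => // /andP[iL jL]; apply: aS => //; rewrite -ms.
rewrite E; split; first exact: schatten_opcomb.
have sY (rc : nat * nat) : schatten p (fun i j => a rc.1 rc.2 * X rc i j) by exact: schattenZ.
apply: (le_trans (trpow_sum_le infI p0 p1 s sY)).
have -> : (size S ^ 2 = size s)%N by rewrite size_allpairs -mulnn.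
rewrite lee_fin -sum1_size natr_sum mulr_suml big_seq [leRHS]big_seq.
apply: ler_sum => _ /allpairsP[rc [rS cS ->]]; rewrite mul1r -surjective_pairing.
have m1 := (schatten_munit (iota_ rc.1) (iota_ rc.2) infI p0 p1).2.
have := trpowZ infI p0 p1 (a rc.1 rc.2) (sX rc).1.
rewrite (schatten_trpow infI p0 (sY rc)) => h; rewrite -lee_fin (le_trans h)//.
rewrite (le_trans (lee_wpmul2l _ m1)) ?mule1 ?lee_fin ?powR_ge0//.
by rewrite ge0_ler_powR ?nnegrE ?cabs_ge0 ?(ltW p0)// aB.
Qed.

Lemma schatten_finop_any a : schatten p (finop a).
Proof.
have ge_term (F : nat -> R) r : (forall n, 0 <= F n) -> (r < L)%N -> F r <= \sum_(n < L) F n.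
  by move=> F0 rL; rewrite (bigD1 (Ordinal rL))//= lerDl sumr_ge0.
have c0 r c : 0 <= cabs (a r c) by exact: cabs_ge0.
have r0 r : 0 <= \sum_(c < L) cabs (a r c) by exact: sumr_ge0.
apply: (@schatten_finop a (iota 0 L) (\sum_(r < L) \sum_(c < L) cabs (a r c)) _ _ _ _ _).1.
- exact: iota_uniq.
- by move=> n; rewrite mem_iota.
- exact: sumr_ge0.
- move=> r c; rewrite !mem_iota !add0n /= => rL cL.
  apply: (le_trans (ge_term (fun c => cabs (a r c)) c (c0 r) cL)).
  exact: (ge_term (fun r => \sum_(c < L) cabs (a r c)) r r0 rL).
- by move=> r c rL cL; rewrite !mem_iota !add0n rL cL.
Qed.

Variables (s : seq int) (d : nat) (b : int -> R[i]).
Hypotheses (us : uniq s) (sd : forall k, k \in s -> (`|k| <= d)%N)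
  (bs : forall k, k \notin s -> b k = 0).

Let F (z : R[i]) := \sum_(k <- s) b k * z ^ k.
Let toepl (r c : nat) : R[i] := b (r%:Z - c%:Z).
(** The normalised discrete Fourier basis. *)
Let w N (j : 'I_N) (r : nat) : R[i] := (Num.sqrt N%:R)^-1%:C * cis (- (r%:R * (j%:R / N%:R))).
(** The circulant with symbol F, given by its spectral decomposition, which is also a rank one
    decomposition. *)
Let circ N (r c : nat) : R[i] := \sum_(j < N) F (cis (j%:R / N%:R)) * (w j r * (w j c)^*).

Let wJ N (j l : 'I_N) r c : (0 < N)%N ->
  w j r * (w l c)^* = N%:R^-1%:C * cis (c%:R * (l%:R / N%:R) - r%:R * (j%:R / N%:R)).
Proof.
move=> N0; rewrite /w conjM cis_conj opprK addrC cisD.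
have -> : (((Num.sqrt N%:R)^-1%:C)^* = (Num.sqrt N%:R)^-1%:C :> R[i]) by rewrite /= oppr0.
have -> : N%:R^-1%:C = (Num.sqrt N%:R)^-1%:C * (Num.sqrt N%:R)^-1%:C :> R[i].
  by rewrite -realCM -invfM -expr2 sqr_sqrtr ?ler0n.
ring.
Qed.

Let circE N r c : (0 < N)%N ->
  circ N r c = \sum_(k <- s) b k * (if (N %| k - r%:Z + c%:Z)%Z then 1 else 0).
Proof.
move=> N0; rewrite /circ.
under eq_bigr => j _ do rewrite wJ// /F mulr_suml.
rewrite exchange_big; apply: eq_bigr => k _ /=.
under eq_bigr => j _ do rewrite mulrACA cisX -cisD.
rewrite -mulr_sumr -mulrA; congr (_ * _).
rewrite (_ : \sum_(j < N) _ = \sum_(j < N) cis ((k - r%:Z + c%:Z)%:~R * (j%:R / N%:R))).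
  rewrite root_sum//; case: ifP; rewrite ?mulr0//.
  by rewrite mul_invNC.
apply: eq_bigr => j _; congr cis; rewrite intrD intrB -!pmulrn; ring.
Qed.

(** For N >= L + d the L by L corner of the circulant of size N shows no wrap-around and is the
    Toeplitz section; its N rank one terms then bound the trace, the truncated Fourier vectors
    having norm at most 1. *)
Lemma trpow_toep_le N : (L + d <= N)%N -> (0 < N)%N ->
  schatten p (finop toepl) ->
  (trpow p (finop toepl) <= (\sum_(j < N) cabs (F (cis (j%:R / N%:R))) `^ p)%:E)%E.
Proof.
move=> LN N0 st.
have NR : 0 < N%:R :> R by rewrite ltr0n.
have w1 j : (sqnorm (finvec (@w N j)) <= 1%:E)%E.
  have [l e] := nrm2_finvec (w j); rewrite sqnorm_fin// e lee_fin.
  rewrite (eq_bigr (fun=> N%:R^-1)) => [|n _]; last first.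
    rewrite /w cabsM cabs_cis mulr1 cabs_real ger0_norm ?invr_ge0 ?sqrtr_ge0//.
    by rewrite exprVn sqr_sqrtr// ltW.
  rewrite sumr_const card_ord -[_ *+ _]mulr_natl ler_pdivrMr// mul1r ler_nat.
  by rewrite (leq_trans _ LN)// leq_addr.
apply: (le_trans (trpow_le_atoms infI p0 p1 st.1 (c := fun j : 'I_N => F (cis (j%:R / N%:R)))
  (xi := fun j => finvec (w j)) (eta := fun j => finvec (w j)) _)).
  split => // i j; rewrite (csum_supp (enum_uniq 'I_N)) => [|k]; last by rewrite mem_enum.
  rewrite big_enum/= /finop /finvec.
  case: (boolP (rho i < L)%N) => iL/=; last by rewrite big1// => k _; rewrite mul0r mulr0.
  case: (boolP (rho j < L)%N) => jL; last by rewrite big1// => k _; rewrite conjc0 !mulr0.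
  rewrite -/(circ N (rho i) (rho j)) circE// /toepl.
  (* The integer k - r + c has modulus at most d + L - 1 < N, so divisibility by N forces it to be
     0. *)
  have P k : k \in s -> (if (N %| k - (rho i)%:Z + (rho j)%:Z)%Z then 1 else 0) =
      (if k == (rho i)%:Z - (rho j)%:Z then 1 else 0) :> R[i].
    move=> /sd kd; congr (if _ then _ else _); apply/idP/eqP => [h|->].
      by have := dvdz_small h; lia.
    by rewrite (_ : _ + _ = 0) ?dvdz0//; lia.
  rewrite big_seq (eq_bigr (fun k => if k == (rho i)%:Z - (rho j)%:Z then b k else 0)) => [|k /P ->]; last first.
    by case: ifP; rewrite ?mulr1 ?mulr0.
  rewrite -big_seq; set m := _ - _; have [ms|ms] := boolP (m \in s).
    by rewrite (bigD1_seq m)//= eqxx big1 ?addr0// => k /negPf ->.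
  rewrite bs// big_seq big1// => k ks; case: eqP => // km.
  by rewrite km (negPf ms) in ks.
rewrite (nsum_supp (enum_uniq 'I_N)) ?big_enum// => [k|k]; first exact: powR_ge0.
by rewrite mem_enum.
Qed.

(** The circulant of size L has the |F| at the roots of unity as singular values and differs from
    the Toeplitz section by a matrix supported by the first and last d indices, with entries of
    modulus at most twice the sum of the |b_k|. *)
Lemma trpow_toep_ge : (2 * d <= L)%N -> (0 < L)%N -> schatten p (finop toepl) ->
  ((\sum_(j < L) cabs (F (cis (j%:R / L%:R))) `^ p)%:E <=
   trpow p (finop toepl) + ((size (iota 0 d ++ iota (L - d) d) ^ 2)%:R *
      ((\sum_(k <- s) cabs (b k)) + (\sum_(k <- s) cabs (b k))) `^ p)%:E)%E.
Proof.
move=> dL L0 st; set S := iota 0 d ++ iota (L - d) d; set B := \sum_(k <- s) cabs (b k).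
have LR : L%:R != 0 :> R by rewrite pnatr_eq0 -lt0n.
have B0 : 0 <= B by apply: sumr_ge0 => k _; exact: cabs_ge0.
have bB k : cabs (b k) <= B.
  have [ks|/bs ->] := boolP (k \in s); last by rewrite cabs0.
  by rewrite /B (big_rem k)//= lerDl sumr_ge0// => m _; exact: cabs_ge0.
have cB r c : cabs (circ L r c) <= B.
  rewrite circE// (le_trans (cabs_sum _ _ _))//; apply: ler_sum => k _; rewrite cabsM.
  by case: ifP => _; rewrite ?cabs1 ?mulr1// cabs0 mulr0 cabs_ge0.
pose D r c := circ L r c - toepl r c.
have uS : uniq S.
  rewrite cat_uniq !iota_uniq/= andbT; apply/hasPn => n; rewrite !mem_iota; lia.
(* Wrap-around requires |r - c| >= L - d, which puts one of r, c among the first d indices and the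
   other among the last d. *)
have [sD tD] : schatten p (finop D) /\ (trpow p (finop D) <= ((size S ^ 2)%:R * (B + B) `^ p)%:E)%E.
  apply: schatten_finop => //.
  - by move=> n; rewrite mem_cat !mem_iota; lia.
  - by rewrite addr_ge0.
  - by move=> r c _ _; rewrite /D (le_trans (cabsD _ _))// cabsN; exact: (lerD (cB r c) (bB _)).
  move=> r c rL cL; rewrite !mem_cat !mem_iota => rcS.
  rewrite /D circE// /toepl; set m := r%:Z - c%:Z.
  have P k : k \in s -> (if (L %| k - r%:Z + c%:Z)%Z then 1 else 0) =
      (if k == m then 1 else 0) :> R[i].
    move=> /sd kd; congr (if _ then _ else _); apply/idP/eqP => [h|->].
      by have := dvdz_small h; rewrite /m; lia.
    by rewrite (_ : _ + _ = 0) ?dvdz0// /m; lia.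
  rewrite big_seq (eq_bigr (fun k => if k == m then b k else 0)) => [|k /P ->]; last first.
    by case: ifP; rewrite ?mulr1 ?mulr0.
  rewrite -big_seq; have [ms|ms] := boolP (m \in s).
    by rewrite (bigD1_seq m)//= eqxx big1 ?addr0 ?subrr// => k /negPf ->.
  rewrite bs// big_seq big1 ?subrr// => k ks; case: eqP => // km.
  by rewrite km (negPf ms) in ks.
have E : finop (circ L) = fun i j => finop toepl i j + finop D i j.
  apply/funext => i; apply/funext => j; rewrite /finop; case: ifP => _; last by rewrite addr0.
  by rewrite /D addrC subrK.
have sC : schatten p (finop (circ L)) by rewrite E; exact: schattenD.
apply: (@le_trans _ _ (trpow p (finop (circ L)))); last first.
  rewrite E (le_trans (trpowD infI p0 p1 st.1 sD.1))//.
  by rewrite leeD2l.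
have ow : orthonormal (fun j : 'I_L => finvec (w j)).
  split => [j|j l]; first by have [] := nrm2_finvec (w j).
  rewrite inner_finvec (eq_bigr (fun n : 'I_L => L%:R^-1%:C * cis ((l%:Z - j%:Z)%:~R * (n%:R / L%:R)))).
    rewrite -mulr_sumr root_sum//; have [->|jl] := eqVneq j l.
      by rewrite subrr dvdz0 mul_invNC.
    rewrite ifF ?mulr0//; apply/negP => h.
    have : j <> l :> nat by move/val_inj => ejl; rewrite ejl eqxx in jl.
    by have := dvdz_small h; have := ltn_ord j; have := ltn_ord l; lia.
  by move=> n _; rewrite wJ//; congr (_ * cis _); rewrite intrB -!pmulrn; ring.
(* The phase of each eigenvalue is moved into the left singular vector, so that the singular values
   are nonnegative. *)
have /fin_all_exists[u hu] : forall j : 'I_L, exists u : R[i], cabs u = 1 /\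
    F (cis (j%:R / L%:R)) = (cabs (F (cis (j%:R / L%:R))))%:C * u.
  move=> j; have [v v1 e] := cabs_Re_unit (F (cis (j%:R / L%:R))).
  have v0 : v != 0 by rewrite -cabs_eq0 v1 oner_eq0.
  by exists v^-1; split; [rewrite cabsV v1 invr1|rewrite -e mulrAC mulfV ?mul1r].
have [xs [xi [eta [xs0 et [xi1 eta1 rep]]]]] := trpow_atoms infI p0 sC.1.
rewrite et (eq_nsum (g := fun k => cabs (xs k)%:C `^ p)) => [|k]; last by rewrite cabs_real ger0_norm.
apply: (rank_one_ineq p0 p1 (e := fun j : 'I_L => finvec (w j))
   (f := fun j i => u j * finvec (w j) i) (a := finop (circ L)) _ ow _ _ xi1 eta1 rep).
- by move=> j; exact: cabs_ge0.
- split => [j|j l]; first by apply: l2Z; exact: ow.1.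
  rewrite innerZl; [|exact: ow.1|apply: l2Z; exact: ow.1].
  rewrite innerZr; [|exact: ow.1|exact: ow.1].
  rewrite ow.2; have [->|_] := eqVneq j l; last by rewrite !mulr0.
  by rewrite mulr1 mulcJ (hu l).1 expr1n.
- move=> j; rewrite opapp_finop; apply/funext => i; rewrite /finvec.
  case: ifP => _; last by rewrite !mulr0.
  rewrite mulrA -(hu j).2.
  have inn (l : 'I_L) : \sum_(c < L) (w l c)^* * w j c = (j == l)%:R.
    by rewrite -(ow.2 j l) inner_finvec; apply: eq_bigr => c _; rewrite mulrC.
  under eq_bigr => c _ do rewrite /circ mulr_suml.
  rewrite exchange_big /=.
  have inn2 (l : 'I_L) : \sum_(c < L) F (cis (l%:R / L%:R)) * (w l (rho i) * (w l c)^*) * w j c =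
      F (cis (l%:R / L%:R)) * w l (rho i) * (j == l)%:R.
    by rewrite -inn mulr_sumr; apply: eq_bigr => c _; rewrite !mulrA.
  rewrite (eq_bigr _ (fun l _ => inn2 l)) (bigD1 j)//= eqxx mulr1 big1 ?addr0// => l.
  by rewrite eq_sym => /negPf ->; rewrite mulr0.
Qed.

End FinSection.

(** * Passing from Toeplitz sections to the circle *)

Section ToeplitzImplies.
Variables (R : realType) (p : R) (p0 : 0 < p) (p1 : p < 1) (phi : int -> R[i]).

Lemma le_of_linear (x y A : R) (n0 : nat) :
  (forall n, (n0 <= n)%N -> n%:R * x <= n%:R * y + A) -> x <= y.
Proof.
move=> h; apply/ler_addgt0Pr => e e0.
pose n := maxn n0 (Num.truncn (A / e)).+1.
have n1 : 0 < n%:R :> R by rewrite ltr0n leq_max orbT.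
have An : A <= n%:R * e.
  rewrite -ler_pdivrMr// (le_trans (ltW (truncnS_gt _)))// ler_nat leq_max leqnn orbT//.
by rewrite -(ler_pM2l n1) mulrDr (le_trans (h n _)) ?leq_maxl// lerD2l.
Qed.

Variables (I : countType) (infI : infinite_set [set: I]).

(** If A and B are the integrals for phi and for 1, averaging [main] over t gives L A <= (L + d) B +
    K with d and K independent of L; dividing by L and letting L grow removes both errors. *)
Lemma toeplitz_Lp (iota_ : nat -> I) (rho : nat -> I -> nat) :
  (forall L n, (n < L)%N -> rho L (iota_ n) = n) ->
  (forall L i, (rho L i < L)%N -> iota_ (rho L i) = i) ->
  (forall L (b : int -> R[i]),
    (trpow p (finop L (rho L) (fun r c => phi (r%:Z - c%:Z) * b (r%:Z - c%:Z))%R) <=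
     trpow p (finop L (rho L) (fun r c => b (r%:Z - c%:Z))%R))%E) ->
  fourier_contractive_Lp p phi.
Proof.
move=> rhoK iotaK H x /finsupp_seq[s us xs]; rewrite (Lp_norm_le_avg p0 p1 _ us xs).
have hQ := psemi_scalcomb s x p0 p1.
set Q := fun c => _ in hQ *.
pose d := \max_(k <- s) `|k|%N.
have sd k : k \in s -> (`|k| <= d)%N.
  by move=> ks; rewrite /d (big_rem k)//= leq_maxl.
have fs L b := schatten_finop_any p0 p1 infI (rhoK L) (iotaK L) (fun r c => b (r%:Z - c%:Z)).
pose K : R := ((d + d) ^ 2)%:R * ((\sum_(k <- s) cabs (phi k * x k)) + (\sum_(k <- s) cabs (phi k * x k))) `^ p.
have main L t : (2 * d <= L)%N -> (0 < L)%N ->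
    \sum_(j < L) Q (modul phi (t + j%:R / L%:R)) <=
    \sum_(j < L + d) Q (modul (fun=> 1) (t + j%:R / (L + d)%:R)) + K.
  move=> dL L0.
  (* Rotating the test polynomial by t translates the sampling points, as needed for the average
     over t. *)
  pose b k := x k * cis t ^ k; pose b' k := phi k * b k.
  have bs k : k \notin s -> b k = 0 by move=> /xs; rewrite /b => ->; rewrite mul0r.
  have bs' k : k \notin s -> b' k = 0 by move=> /bs; rewrite /b' => ->; rewrite mulr0.
  have lo := trpow_toep_ge p0 p1 infI (rhoK L) (iotaK L) us sd bs' dL L0 (fs L b').
  have Ld0 : (0 < L + d)%N by rewrite addn_gt0 L0.
  have up := trpow_toep_le p0 p1 infI (rhoK L) (iotaK L) us sd bs (leqnn _) Ld0 (fs L b).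
  have := le_trans lo (leeD2r _ (le_trans (H L b) up)).
  rewrite -EFinD lee_fin => h.
  have E1 N (j : 'I_N) : cabs (\sum_(k <- s) b' k * cis (j%:R / N%:R) ^ k) `^ p =
      Q (modul phi (t + j%:R / N%:R)).
    congr (cabs _ `^ p); apply: eq_bigr => k _.
    rewrite /modul cisD expfzMl /b' /b.
    by move: (cis t ^ k) (cis (j%:R / N%:R) ^ k) => X Y; ring.
  have E2 N (j : 'I_N) : cabs (\sum_(k <- s) b k * cis (j%:R / N%:R) ^ k) `^ p =
      Q (modul (fun=> 1) (t + j%:R / N%:R)).
    congr (cabs _ `^ p); apply: eq_bigr => k _.
    rewrite /modul cisD expfzMl /b.
    by move: (cis t ^ k) (cis (j%:R / N%:R) ^ k) => X Y; ring.
  move: h; rewrite (eq_bigr _ (fun j _ => E1 L j)) (eq_bigr _ (fun j _ => E2 (L + d)%N j)).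
  have -> : \sum_(k <- s) cabs (b' k) = \sum_(k <- s) cabs (phi k * x k).
    by apply: eq_bigr => k _; rewrite /b' /b !cabsM cabsXz cabs_cis exp1rz mulr1.
  by rewrite size_cat !size_iota.
have cm c := psemi_continuous p0 hQ (c := c).
have cms (c : int -> R[i]) N (j : 'I_N) :=
  @continuous_shift _ (fun t => Q (modul c t)) (j%:R / N%:R) (cm c).
have cs (c : int -> R[i]) N := @continuous_sum _ _ (index_enum 'I_N)
  (fun j t => Q (modul c (t + j%:R / N%:R))) (cms c N).
apply: (@le_of_linear _ _ (d%:R * circle_avg Q (fun=> 1) + K) (maxn 1 (2 * d))) => L.
rewrite geq_max => /andP[L0 dL].
have := @cint_le _ (fun t => \sum_(j < L) Q (modul phi (t + j%:R / L%:R)))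
  (fun t => \sum_(j < L + d) Q (modul (fun=> 1) (t + j%:R / (L + d)%:R)) + K) _ _ (fun t => main L t dL L0).
rewrite cintD; [|by apply: continuous_sum => j; exact: cms|exact: cst_continuous].
rewrite (cint_roots L0 (cm phi)) => [|t]; last by rewrite modul_period.
rewrite (cint_roots _ (cm (fun=> 1))) => [||t]; [|by rewrite addn_gt0 L0|by rewrite modul_period].
rewrite cint_cst [(L + d)%:R * _](_ : _ = L%:R * circle_avg Q (fun=> 1) + d%:R * circle_avg Q (fun=> 1)); last first.
  by rewrite -mulrDl -natrD.
rewrite -addrA; apply; first exact: cs.
apply: (@continuousDf _ (fun t => \sum_(j < L + d) Q (modul (fun=> 1) (t + j%:R / (L + d)%:R)))
  (fun=> K) (cs _ _) _); exact: cst_continuous.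
Qed.

End ToeplitzImplies.

(** * Each contractivity statement implies the one on L^p *)

Section ConverseImplications.
Variables (R : realType) (p : R) (p0 : 0 < p) (p1 : p < 1) (phi : int -> R[i]).

Lemma finsupp_of_seq (K : choiceType) (V : zmodType) (x : K -> V) (s : seq K) :
  (forall k, k \notin s -> x k = 0) -> finsupp_fun x.
Proof.
move=> xs; apply: (@sub_finite_set _ _ [set` s]) => // k /= xk.
by apply: contraNT xk => /xs ->.
Qed.

Lemma Fnorm_trpow_le (I : countType) (x y : opmat R I) : infinite_set [set: I] ->
  schatten p x -> schatten p y -> (Fnorm p (trpow p x) <= Fnorm p (trpow p y))%E ->
  (trpow p x <= trpow p y)%E.
Proof.
move=> infI sx sy; have x0 := trpow_ge0 infI p0 sx.1; have y0 := trpow_ge0 infI p0 sy.1.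
rewrite (schatten_trpow infI p0 sx) (schatten_trpow infI p0 sy) => /(Fnorm_le p0) h.
by rewrite lee_fin; apply: h; apply: fine_ge0; [exact: x0|exact: y0].
Qed.

Lemma schur_Sp_Lp : schur_contractive_Sp p (fun r c => phi (r - c)) ->
  fourier_contractive_Lp p phi.
Proof.
(* Negative integers are sent to L, outside the section. *)
move=> H; pose rho L (i : int) := if (0 <= i)%R then `|i|%N else L.
have rK L n : (n < L)%N -> rho L (Posz n) = n by [].
have iK L i : (rho L i < L)%N -> Posz (rho L i) = i by rewrite /rho; case: i => //= n; rewrite ltnn.
apply: (toeplitz_Lp p0 p1 infinite_int rK iK) => L b.
apply: (Fnorm_trpow_le infinite_int); do ?exact: (schatten_finop_any p0 p1 infinite_int (rK L) (iK L)).
pose x := finop L (rho L) (fun r c => b (r%:Z - c%:Z)).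
have E : finop L (rho L) (fun r c => phi (r%:Z - c%:Z) * b (r%:Z - c%:Z)) =
    fun r c => phi (r - c) * x r c.
  apply/funext => i; apply/funext => j; rewrite /x /finop.
  by case: ifP => [/andP[/iK iL /iK jL]|]; rewrite ?mulr0// iL jL.
rewrite E; apply: H.
apply: (@finsupp_of_seq _ _ _ [seq (Posz r, Posz c) | r <- iota 0 L, c <- iota 0 L]).
case=> i j; apply: contraNeq; rewrite /x /finop /=; case: ifP => [/andP[iL jL] _|]; last by rewrite eqxx.
rewrite -(iK _ _ iL) -(iK _ _ jL); apply/allpairsP; exists (rho L i, rho L j) => /=.
by rewrite !mem_iota.
Qed.

Lemma schur_SpSp_Lp : schur_contractive_SpSp p (fun r c => phi (r - c)) ->
  fourier_contractive_Lp p phi.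
Proof.
move=> H; pose rho L (i : nat * int) := if (i.1 == 0%N) && (0 <= i.2)%R then `|i.2|%N else L.
pose ii n : nat * int := (0%N, Posz n).
have rK L n : (n < L)%N -> rho L (ii n) = n by [].
have iK L i : (rho L i < L)%N -> ii (rho L i) = i.
  by rewrite /rho; case: i => [[|m] [n|n]] //=; rewrite ltnn.
apply: (toeplitz_Lp p0 p1 infinite_nat_int rK iK) => L b.
apply: (Fnorm_trpow_le infinite_nat_int); do ?exact: (schatten_finop_any p0 p1 infinite_nat_int (rK L) (iK L)).
(* Each block carries its scalar in the entry (0, 0), so the block matrix is the scalar Toeplitz
   section. *)
pose x (r c : int) : opmat R nat := fun m n =>
  finop L (rho L) (fun r c => b (r%:Z - c%:Z)) (0%N, r) (0%N, c) * munit R 0%N 0%N m n.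
have E0 : block_op x = finop L (rho L) (fun r c => b (r%:Z - c%:Z)).
  apply/funext => -[m i]; apply/funext => -[n j]; rewrite /block_op /x /munit /=.
  case: m n => [|m] [|n]; rewrite ?mulr1 ?mulr0// /finop /rho/= ltnn ?andbF//.
have E : finop L (rho L) (fun r c => phi (r%:Z - c%:Z) * b (r%:Z - c%:Z)) =
    block_op (fun r c i j => phi (r - c) * x r c i j).
  transitivity (fun i j : nat * int => phi (i.2 - j.2) * block_op x i j).
    rewrite E0; apply/funext => i; apply/funext => j; rewrite /finop.
    case: ifP => [/andP[/iK iL /iK jL]|]; rewrite ?mulr0//.
    by rewrite -[in RHS]iL -[in RHS]jL.
  by apply/funext => -[m i]; apply/funext => -[n j].
rewrite E -E0; apply: H; last first.
  by move=> r c; apply: (schattenZ infinite_nat p0 p1); exact: (schatten_munit _ _ infinite_nat p0 p1).1.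
apply: (@finsupp_of_seq _ _ _ [seq (Posz r, Posz c) | r <- iota 0 L, c <- iota 0 L]).
case=> i j ij; apply/funext => m; apply/funext => n /=; rewrite /x /finop.
case: ifP => [/andP[iL jL]|]; last by rewrite mul0r.
case/negP: ij; have [ei] := iK _ _ iL; have [ej] := iK _ _ jL.
by apply/allpairsP; exists (rho L (0%N, i), rho L (0%N, j)); rewrite /= !mem_iota iL jL ei ej.
Qed.

(** The lower bound is [rank_one_ineq] for a single singular value, the phase of z going into the
    left vector. *)
Lemma trpow_munitZ (z : R[i]) :
  trpow p (fun i j => z * munit R 0%N 0%N i j)%R = (cabs z `^ p)%:E.
Proof.
have [sm m1] := schatten_munit (R := R) 0%N 0%N infinite_nat p0 p1.
have sz := schattenZ infinite_nat p0 p1 z sm.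
apply/eqP; rewrite eq_le; apply/andP; split.
  apply: (le_trans (trpowZ infinite_nat p0 p1 z sm.1)).
  apply: (@le_trans _ _ ((cabs z `^ p)%:E * 1)%E); last by rewrite mule1.
  by apply: lee_wpmul2l => //; rewrite lee_fin powR_ge0.
have [xs [xi [eta [xs0 et [xi1 eta1 rep]]]]] := trpow_atoms infinite_nat p0 sz.1.
rewrite et (eq_nsum (g := fun k => cabs (xs k)%:C `^ p)) => [|k]; last by rewrite cabs_real ger0_norm.
have [v v1 e] := cabs_Re_unit z.
have v0 : v != 0 by rewrite -cabs_eq0 v1 oner_eq0.
have ez : z = (cabs z)%:C * v^-1 by rewrite -e mulrAC mulfV ?mul1r.
have od : orthonormal (fun _ : 'I_1 => dvec R 0%N).
  split=> [j|j l]; first exact: l2_dvec.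
  by rewrite inner_self ?nrm2_dvec ?(ord1 j) ?(ord1 l) ?eqxx//; exact: l2_dvec.
have := @rank_one_ineq _ _ _ p0 p1 _ 1 _ (fun=> dvec R 0%N) (fun _ i => v^-1 * dvec R 0%N i)
  (fun=> cabs z) _ xi eta _ od _ _ xi1 eta1 rep.
rewrite big_ord1; apply.
- by move=> _; exact: cabs_ge0.
- split=> [j|j l]; first by apply: l2Z; exact: l2_dvec.
  rewrite inner_self; last by apply: l2Z; exact: l2_dvec.
  rewrite nrm2Z; last exact: l2_dvec.
  by rewrite nrm2_dvec cabsV v1 invr1 expr1n mulr1 (ord1 j) (ord1 l) eqxx.
- move=> _; apply/funext => i; rewrite opapp_dvec mulrA -ez /munit /dvec.
  by rewrite eqxx andbT.
Qed.

Lemma LpSp_Lp : fourier_contractive_LpSp p phi -> fourier_contractive_Lp p phi.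
Proof.
move=> H x fx; have [s us xs] := finsupp_seq fx.
pose y k : opmat R nat := fun i j => x k * munit R 0%N 0%N i j.
have E c (d : int -> opmat R nat) : (forall k, k \notin s -> c k = 0) ->
    (forall k, d k = fun i j => c k * munit R 0%N 0%N i j) -> LpSp_norm p d = Lp_norm p c.
  move=> cs dE; congr (Fnorm p (haar_int _)); apply/funext => z.
  rewrite -trpow_munitZ; congr (trpow p _); apply/funext => i; apply/funext => j.
  rewrite /trigpoly_op (trigpolyE _ us); last by move=> k /cs; rewrite dE => ->; rewrite mul0r.
  rewrite (trigpolyE _ us)// mulr_suml; apply: eq_bigr => k _; rewrite dE; ring.
rewrite -(E x y)// -(E _ (fun k i j => phi k * y k i j)).
- apply: H; last by move=> k; apply: (schattenZ infinite_nat p0 p1); exact: (schatten_munit _ _ infinite_nat p0 p1).1.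
  apply: (finsupp_of_seq (s := s)) => k /xs e; apply/funext => i; apply/funext => j.
  by rewrite /y e mul0r.
- by move=> k /xs ->; rewrite mulr0.
- by move=> k; apply/funext => i; apply/funext => j; rewrite /y mulrA.
Qed.

End ConverseImplications.

(** * Contractive multipliers on L^p are atomic *)

Section Sharpen.
Variables (R : realType) (p : R) (p0 : 0 < p) (p1 : p < 1).

Lemma Lp_avg_le (phi : int -> R[i]) (s : seq int) (x : int -> R[i]) :
  fourier_contractive_Lp p phi -> uniq s -> (forall k, k \notin s -> x k = 0) ->
  circle_avg (fun c => cabs (\sum_(k <- s) c k * x k) `^ p) phi <=
  circle_avg (fun c => cabs (\sum_(k <- s) c k * x k) `^ p) (fun=> 1).
Proof.
by move=> H us xs; rewrite -(Lp_norm_le_avg p0 p1 _ us xs); apply/H/(finsupp_of_seq xs).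
Qed.

(* Only the largest term can dominate; every other term is at most the
   geometric mean of itself and the largest one. *)
Lemma sum_pow_le_cross (T : eqType) (r : seq T) (y : T -> R[i]) : uniq r ->
  \sum_(g <- r) cabs (y g) `^ p <= cabs (\sum_(g <- r) y g) `^ p +
    2 * \sum_(g <- r) \sum_(h <- r | h != g) (cabs (y g) * cabs (y h)) `^ (p / 2).
Proof.
move=> ur; have [->|rn] := eqVneq r [::].
  by rewrite !big_nil mulr0 addr0 powR_ge0.
have [g0 g0r gmax] : exists2 g0, g0 \in r & forall g, g \in r -> cabs (y g) <= cabs (y g0).
  elim: r rn {ur} => // g r IH _; have [->|rn] := eqVneq r [::].
    by exists g; rewrite ?mem_head// => h; rewrite inE => /eqP ->.
  have [h hr hm] := IH rn; have [gh|hg] := leP (cabs (y g)) (cabs (y h)).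
    by exists h; rewrite ?inE ?hr ?orbT// => k; rewrite inE => /orP[/eqP ->//|/hm].
  exists g; rewrite ?mem_head// => k; rewrite inE => /orP[/eqP ->//|/hm kh].
  by rewrite (le_trans kh)// ltW.
pose U := \sum_(g <- r | g != g0) cabs (y g) `^ p; pose S := \sum_(g <- r | g != g0) y g.
have -> : \sum_(g <- r) cabs (y g) `^ p = cabs (y g0) `^ p + U by rewrite (bigD1_seq g0).
have -> : \sum_(g <- r) y g = y g0 + S by rewrite (bigD1_seq g0).
have h1 : cabs (y g0) `^ p <= cabs (y g0 + S) `^ p + U.
  have SU : cabs S `^ p <= U.
    apply: (@le_trans _ _ ((\sum_(g <- r | g != g0) cabs (y g)) `^ p)).
      rewrite ge0_ler_powR ?nnegrE ?cabs_ge0 ?cabs_sum ?(ltW p0)//.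
      by apply: sumr_ge0 => g _; exact: cabs_ge0.
    rewrite /U -[X in X `^ p]big_filter -[leRHS]big_filter.
    exact: (powR_sum_le p0 p1 _ (fun g => cabs_ge0 (y g))).
  rewrite (le_trans _ (lerD (lexx _) SU))// (le_trans _ (powRD_le _ _ _ _)) ?cabs_ge0//.
  rewrite ge0_ler_powR ?nnegrE ?addr_ge0 ?cabs_ge0 ?(ltW p0)//.
  by rewrite -(cabsN S) (le_trans _ (cabsD _ _))// addrK.
have h2 : U <= \sum_(g <- r) \sum_(h <- r | h != g) (cabs (y g) * cabs (y h)) `^ (p / 2).
  have c0 g : 0 <= \sum_(h <- r | h != g) (cabs (y g) * cabs (y h)) `^ (p / 2).
    by apply: sumr_ge0 => h _; exact: powR_ge0.
  rewrite (bigD1_seq g0)//= (le_trans _ (lerD (c0 g0) (lexx _)))// add0r.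
  rewrite /U [leLHS]big_seq_cond [leRHS]big_seq_cond; apply: ler_sum => g /andP[gr gg0].
  apply: (@le_trans _ _ ((cabs (y g) * cabs (y g0)) `^ (p / 2))); last first.
    by rewrite (big_rem g0)//= eq_sym gg0 lerDl; apply: sumr_ge0 => h _; exact: powR_ge0.
  have -> : cabs (y g) `^ p = (cabs (y g) * cabs (y g)) `^ (p / 2).
    by rewrite -expr2 -powR_mulrn ?cabs_ge0// -powRrM; congr (_ `^ _); field.
  rewrite ge0_ler_powR ?nnegrE ?mulr_ge0 ?cabs_ge0 ?divr_ge0 ?(ltW p0)//.
  by rewrite ler_wpM2l ?cabs_ge0// gmax.
by move: h1 h2; set c := \sum_(g <- r) _; set v := _ `^ p; set u := _ `^ p; lra.
Qed.

Lemma bernoulli (t : R) n : 1 <= t -> 1 + n%:R * (t - 1) <= t ^+ n.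
Proof.
move=> t1; elim: n => [|n IH]; first by rewrite mul0r addr0 expr0.
have t0 : 0 <= t by rewrite (le_trans ler01).
have := ler_wpM2l t0 IH; rewrite -exprS; apply: le_trans.
have : 0 <= n%:R * (t - 1) ^+ 2 by rewrite mulr_ge0// sqr_ge0.
rewrite -natr1; nra.
Qed.

Lemma cabsD_unit_lt2 (g h : R[i]) : cabs g = 1 -> cabs h = 1 -> g != h -> cabs (g + h) < 2.
Proof.
move=> g1 h1 gh.
have d0 : 0 < cabs (g - h) by rewrite lt_neqAle cabs_ge0 eq_sym cabs_eq0 subr_eq0 gh.
have : cabs (g + h) ^+ 2 + cabs (g - h) ^+ 2 = 2 * cabs g ^+ 2 + 2 * cabs h ^+ 2.
  have ImN (z : R[i]) : complex.Im (- z) = - complex.Im z by case: z.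
  by rewrite !sqr_cabs !ReD !ImD ReN ImN; ring.
rewrite g1 h1; have := cabs_ge0 (g + h); nra.
Qed.

Section Binomial.
Variable n : nat.

Definition bsupp := [seq Posz i | i <- iota 0 n.+1].
Definition bcoef (k : int) : R[i] := if (0 <= k)%R then 'C(n, `|k|)%:R else 0.

Lemma bsupp_uniq : uniq bsupp.
Proof. by rewrite map_inj_uniq ?iota_uniq// => i j []. Qed.

Lemma bcoef_out k : k \notin bsupp -> bcoef k = 0.
Proof.
rewrite /bcoef; case: k => //= i iN; rewrite bin_small// ltnNge; apply: contra iN => iN.
by apply: map_f; rewrite mem_iota.
Qed.

Lemma bcoef_eval (w : R[i]) : \sum_(k <- bsupp) w ^ k * bcoef k = (1 + w) ^+ n.
Proof.
rewrite big_map (_ : iota 0 n.+1 = index_iota 0 n.+1) ?big_mkord; last by rewrite /index_iota subn0.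
rewrite exprDn; apply: eq_bigr => i _.
by rewrite expr1n mul1r /bcoef /= mulr_natr.
Qed.

(** The functional of the test polynomial (1 + z)^n; its circle average at the multiplier 1 is the
    integral of |1 + z|^(np). *)
Definition bQ (c : int -> R[i]) : R := cabs (\sum_(k <- bsupp) c k * bcoef k) `^ p.

Lemma psemi_bQ : psemi p bsupp bQ.
Proof. exact: psemi_scalcomb. Qed.

(** Among any N translated roots of unity one lies within 1/N of the point 1 in the angular
    parameter, where |1 + z| >= sg; hence every sampled sum is at least sg^(np). This bounds the
    integral from below without evaluating it. *)
Lemma bQ_lower (sg d : R) N : 0 <= sg -> (0 < N)%N -> N%:R^-1 < d ->
  (forall u : R, `|u| < d -> sg <= cabs (1 + cis u)) ->
  (sg ^+ n) `^ p <= N%:R * circle_avg bQ (fun=> 1).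
Proof.
move=> s0 N0 Nd hd; have cQ := psemi_continuous p0 psemi_bQ (c := fun=> 1).
have NR : 0 < N%:R :> R by rewrite ltr0n.
rewrite /circle_avg -(cint_roots N0 cQ) => [|t]; last by rewrite modul_period.
rewrite -[leLHS]cint_cst; apply: cint_le.
- exact: cst_continuous.
- apply: (@continuous_sum _ _ _ (fun (j : 'I_N) t => bQ (modul (fun=> 1) (t + j%:R / N%:R)))) => j.
  exact: (@continuous_shift _ (fun t => bQ (modul (fun=> 1) t)) (j%:R / N%:R) cQ).
(* With this m the point t + m/N lies in [0, 1/N); j is the residue of m modulo N. *)
move=> t; pose m := Num.ceil (- (t * N%:R)); pose j := `|(m %% N)%Z|%N.
have Nz : (N : int) != 0 by rewrite eqz_nat -lt0n.
have jm : (j : int) = (m %% N)%Z by rewrite /j gez0_abs// modz_ge0.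
have jN : (j < N)%N by rewrite -ltz_nat jm; have := ltz_pmod m (d := N); rewrite ltz_nat; apply.
rewrite (bigD1 (Ordinal jN))//= (le_trans _ (lerD (lexx _) (sumr_ge0 _ (fun i _ => powR_ge0 _ _))))// addr0.
have E : cis (t + j%:R / N%:R) = cis (t + m%:~R / N%:R).
  have -> : m%:~R / N%:R = j%:R / N%:R + (m %/ N)%Z%:~R :> R.
    by rewrite {1}(divz_eq m N) -jm intrD intrM mulrDl -!pmulrn mulfK ?gt_eqF// addrC.
  by rewrite (addrA t) [RHS]cisD cis_int mulr1.
have small : `|t + m%:~R / N%:R| < d.
  apply: (le_lt_trans _ Nd).
  have -> : t + m%:~R / N%:R = (m%:~R + t * N%:R) / N%:R by field; rewrite gt_eqF.
  rewrite normrM [`|N%:R^-1|]ger0_norm ?invr_ge0 ?(ltW NR)// ler_piMl ?invr_ge0 ?(ltW NR)//.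
  have /andP[] := ceil_itv (- (t * N%:R)); rewrite -/m => h1 h2.
  by rewrite ler_norml; apply/andP; split; move: h1 h2; rewrite intrD; lra.
rewrite /bQ ge0_ler_powR ?nnegrE ?exprn_ge0 ?cabs_ge0 ?(ltW p0)//.
rewrite (eq_bigr (fun k => cis (t + j%:R / N%:R) ^ k * bcoef k)).
  by rewrite bcoef_eval cabsX E lerXn2r ?nnegrE ?cabs_ge0// hd.
by move=> k _; rewrite /modul mul1r.
Qed.

End Binomial.

(** Provides a single rho < 4 for all pairs of distinct atoms; the lower bound 1 makes rho positive
    also when there is no pair. *)
Lemma bounded_below2 (T : eqType) (s : seq T) (F : T -> R) :
  (forall x, x \in s -> F x < 4) -> exists r : R, 1 <= r < 4 /\ forall x, x \in s -> F x <= r.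
Proof.
elim: s => [|x s IH] h; first by exists 1; split => //; rewrite lexx; lra.
have [|r [/andP[r1 r4] hr]] := IH; first by move=> y ys; apply: h; rewrite inE ys orbT.
have x4 := h x (mem_head _ _).
exists (Num.max r (F x)); split.
  by rewrite le_max r1/= gt_max r4.
by move=> y; rewrite inE le_max => /orP[/eqP ->|/hr ->//]; rewrite lexx orbT.
Qed.

(** Integrate [sum_pow_le_cross] for the terms a_g (1 + z/g)^n: the diagonal terms have equal
    integrals by rotation, and the cross terms are at most rho^(np/2) up to a constant. *)
Lemma binom_cross n (r : seq (circle R)) (a : circle R -> R[i]) (rho : R) : uniq r ->
  (forall g h, g \in r -> h \in r -> h != g -> 2 + cabs ((sval g)^-1 + (sval h)^-1) <= rho) ->
  (\sum_(g <- r) cabs (a g) `^ p) * circle_avg (bQ n) (fun=> 1) <=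
  circle_avg (bQ n) (fun k => \sum_(g <- r) a g * sval g ^ (- k)) +
    (2 * \sum_(g <- r) \sum_(h <- r | h != g) (cabs (a g) * cabs (a h)) `^ (p / 2)) * (rho ^+ n) `^ (p / 2).
Proof.
move=> ur hr; set K := 2 * _.
have cg (g : circle R) : cabs (sval g) = 1.
  by apply: complexI; rewrite cabsE; exact/eqP/(valP g).
have cgV (g : circle R) : cabs (sval g)^-1 = 1 by rewrite cabsV cg invr1.
have cQ c := psemi_continuous p0 (psemi_bQ n) (c := c).
pose y t (g : circle R) := a g * (1 + (sval g)^-1 * cis t) ^+ n.
have yE t g : bQ n (modul (fun k => a g * sval g ^ (- k)) t) = cabs (y t g) `^ p.
  rewrite /bQ /y -bcoef_eval mulr_sumr; congr (cabs _ `^ p); apply: eq_bigr => k _.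
  by rewrite /modul -exprz_inv expfzMl !mulrA.
have SE t : bQ n (modul (fun k => \sum_(g <- r) a g * sval g ^ (- k)) t) =
    cabs (\sum_(g <- r) y t g) `^ p.
  rewrite /bQ /y; congr (cabs _ `^ p).
  under [RHS]eq_bigr => g _ do rewrite -bcoef_eval mulr_sumr.
  rewrite exchange_big; apply: eq_bigr => k _ /=.
  rewrite /modul !mulr_suml; apply: eq_bigr => g _.
  by rewrite -exprz_inv expfzMl !mulrA.
have I1 g : cint (fun t => bQ n (modul (fun k => a g * sval g ^ (- k)) t)) =
    cabs (a g) `^ p * circle_avg (bQ n) (fun=> 1).
  rewrite -(circle_avg_rot p0 (psemi_bQ n) (fun=> 1) (cgV g)) /circle_avg -cintZ; last exact: cQ.
  congr cint; apply/funext => t; rewrite yE /y cabsM powRM ?cabs_ge0//; congr (_ * _).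
  rewrite /bQ -bcoef_eval; congr (cabs _ `^ p); apply: eq_bigr => k _.
  by rewrite /modul mul1r expfzMl.
rewrite mulr_suml -(eq_bigr _ (fun g _ => I1 g)) -cint_sum; last by move=> g; exact: cQ.
rewrite -[K * _]cint_cst /circle_avg -cintD; [|exact: cQ|exact: cst_continuous].
apply: cint_le.
- by apply: continuous_sum => g; exact: cQ.
- by apply: continuousDf; [exact: cQ|exact: cst_continuous].
move=> t; rewrite SE (eq_bigr _ (fun g _ => yE t g)).
apply: (le_trans (sum_pow_le_cross (y t) ur)); rewrite lerD2l /K -mulrA ler_wpM2l//.
rewrite mulr_suml big_seq [leRHS]big_seq; apply: ler_sum => g gr.
rewrite mulr_suml big_seq_cond [leRHS]big_seq_cond; apply: ler_sum => h /andP[hr' hg].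
rewrite -powRM ?mulr_ge0 ?cabs_ge0//; last first.
  by rewrite exprn_ge0// (le_trans _ (hr g h gr hr' hg))// addr_ge0 ?cabs_ge0.
rewrite ge0_ler_powR ?nnegrE ?mulr_ge0 ?cabs_ge0 ?divr_ge0 ?(ltW p0)//.
  by rewrite exprn_ge0// (le_trans _ (hr g h gr hr' hg))// addr_ge0 ?cabs_ge0.
rewrite /y !cabsM !cabsX mulrACA ler_wpM2l ?mulr_ge0 ?cabs_ge0// -exprMn.
rewrite lerXn2r ?nnegrE ?mulr_ge0 ?cabs_ge0//.
  by rewrite (le_trans _ (hr g h gr hr' hg))// addr_ge0 ?cabs_ge0.
apply: le_trans (hr g h gr hr' hg); rewrite -cabsM.
(* The outer coefficients together contribute at most 2 to the modulus, and the middle one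
   contributes the modulus of the sum of the inverses of g and h. *)
have -> : (1 + (sval g)^-1 * cis t) * (1 + (sval h)^-1 * cis t) =
  1 + ((sval g)^-1 * (sval h)^-1) * (cis t) ^+ 2 + ((sval g)^-1 + (sval h)^-1) * cis t.
  by move: (sval g)^-1 (sval h)^-1 (cis t) => u v w; ring.
rewrite (le_trans (cabsD _ _))// lerD//; last by rewrite cabsM cabs_cis mulr1.
rewrite (le_trans (cabsD _ _))// cabs1 !cabsM cabs_cis !cgV !mulr1.
by rewrite -[2]/(1 + 1).
Qed.

(** The integral is at least sg^(np) / N with N fixed and sg^2 > rho, so the cross term is
    negligible: the excess of A over 1 + e, multiplied by tau^n with tau > 1, stays bounded. *)
Lemma binom_gap (A e K rho : R) : 1 <= rho < 4 -> 0 <= K ->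
  (forall n, A * circle_avg (bQ n) (fun=> 1) <=
     (1 + e) * circle_avg (bQ n) (fun=> 1) + K * (rho ^+ n) `^ (p / 2)) -> A <= 1 + e.
Proof.
move=> /andP[rho1 rho4] K0 H.
(* Its square lies strictly between rho and 4 = |1 + 1|^2. *)
pose sg := Num.sqrt ((rho + 4) / 2).
have sg2 : sg ^+ 2 = (rho + 4) / 2 by rewrite sqr_sqrtr//; lra.
have sg0 : 0 < sg by rewrite sqrtr_gt0; lra.
have sg_2 : sg < 2 by nra.
have [|d d0 hd] := @cis_near0 R (2 - sg); first by lra.
have near u : `|u| < d -> sg <= cabs (1 + cis u).
  move=> /hd h; have := cabsD (1 + cis u) (- (cis u - 1)).
  rewrite (_ : _ - _ = 2%:R%:C); last by rewrite rmorph_nat; ring.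
  by rewrite cabsN cabs_real ger0_norm ?ler0n//; lra.
pose N := (Num.truncn d^-1).+1.
have Nd : N%:R^-1 < d.
  by rewrite invf_plt ?posrE// ?truncnS_gt.
have low n := bQ_lower n (ltW sg0) (isT : (0 < N)%N) Nd near.
pose tau := (sg ^+ 2 / rho) `^ (p / 2).
have rho0 : 0 < rho by lra.
have tau1 : 1 < tau.
  have t1 : 1 < sg ^+ 2 / rho by rewrite ltr_pdivlMr// mul1r sg2; lra.
  apply: (@le_lt_trans _ _ (1 `^ (p / 2))); first by rewrite powR1.
  apply: gt0_ltr_powR => //; rewrite ?nnegrE ?ler01 ?divr_gt0//.
  by rewrite (le_trans ler01)// ltW.
have key n : (A - (1 + e)) * tau ^+ n <= K * N%:R.
  have I0 : 0 < circle_avg (bQ n) (fun=> 1).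
    have : 0 < N%:R * circle_avg (bQ n) (fun=> 1).
      by apply: lt_le_trans (low n); rewrite powR_gt0// exprn_gt0.
    by rewrite pmulr_rgt0// ltr0n.
  have rp : 0 < (rho ^+ n) `^ (p / 2) by rewrite powR_gt0// exprn_gt0.
  have tauE : tau ^+ n * (rho ^+ n) `^ (p / 2) = (sg ^+ n) `^ p.
    have powXn (u : R) : 0 <= u -> (u `^ (p / 2)) ^+ n = (u ^+ n) `^ (p / 2).
      move=> u0; elim: n {I0 rp low H} => [|m IH]; first by rewrite !expr0 powR1.
      by rewrite !exprS IH -powRM ?exprn_ge0.
    rewrite powXn ?divr_ge0 ?sqr_ge0 ?(ltW rho0)// -powRM ?exprn_ge0 ?divr_ge0 ?sqr_ge0 ?(ltW rho0)//.
    rewrite -exprMn divfK ?gt_eqF// -exprM mulnC exprM -[X in (X) `^ _]powR_mulrn ?exprn_ge0 ?(ltW sg0)//.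
    by rewrite -powRrM; congr (_ `^ _); field.
  have h1 := H n; have h3 := low n.
  rewrite -tauE in h3.
  have h4 : (A - (1 + e)) * circle_avg (bQ n) (fun=> 1) <= K * (rho ^+ n) `^ (p / 2).
    by rewrite mulrBl lerBlDl.
  rewrite -(ler_pM2r rp).
  have [An|An] := leP (A - (1 + e)) 0.
    apply: (@le_trans _ _ 0); last by rewrite !mulr_ge0// ltW.
    by rewrite -mulrA mulr_le0_ge0// mulr_ge0 ?exprn_ge0 ?powR_ge0// ltW.
  apply: (@le_trans _ _ (N%:R * ((A - (1 + e)) * circle_avg (bQ n) (fun=> 1)))).
    by rewrite -mulrA [leRHS]mulrCA ler_wpM2l// ltW.
  by rewrite [leRHS]mulrAC [leRHS]mulrC ler_wpM2l.
have [//|An] := leP A (1 + e).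
have A0 : 0 < A - (1 + e) by rewrite subr_gt0.
suff : (A - (1 + e)) * (tau - 1) <= 0 by rewrite pmulr_rle0//; lra.
apply: (@le_of_linear _ _ _ (K * N%:R) 0) => n _.
rewrite mulr0 add0r (le_trans _ (key n))// mulrCA ler_pM2l//.
by have := bernoulli n (ltW tau1); lra.
Qed.

(* Testing on (1 + z)^n: as n grows the translates of |1 + z|^(np) by distinct
   points of the circle become asymptotically disjoint. *)
Lemma atomic_mass_le1 (phi : int -> R[i]) (a : circle R -> R[i]) :
  fourier_contractive_Lp p phi -> (forall k, phi k = fourier_atomic a k) ->
  (nsum (fun g => cabs (a g) `^ p)%R < +oo)%E ->
  (nsum (fun g => cabs (a g) `^ p)%R <= 1)%E.
Proof.
move=> H /funext phia aoo; apply: nsum_le => r ur.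
have cg (g : circle R) : cabs (\val g) = 1.
  by apply: complexI; rewrite cabsE; exact/eqP/(valP g).
have cgV (g : circle R) : cabs (\val g)^-1 = 1 by rewrite cabsV cg invr1.
rewrite lee_fin; apply/ler_addgt0Pr => e e0.
have ap0 (g : circle R) : 0 <= cabs (a g) `^ p by exact: powR_ge0.
have [r1 ur1 tail] := nsum_tail ap0 aoo e0.
(* [r] is the set of atoms whose mass is to be bounded; adding [r1] makes the mass of the omitted
   atoms at most e. *)
pose r2 := r ++ [seq g <- r1 | g \notin r].
have ur2 : uniq r2.
  rewrite cat_uniq ur filter_uniq// andbT/=; apply/hasPn => g; rewrite mem_filter.
  by case/andP.
have mr2 g : g \in r1 -> g \in r2 by rewrite mem_cat mem_filter => ->; rewrite andbT orbN.
pose at_ (g : circle R) : R[i] := if g \in r2 then 0 else a g.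
have tail2 : (nsum (fun g => cabs (at_ g) `^ p)%R <= e%:E)%E.
  apply: le_trans tail; apply: le_nsum => g; rewrite /at_.
  case: (boolP (g \in r1)) => [/mr2 ->|_]; first by rewrite cabs0 powR0 ?gt_eqF.
  by case: ifP; rewrite ?cabs0 ?powR0 ?gt_eqF.
have as_ : asum a by apply: (nsum_of_pow p0 p1) => // g; exact: cabs_ge0.
pose A := \sum_(g <- r2) cabs (a g) `^ p.
have rA : \sum_(g <- r) cabs (a g) `^ p <= A.
  by rewrite /A big_cat/= lerDl; apply: sumr_ge0.
rewrite (le_trans rA)//.
pose phir k := \sum_(g <- r2) a g * sval g ^ (- k).
have phi_split k : phir k = phi k + (-1) * fourier_atomic at_ k.
  have ak : asum (fun g => a g * sval g ^ (- k)).
    by apply: (asum_le _ as_) => g; rewrite cabsM cabsXz cg exp1rz mulr1.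
  rewrite phia /fourier_atomic (csum_restrict ak ur2) mulN1r.
  rewrite (eq_csum (g := fun g => at_ g * sval g ^ (- k))) ?addrK// => g.
  by rewrite /at_; case: ifP; rewrite ?mul0r.
(* Contractivity of phi accounts for the 1, and the omitted atoms for the e. *)
have avg_phir n : circle_avg (bQ n) phir <= (1 + e) * circle_avg (bQ n) (fun=> 1).
  have [Q0 Qd Qz _] := psemi_avg p0 (psemi_bQ n).
  rewrite (_ : phir = fun k => phi k + (-1) * fourier_atomic at_ k); last exact/funext.
  apply: (le_trans (Qd _ _)); rewrite mulrDl mul1r; apply: lerD.
    exact: (Lp_avg_le H (bsupp_uniq n) (@bcoef_out n)).
  apply: (le_trans (Qz _ _)); rewrite cabsN cabs1 powR1 mul1r.
  exact: (fourier_atomic_bound p0 p1 (psemi_bQ n) tail2).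
have [|rho [/andP[rho1 rho4] hrho]] := @bounded_below2 _
  [seq gh <- [seq (g, h) | g <- r2, h <- r2] | gh.2 != gh.1]
  (fun gh => 2 + cabs ((sval gh.1)^-1 + (sval gh.2)^-1)).
  move=> [g h]; rewrite mem_filter /= => /andP[hg _].
  rewrite -ltrBrDl (_ : 4 - 2 = 2 :> R); last by ring.
  apply: cabsD_unit_lt2; rewrite ?cgV//; apply: contra hg => /eqP/invr_inj hg.
  by apply/eqP/val_inj.
have cross n := binom_cross n a ur2 (fun g h gr hr hg =>
  hrho (g, h) (eq_ind_r is_true (introT andP (conj hg (allpairs_f (@pair _ _) gr hr))) (mem_filter _ _ _))).
have K0 : 0 <= 2 * \sum_(g <- r2) \sum_(h <- r2 | h != g) (cabs (a g) * cabs (a h)) `^ (p / 2).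
  by rewrite mulr_ge0// sumr_ge0// => g _; apply: sumr_ge0 => h _; exact: powR_ge0.
apply: (binom_gap _ K0 (rho := rho)) => [|n]; first by rewrite rho1.
exact: (le_trans (cross n) (lerD (avg_phir n) (lexx _))).
Qed.

End Sharpen.

(** * Coefficients of powers of the Dirichlet kernel *)

Section BoxKernel.
Variables (R : realType) (n : nat).
Hypothesis n0 : (0 < n)%N.

Definition boxpoly : {poly R} := \sum_(i < n) 'X^i.

Lemma coef_boxpoly k : boxpoly`_k = (k < n)%N%:R.
Proof.
rewrite coef_sum; case: (ltnP k n) => [kn|nk].
  rewrite (bigD1 (Ordinal kn))//= coefXn eqxx big1 ?addr0// => i ik.
  by rewrite coefXn; case: eqP => // e; case/negP: ik; rewrite -val_eqE /= e.
by rewrite big1// => i _; rewrite coefXn gtn_eqF// (leq_trans (ltn_ord i)).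
Qed.

Lemma boxpow_ge0 m k : 0 <= (boxpoly ^+ m)`_k.
Proof.
elim: m k => [|m IH] k; first by rewrite expr0 coef1.
by rewrite exprS coefM; apply: sumr_ge0 => j _; rewrite mulr_ge0// coef_boxpoly.
Qed.

(** A multiplication by the kernel adds up at most n coefficients. *)
Lemma boxpow_le m k : (boxpoly ^+ m.+1)`_k <= n%:R ^+ m.
Proof.
elim: m k => [|m IH] k; first by rewrite expr1 expr0 coef_boxpoly lern1 leq_b1.
rewrite exprS coefM [n%:R ^+ _]exprSr.
have sumlt j : \sum_(i < j) (i < n)%N%:R = (minn j n)%:R :> R.
  elim: j => [|j IHj]; first by rewrite big_ord0 min0n.
  by rewrite big_ord_recr/= IHj -natrD; congr (_%:R); case: ltnP => ?; lia.
apply: (@le_trans _ _ (\sum_(j < k.+1) n%:R ^+ m * (j < n)%N%:R)).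
  by apply: ler_sum => j _; rewrite coef_boxpoly mulrC ler_wpM2r.
by rewrite -mulr_sumr sumlt ler_wpM2l ?exprn_ge0// ler_nat geq_minr.
Qed.

(** The kernel times 1 - X telescopes to 1 - X^n. The increment is thus a coefficient of a power one
    lower times 1 - X^n, a difference of numbers between 0 and n^m. *)
Lemma boxpow_diff m k : `|(boxpoly ^+ m.+2)`_k.+1 - (boxpoly ^+ m.+2)`_k| <= n%:R ^+ m.
Proof.
have tele : boxpoly * (1 - 'X) = 1 - 'X^n.
  by rewrite -[RHS]opprB -(opprB 'X) mulrN mulrC [in RHS]subrX1.
have E : (boxpoly ^+ m.+2)`_k.+1 - (boxpoly ^+ m.+2)`_k =
    (boxpoly ^+ m.+1)`_k.+1 - (if (k.+1 < n)%N then 0 else (boxpoly ^+ m.+1)`_(k.+1 - n)).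
  have := congr1 (fun q : {poly R} => (boxpoly ^+ m.+1 * q)`_k.+1) tele.
  by rewrite mulrA -exprSr !mulrBr !mulr1 !coefB coefMX coefMXn.
rewrite E; have := boxpow_le m k.+1; have := boxpow_ge0 m.+1 k.+1.
case: ifP => _; last first.
  have := boxpow_le m (k.+1 - n); have := boxpow_ge0 m.+1 (k.+1 - n).
  by rewrite ler_norml; lra.
by move=> ? ?; rewrite subr0 ger0_norm.
Qed.

(** Controls the increment into index 0, the coefficients of negative index being 0. *)
Lemma boxpow_coef0 m : (boxpoly ^+ m.+2)`_0 <= n%:R ^+ m.
Proof.
have -> : (boxpoly ^+ m.+2)`_0 = 1.
  elim: m.+2 => [|j IH]; first by rewrite expr0 coef1.
  by rewrite exprS coef0M IH coef_boxpoly n0 mulr1.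
by rewrite exprn_ege1// ler1n.
Qed.

Lemma size_boxpow m : (size (boxpoly ^+ m.+1) <= m.+1 * n)%N.
Proof.
have sb : (size boxpoly <= n)%N.
  by apply/leq_sizeP => j nj; rewrite coef_boxpoly ltnNge nj.
elim: m => [|m IH]; first by rewrite expr1 mul1n.
rewrite exprS (leq_trans (size_polyMleq _ _))//; lia.
Qed.

(** The coefficients add up to the value n^(m+1) at 1 and there are at most (m+1) n of them: some
    coefficient reaches the mean. *)
Lemma boxpow_max m : exists2 k : nat, (k < m.+1 * n)%N &
  n%:R ^+ m.+1 <= (m.+1 * n)%:R * (boxpoly ^+ m.+1)`_k.
Proof.
set q := boxpoly ^+ m.+1; set N := (m.+1 * n)%N.
have N0 : (0 < N)%N by rewrite muln_gt0.
have sumq : \sum_(k < N) q`_k = n%:R ^+ m.+1.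
  have : q.[1] = n%:R ^+ m.+1.
    rewrite horner_exp horner_sum (eq_bigr (fun=> 1)) ?sumr_const ?card_ord// => i _.
    by rewrite hornerXn expr1n.
  rewrite (horner_coef_wide _ (size_boxpow m)) => <-; apply: eq_bigr => i _.
  by rewrite expr1n mulr1.
have [[[k kN] /= h]|h] := pselect (exists k : 'I_N, n%:R ^+ m.+1 <= N%:R * q`_k); first by exists k; [exact: kN|exact: h].
exfalso; have : N%:R * \sum_(k < N) q`_k < N%:R * n%:R ^+ m.+1.
  rewrite mulr_sumr (_ : N%:R * n%:R ^+ m.+1 = \sum_(k < N) n%:R ^+ m.+1); last first.
    by rewrite sumr_const card_ord mulr_natl.
  apply: ltr_sum; first by apply/hasP; exists (Ordinal N0); rewrite ?mem_index_enum.
  by move=> k _; rewrite ltNge; apply/negP => hk; apply: h; exists k.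
by rewrite sumq ltxx.
Qed.

(** As n <= N, the exponents below n are distinct modulo N and the sampled characters are
    orthogonal. *)
Lemma box_parseval N (t : R) : (n <= N)%N ->
  \sum_(j < N) cabs (\sum_(i < n) cis (t + j%:R / N%:R) ^+ i) ^+ 2 = N%:R * n%:R.
Proof.
move=> nN; have N0 : (0 < N)%N := leq_trans n0 nN.
apply: complexI; rewrite realC_sum.
under eq_bigr => j _ do rewrite -mulcJ conj_sum mulr_suml.
rewrite exchange_big /=.
rewrite (eq_bigr (fun=> N%:R)) => [|i _].
  by rewrite sumr_const card_ord realCM !rmorph_nat mulr_natr.
under eq_bigr => j _ do rewrite mulr_sumr.
rewrite exchange_big /= (bigD1 i)//= [X in _ + X]big1 ?addr0 => [|l li].
  under eq_bigr => j _ do rewrite mulcJ cabsX cabs_cis !expr1n.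
  by rewrite sumr_const card_ord.
have cc (k : nat) (u : R) : (cis u ^+ k)^* = cis (- (k%:R * u)) by rewrite cisXn cis_conj.
rewrite (eq_bigr (fun j : 'I_N => cis ((i%:R - l%:R) * t) * cis ((i%:Z - l%:Z)%:~R * (j%:R / N%:R)))).
  rewrite -mulr_sumr root_sum// ifF ?mulr0//; apply/negP => h.
  have : l <> i :> nat by move/val_inj => e; rewrite e eqxx in li.
  by have := dvdz_small h; have := ltn_ord i; have := ltn_ord l; lia.
move=> j _; rewrite cc cisXn -!cisD; congr cis; rewrite intrB -!pmulrn; ring.
Qed.

End BoxKernel.

Section TestFunctions.
Variables (R : realType) (p : R) (p0 : 0 < p) (p1 : p < 1).

(* The witnesses are normalised powers of the Dirichlet kernel
   1 + z + ... + z^(n-1). *)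
Lemma test_functions : exists M : nat, forall n, (0 < n)%N ->
  exists (N : nat) (s : seq int) (x : int -> R[i]),
  [/\ (0 < N)%N, uniq s /\ (forall k, k \notin s -> x k = 0),
      forall k l, k \in s -> l \in s -> (N %| k - l)%Z -> k = l,
      forall k, cabs (x k - 1) <= `|k|%N%:R * (M%:R / n%:R) &
      forall t : R, \sum_(j < N) cabs (\sum_(k <- s) x k * cis (t + j%:R / N%:R) ^ k) `^ p <= M%:R * N%:R `^ p].
Proof.
(* The power M = m + 2 satisfies M p >= 2, which allows the comparison with a square in [up]. *)
pose m := Num.truncn (2 / p); exists m.+2 => n n0.
have Mp : 2 <= m.+2%:R * p.
  rewrite -ler_pdivrMr// (le_trans (ltW (truncnS_gt _)))// ler_nat.
  by rewrite leqnSn.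
have nR : 0 < n%:R :> R by rewrite ltr0n.
pose N := (m.+2 * n)%N; have N0 : (0 < N)%N by rewrite muln_gt0.
have NR : 0 < N%:R :> R by rewrite ltr0n.
pose q := boxpoly R n ^+ m.+2.
have [k0 k0N hk0] := boxpow_max R n0 m.+1; rewrite -/q -/N in hk0.
have c0 : 0 < q`_k0.
  by rewrite -(pmulr_rgt0 _ NR) (lt_le_trans _ hk0)// exprn_gt0.
pose s := [seq i%:Z - k0%:Z | i <- iota 0 N].
pose cz (k : int) : R := if (0 <= k)%R then q`_`|k| else 0.
(* Recentred at an index [k0] whose coefficient is at least the mean and divided by that
   coefficient, so that x_0 = 1. *)
pose x (k : int) : R[i] := (cz (k + k0%:Z) / q`_k0)%:C.
have szq : (size q <= N)%N := size_boxpow R n0 m.+1.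
have us : uniq s by rewrite map_inj_uniq ?iota_uniq// => i j; lia.
have xs k : k \notin s -> x k = 0.
  move=> ks; rewrite /x /cz; case: ifP => [kk|_]; last by rewrite mul0r.
  rewrite (leq_sizeP _ _ szq _ _) ?mul0r//; rewrite leqNgt; apply: contra ks => kN.
  by apply/mapP; exists (absz (k + k0%:Z)); rewrite ?mem_iota//; lia.
exists N, s, x; split => //.
- by move=> k l /mapP[i + ->] /mapP[j + ->]; rewrite !mem_iota => iN jN h; have := dvdz_small h; lia.
- have step (k : int) : `|cz (k + 1) - cz k| <= n%:R ^+ m.
    have czP (j : nat) : cz (Posz j) = q`_j by [].
    have czN (j : nat) : cz (Negz j) = 0 by [].
    case: k => [k|[|k]].
    + by rewrite (_ : Posz k + 1 = Posz k.+1) ?czP; [exact: boxpow_diff|lia].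
    + rewrite (_ : Negz 0 + 1 = Posz 0) ?czP ?czN; last by [].
      by rewrite subr0 ger0_norm ?boxpow_ge0//; exact: boxpow_coef0.
    + rewrite (_ : Negz k.+1 + 1 = Negz k) ?czN; last by lia.
      by rewrite subrr normr0 exprn_ge0// ltW.
  have cap (j : nat) (k : int) : `|cz (k + j%:Z) - cz k| <= j%:R * n%:R ^+ m.
    elim: j => [|j IH]; first by rewrite addr0 subrr normr0 mul0r.
    rewrite -natr1 mulrDl mul1r [leRHS]addrC (_ : k + j.+1%:Z = k + j%:Z + 1); last by lia.
    by rewrite -(subrKA (cz (k + j%:Z))) (le_trans (ler_normD _ _))// lerD.
  (* The coefficient at [k0] is at least n^(m+2) / N = n^(m+1) / (m+2), while increments are at most
     n^m. *)
  have scale : n%:R ^+ m / q`_k0 <= m.+2%:R / n%:R.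
    rewrite ler_pdivrMr// mulrAC ler_pdivlMr// -(ler_pM2l nR).
    move: hk0; rewrite /N natrM 2!exprS; set u := n%:R ^+ m; nra.
  have cz0 : cz (0 + k0%:Z) = q`_k0 by rewrite add0r.
  move=> k; rewrite (_ : x k - 1 = ((cz (k + k0%:Z) - cz (0 + k0%:Z)) / q`_k0)%:C); last first.
    by rewrite cz0 mulrBl divff ?gt_eqF// realCD realCN.
  rewrite cabs_real normrM [X in _ * X]ger0_norm; last by rewrite invr_ge0 ltW.
  have h : `|cz (k + k0%:Z) - cz (0 + k0%:Z)| <= `|k|%N%:R * n%:R ^+ m.
    case: (leP 0 k) => kk.
      by have := cap `|k|%N (0 + k0%:Z); rewrite (_ : _ + _ + _ = k + k0%:Z)//; lia.
    by have := cap `|k|%N (k + k0%:Z); rewrite distrC (_ : _ + _ + _ = 0 + k0%:Z)//; lia.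
  rewrite (le_trans (ler_wpM2r _ h)) ?invr_ge0 ?(ltW c0)//.
  by rewrite -mulrA ler_wpM2l.
- move=> t.
  have E z : cabs z = 1 -> cabs (\sum_(k <- s) x k * z ^ k) =
      (cabs (\sum_(i < n) z ^+ i) ^+ m.+2) / q`_k0.
    move=> z1; have zn0 : z != 0 by rewrite -cabs_eq0 z1 oner_eq0.
    have -> : \sum_(k <- s) x k * z ^ k = z ^ (- k0%:Z) * (q`_k0)^-1%:C * \sum_(i < N) (q`_i)%:C * z ^+ i.
      rewrite /s big_map (_ : iota 0 N = index_iota 0 N) ?big_mkord; last by rewrite /index_iota subn0.
      rewrite mulr_sumr; apply: eq_bigr => i _.
      rewrite /x subrK expfzDr// -[cz _]/(q`_i) realCM -[z ^ i%:Z]/(z ^+ i).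
      by rewrite mulrACA mulrC [X in X * _]mulrC.
    have -> : \sum_(i < N) (q`_i)%:C * z ^+ i = (\sum_(i < n) z ^+ i) ^+ m.+2.
      transitivity (map_poly (real_complex R) q).[z].
        rewrite (@horner_coef_wide _ N) ?size_map_poly//; apply: eq_bigr => i _.
        by rewrite coef_map.
      rewrite /q /boxpoly rmorphXn rmorph_sum horner_exp horner_sum; congr (_ ^+ _).
      by apply: eq_bigr => i _; rewrite /= map_polyXn hornerXn.
    by rewrite 2!cabsM cabsXz z1 exp1rz mul1r cabs_real ger0_norm ?invr_ge0 ?(ltW c0)// cabsX mulrC.
  (* The kernel divided by n has modulus u <= 1, so u^(Mp) <= u^2. By Parseval the sum of u^2 over
     the samples is N / n = M. *)
  have up z : cabs z = 1 -> cabs (\sum_(k <- s) x k * z ^ k) `^ p <=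
      N%:R `^ p * (cabs (\sum_(i < n) z ^+ i) / n%:R) ^+ 2.
    move=> z1; rewrite E//; set D := cabs (\sum_(i < n) z ^+ i); pose u := D / n%:R.
    have D0 : 0 <= D by exact: cabs_ge0.
    have u0 : 0 <= u by rewrite divr_ge0.
    have u1 : u <= 1.
      rewrite ler_pdivrMr// mul1r (le_trans (cabs_sum _ _ _))//.
      rewrite (eq_bigr (fun=> 1)) ?sumr_const ?card_ord// => i _.
      by rewrite cabsX z1 expr1n.
    have h : D ^+ m.+2 / q`_k0 <= N%:R * u ^+ m.+2.
      have -> : N%:R * u ^+ m.+2 = D ^+ m.+2 * (N%:R / n%:R ^+ m.+2).
        by rewrite expr_div_n mulrCA.
      rewrite ler_wpM2l ?exprn_ge0// ler_pdivlMr ?exprn_gt0// mulrC ler_pdivrMr//.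
    apply: (@le_trans _ _ ((N%:R * u ^+ m.+2) `^ p)).
      apply: (le_powR p0 _ h); exact: (divr_ge0 (exprn_ge0 _ D0) (ltW c0)).
    rewrite powRM ?exprn_ge0// ler_wpM2l ?powR_ge0// -/u.
    have [->|un0] := eqVneq u 0; first by rewrite !expr0n/= powR0 ?gt_eqF.
    have up0 : 0 < u by rewrite lt_neqAle eq_sym un0.
    rewrite -powR_mulrn// -powRrM -[leRHS]powR_mulrn//.
    by apply: ger_powR => //; rewrite up0.
  apply: (le_trans (ler_sum _ (fun (j : 'I_N) _ => up (cis (t + j%:R / N%:R)) (cabs_cis _)))).
  rewrite -mulr_sumr mulrC ler_wpM2r ?powR_ge0//.
  under eq_bigr => j _ do rewrite expr_div_n.
  rewrite -mulr_suml box_parseval//; last by rewrite leq_pmull.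
  by rewrite ler_pdivrMr ?exprn_gt0// expr2 mulrA /N natrM.
Qed.

End TestFunctions.

(** * Discrete measures attached to a contractive multiplier *)

Section Sampling.
Variables (R : realType) (p : R) (p0 : 0 < p) (p1 : p < 1).

(* The values of phi * f at the translated N-th roots of unity are the weights
   of a measure whose Fourier coefficients are those of phi * f. *)
Lemma sampled_measures (phi : int -> R[i]) : fourier_contractive_Lp p phi ->
  exists2 C : R, 0 <= C & forall n, (0 < n)%N -> exists l : seq (R[i] * R[i]),
  [/\ forall x, x \in l -> cabs x.2 = 1,
      \sum_(x <- l) cabs x.1 `^ p <= C &
      forall k : int, `|k|%N%:R * C < n%:R ->
        cabs (\sum_(x <- l) x.1 * x.2 ^ (- k) - phi k) <= `|k|%N%:R * C / n%:R * cabs (phi k)].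
Proof.
move=> H; have [M hM] := test_functions p0 p1.
exists (M%:R + 1) => [|n n0]; first by rewrite addr_ge0.
have [N [s [x [N0 [us xs] inj near1 cost]]]] := hM n n0.
have NR : 0 < N%:R :> R by rewrite ltr0n.
have nR : 0 < n%:R :> R by rewrite ltr0n.
have hQ := psemi_scalcomb s x p0 p1.
have avg := Lp_avg_le p0 p1 H us xs.
set Q := fun c => _ in hQ avg.
have cQ c := psemi_continuous p0 hQ (c := c).
have cs (c : int -> R[i]) := @continuous_sum _ _ (index_enum 'I_N)
  (fun j t => Q (modul c (t + j%:R / N%:R)))
  (fun j => @continuous_shift _ (fun t => Q (modul c t)) (j%:R / N%:R) (cQ c)).
have roots c : cint (fun t => \sum_(j < N) Q (modul c (t + j%:R / N%:R))) = N%:R * circle_avg Q c.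
  by apply: (cint_roots N0 (cQ c)) => t; rewrite modul_period.
have up1 : N%:R * circle_avg Q (fun=> 1) <= M%:R * N%:R `^ p.
  rewrite -roots -[leRHS]cint_cst; apply: cint_le => [| |t].
  - exact: cs.
  - exact: cst_continuous.
  - apply: le_trans (cost t); apply: ler_sum => j _; rewrite /Q.
    rewrite (eq_bigr (fun k => x k * cis (t + j%:R / N%:R) ^ k)) => [|k _]; first exact: lexx.
    by rewrite /modul mul1r mulrC.
(* The mean over t is at most M N^p, so the bound with M + 1 cannot fail for every t. *)
have [t ht] : exists t, \sum_(j < N) Q (modul phi (t + j%:R / N%:R)) <= (M%:R + 1) * N%:R `^ p.
  apply: contrapT => /forallNP nt.
  have : (M%:R + 1) * N%:R `^ p <= N%:R * circle_avg Q phi.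
    rewrite -roots -[leLHS]cint_cst; apply: cint_le => [| |t].
    - exact: cst_continuous.
    - exact: cs.
    - by apply/ltW; rewrite ltNge; apply/negP/nt.
  have : N%:R * circle_avg Q phi <= M%:R * N%:R `^ p.
    by apply: le_trans up1; rewrite ler_wpM2l// ltW.
  move=> h1 h2; have := le_trans h2 h1; rewrite mulrDl mul1r gerDl leNgt.
  by rewrite powR_gt0.
pose z (j : 'I_N) : R[i] := cis (t + j%:R / N%:R).
(* The weights of discrete Fourier inversion; the corresponding k-th coefficient is phi_k x_k, and
   x_k is close to 1. *)
pose b (j : 'I_N) : R[i] := N%:R^-1%:C * \sum_(k <- s) phi k * x k * z j ^ k.
exists [seq (b j, z j) | j <- index_enum 'I_N]; split.
- by move=> _ /mapP[j _ ->]; rewrite cabs_cis.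
- rewrite big_map /=.
  rewrite (eq_bigr (fun j : 'I_N => N%:R^-1 `^ p * Q (modul phi (t + j%:R / N%:R)))); last first.
    move=> j _; rewrite cabsM cabs_real ger0_norm ?invr_ge0 ?(ltW NR)// powRM ?invr_ge0 ?cabs_ge0 ?(ltW NR)//.
    congr (_ * (cabs _ `^ p)); apply: eq_bigr => k _; rewrite /modul -/(z j).
    by move: (z j ^ k) => w; ring.
  rewrite -mulr_sumr (le_trans (ler_wpM2l (powR_ge0 _ _) ht))//.
  by rewrite mulrCA -powRM ?invr_ge0 ?(ltW NR)// mulVf ?gt_eqF// powR1 mulr1.
- move=> k kn; rewrite big_map /=.
  (* Otherwise x_k = 0, although |x_k - 1| <= |k| M / n < 1. *)
  have ks : k \in s.
    apply: contraTT kn => /xs xk; have := near1 k; rewrite xk sub0r cabsN cabs1.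
    rewrite mulrA ler_pdivlMr// mul1r -leNgt => /le_trans; apply.
    by rewrite ler_wpM2l// lerDl.
  (* No aliasing occurs, since the frequencies in s are pairwise incongruent modulo N. *)
  have -> : \sum_(j < N) b j * z j ^ (- k) = phi k * x k.
    transitivity (\sum_(m <- s) phi m * x m * (if m == k then 1 else 0)).
      rewrite (eq_bigr (fun j : 'I_N => \sum_(m <- s) (phi m * x m) *
          (cis ((m - k)%:~R * t) * (N%:R^-1%:C * cis ((m - k)%:~R * (j%:R / N%:R)))))).
        rewrite exchange_big big_seq [RHS]big_seq; apply: eq_bigr => m ms /=.
        rewrite -mulr_sumr -mulr_sumr -mulr_sumr root_sum//; congr (_ * _).
        have [->|mk] := eqVneq m k.
          by rewrite subrr dvdz0 mul_invNC// mulr1 mul0r cis0.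
        rewrite ifF ?mulr0//; apply/negP => h; have := inj _ _ ms ks h.
        by move=> e; rewrite e eqxx in mk.
      move=> j _; rewrite /b mulrAC mulr_sumr; apply: eq_bigr => m _.
      have -> : z j ^ m = cis (m%:~R * (t + j%:R / N%:R)) by rewrite /z cisX.
      have -> : z j ^ (- k) = cis ((- k)%:~R * (t + j%:R / N%:R)) by rewrite /z cisX.
      have -> : cis ((m - k)%:~R * t) * (N%:R^-1%:C * cis ((m - k)%:~R * (j%:R / N%:R))) =
          N%:R^-1%:C * (cis (m%:~R * (t + j%:R / N%:R)) * cis ((- k)%:~R * (t + j%:R / N%:R))).
        rewrite mulrCA -!cisD; congr (_ * cis _); rewrite intrB intrN; ring.
      move: (cis (m%:~R * _)) (cis ((- k)%:~R * _)) => u v; ring.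
    by rewrite (bigD1_seq k)//= eqxx mulr1 big1 ?addr0// => m /negPf ->; rewrite mulr0.
  rewrite -[X in _ - X]mulr1 -mulrBr cabsM mulrC ler_wpM2r ?cabs_ge0//.
  rewrite (le_trans (near1 k))// mulrA ler_wpM2r ?invr_ge0 ?(ltW nR)//.
  by rewrite ler_wpM2l// lerDl.
Qed.

End Sampling.

(** * Limits of bounded sequences along an ultrafilter *)

Section UltraLimit.
Variables (R : realType) (U : set_system nat).
Hypothesis UU : UltraFilter U.

(** One ultrafilter provides limits for all bounded sequences simultaneously, in place of a diagonal
    extraction over the countably many masses and locations. *)
Lemma ultra_limR (z : nat -> R) (M : R) : (forall n, `|z n| <= M) ->
  exists l : R, forall e, 0 < e -> U [set n | `|z n - l| <= e].
Proof.
move=> zM; have PU : ProperFilter (z @ U) by exact: fmap_proper_filter.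
have zI : (z @ U) `[- M, M]%classic.
  apply: (@filterS _ U _ setT) => [n _|]; last exact: filterT.
  by rewrite /= in_itv/=; have := zM n; rewrite ler_norml.
have [l [_ cl]] := segment_compact PU zI.
(* If the set is not in [U], its complement is, which contradicts that l is a cluster point. *)
exists l => e e0; have [//|nU] := in_ultra_setVsetC [set n | `|z n - l| <= e] UU.
have [||y [yA yB]] := cl [set y | ~ `|y - l| <= e] (ball l e).
- exact: nU.
- exact: nbhsx_ballx.
by exfalso; apply: yA; move: yB; rewrite /ball/= distrC => /ltW.
Qed.

Lemma ultra_limC (z : nat -> R[i]) (M : R) : (forall n, cabs (z n) <= M) ->
  exists l : R[i], forall e : R, 0 < e -> U [set n | cabs (z n - l) <= e].
Proof.
move=> zM.
have [a ha] := @ultra_limR (fun n => complex.Re (z n)) M (fun n => le_trans (cabs_Re _) (zM n)).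
have [b hb] := @ultra_limR (fun n => complex.Im (z n)) M (fun n => le_trans (cabs_Im _) (zM n)).
exists (a +i* b) => e e0; have e2 : 0 < e / 2 by rewrite divr_gt0.
apply: filterS (filterI (ha _ e2) (hb _ e2)) => n /= [h1 h2].
rewrite (le_trans (cabs_ReIm _))//; case: (z n) h1 h2 => x y /= h1 h2.
by rewrite [leRHS](splitr e) lerD.
Qed.

Lemma ultra_all (T : nat) (P : nat -> set nat) : (forall i, (i < T)%N -> U (P i)) ->
  U [set n | forall i, (i < T)%N -> P i n].
Proof.
elim: T => [|T IH] h; first by apply: (@filterS _ U _ setT) => //; exact: filterT.
apply: filterS (filterI (IH (fun i iT => h i (ltnW iT))) (h T (ltnSn T))) => n /= [h1 h2] i.
by rewrite ltnS leq_eqVlt => /orP[/eqP ->|/h1].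
Qed.

End UltraLimit.

Lemma unit_pow_lip (R : realType) (u v : R[i]) (k : int) : cabs u = 1 -> cabs v = 1 ->
  cabs (u ^ k - v ^ k) <= `|k|%N%:R * cabs (u - v).
Proof.
move=> u1 v1.
have nat_ (x y : R[i]) n : cabs x = 1 -> cabs y = 1 -> cabs (x ^+ n - y ^+ n) <= n%:R * cabs (x - y).
  move=> x1 y1; elim: n => [|n IH]; first by rewrite subrr cabs0 mul0r.
  rewrite !exprS (_ : _ - _ = x * (x ^+ n - y ^+ n) + (x - y) * y ^+ n); last by ring.
  rewrite (le_trans (cabsD _ _))// !cabsM cabsX x1 y1 expr1n mul1r mulr1.
  by rewrite -natr1 mulrDl mul1r lerD.
have inv_ : cabs (u^-1 - v^-1) = cabs (u - v).
  have u0 : u != 0 by rewrite -cabs_eq0 u1 oner_eq0.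
  have v0 : v != 0 by rewrite -cabs_eq0 v1 oner_eq0.
  rewrite (_ : _ - _ = - (u - v) * (u^-1 * v^-1)); last by field; rewrite u0 v0.
  by rewrite !cabsM cabsN !cabsV u1 v1 invr1 !mulr1.
case: k => n; first exact: nat_.
have neg (w : R[i]) : w ^ Negz n = w^-1 ^+ n.+1 by rewrite exprVn.
rewrite !neg -inv_.
by apply: nat_; rewrite cabsV ?u1 ?v1 invr1.
Qed.

Lemma cabsD4 (R : realType) (a b c d : R[i]) (e : R) : cabs a <= e / 4 -> cabs b <= e / 4 ->
  cabs c <= e / 4 -> cabs d <= e / 4 -> cabs (a + b + c + d) <= e.
Proof.
move=> ha hb hc hd; rewrite (_ : e = e / 4 + e / 4 + e / 4 + e / 4); last by field.
by do 3 (rewrite (le_trans (cabsD _ _))// lerD//).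
Qed.

Section SeqSums.
Variables (R : realType) (T : Type) (d : T).

Lemma sum_nth_le (F : T -> R) (s : seq T) m : (forall x, 0 <= F x) -> F d = 0 ->
  \sum_(i < m) F (nth d s i) <= \sum_(x <- s) F x.
Proof.
move=> F0 Fd; elim: s m => [|x s IH] [|m].
- by rewrite big_ord0 big_nil.
- by rewrite big_nil big1// => i _; rewrite nth_nil.
- by rewrite big_ord0; apply: sumr_ge0.
- by rewrite big_ord_recl big_cons lerD2l.
Qed.

End SeqSums.

(** * Compactness of discrete measures with bounded p-sums *)

Section AtomicLimit.
Variables (R : realType) (p : R) (p0 : 0 < p) (p1 : p < 1).

Lemma nsum_nat_le (F : nat -> R) (C : R) : (forall i, 0 <= F i) ->
  (forall m, \sum_(i < m) F i <= C) -> (nsum F <= C%:E)%E.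
Proof.
move=> F0 FC; apply: nsum_le => s us; rewrite lee_fin.
pose m := (\max_(i <- s) i).+1.
have sm i : i \in s -> (i < m)%N by move=> is_; rewrite ltnS (big_rem i)//= leq_maxl.
apply: le_trans (FC m); rewrite -(big_mkord xpredT F) [leRHS](bigID (mem s))/=.
have -> : \sum_(0 <= i < m | i \in s) F i = \sum_(i <- s) F i.
  rewrite -big_filter; apply: perm_big; apply: uniq_perm; rewrite ?filter_uniq ?iota_uniq// => i.
  by rewrite mem_filter mem_index_iota /=; apply/andP/idP => [[]//|is_]; rewrite sm.
by rewrite lerDl sumr_ge0.
Qed.

(** The last clause is what the decreasing order gives: the first i + 1 terms of the p-sum are at
    least the last of them. Unlike the order, it is kept as the working hypothesis because it passes
    to limits term by term. *)
Definition decaying (C : R) (b : nat -> R) := [/\ forall i, 0 <= b i,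
  (nsum (fun i => b i `^ p)%R <= C%:E)%E & forall i, i.+1%:R * b i `^ p <= C].

(** With q = (1-p)/p one has b = (b^p)^q b^p. Beyond C / d the decay gives b^p <= d, so the tail is
    at most d^q C, uniformly in b; q > 0 is where p < 1 enters. *)
Lemma decaying_tail C (e : R) : 0 <= C -> 0 < e -> exists T, forall b, decaying C b ->
  (nsum (fun i => if i \in iota 0 T then 0 else b i)%R <= e%:E)%E.
Proof.
move=> C0 e0; pose q := (1 - p) / p.
have q0 : 0 < q by rewrite divr_gt0// subr_gt0.
have [d d0 dC] := small_pow q0 C0 e0.
exists (Num.truncn (C / d)) => b [b0 bC bdec].
apply: (@le_trans _ _ (nsum (fun i => d `^ q * b i `^ p)%R)).
  apply: le_nsum => i; case: ifPn => [_|]; first by rewrite mulr_ge0 ?powR_ge0.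
  rewrite mem_iota add0n /= -leqNgt => Ti.
  have [->|bn0] := eqVneq (b i) 0; first by rewrite mulr_ge0 ?powR_ge0.
  have bp : b i `^ p <= d.
    have i0 : 0 < i.+1%:R :> R by rewrite ltr0n.
    rewrite -(ler_pM2l i0) (le_trans (bdec i))// -ler_pdivrMr//.
    by rewrite (le_trans (ltW (truncnS_gt _)))// ler_nat ltnS.
  have bE : b i = (b i `^ p) `^ q * b i `^ p.
    rewrite -powRrM -powRD; last by rewrite bn0 implybT.
    by rewrite (_ : p * q + p = 1) ?powRr1// /q mulrCA mulfV ?gt_eqF// mulr1 subrK.
  rewrite [leLHS]bE ler_wpM2r ?powR_ge0//; exact: (le_powR q0 (powR_ge0 _ _)).
rewrite nsumZ ?powR_ge0//; last by move=> i; exact: powR_ge0.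
apply: (@le_trans _ _ ((d `^ q)%:E * C%:E)%E); last by rewrite -EFinM lee_fin.
by apply: lee_wpmul2l; rewrite ?lee_fin ?powR_ge0.
Qed.

Lemma atomic_limit (phi : int -> R[i]) (C : R) (l : nat -> seq (R[i] * R[i])) : 0 <= C ->
  (forall n x, x \in l n -> cabs x.2 = 1) ->
  (forall n, \sum_(x <- l n) cabs x.1 `^ p <= C) ->
  (forall k (e : R), 0 < e -> exists n0, forall n, (n0 <= n)%N ->
     cabs (\sum_(x <- l n) x.1 * x.2 ^ (- k) - phi k) <= e) ->
  exists beta gamma : nat -> R[i], [/\ forall m, cabs (gamma m) = 1,
    (nsum (fun m => cabs (beta m) `^ p)%R <= C%:E)%E &
    forall k, phi k = csum (fun m => beta m * gamma m ^ (- k))].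
Proof.
move=> C0 l1 lC lphi.
(* Masses in decreasing order; the list is continued by atoms of mass 0 at the point 1, so that
   every index has a unimodular location. *)
pose r (x y : R[i] * R[i]) := cabs y.1 <= cabs x.1.
pose ls n := sort r (l n); pose d0 : R[i] * R[i] := (0, 1).
pose b n m := (nth d0 (ls n) m).1; pose g n m := (nth d0 (ls n) m).2.
have g1 n m : cabs (g n m) = 1.
  rewrite /g; have [mn|mn] := ltnP m (size (ls n)); last by rewrite nth_default ?cabs1.
  by apply: (l1 n); rewrite -(mem_sort r) mem_nth.
have bF0 n m : 0 <= cabs (b n m) `^ p by exact: powR_ge0.
have bsum n m : \sum_(i < m) cabs (b n i) `^ p <= C.
  apply: le_trans (lC n); rewrite -(perm_big _ (permEl (perm_sort r (l n)))).
  apply: (sum_nth_le (d := d0) (F := fun x => cabs x.1 `^ p)) => [x|]; first exact: powR_ge0.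
  by rewrite cabs0 powR0 ?gt_eqF.
have bdec n i j : (i <= j)%N -> cabs (b n j) <= cabs (b n i).
  move=> ij; rewrite /b; have [jn|jn] := ltnP j (size (ls n)); last first.
    by rewrite nth_default// cabs0 cabs_ge0.
  have rt : transitive r by move=> y x z; rewrite /r => h1 h2; exact: le_trans h2 h1.
  have rr : reflexive r by move=> x; rewrite /r.
  have := sorted_leq_nth rt rr d0 (sort_sorted (_ : total r) (l n)); apply => //.
  - by move=> x y; rewrite /r; case: (leP (cabs y.1) (cabs x.1)) => // /ltW.
  - by rewrite inE (leq_ltn_trans ij).
have bdecC n i : i.+1%:R * cabs (b n i) `^ p <= C.
  apply: le_trans (bsum n i.+1); rewrite mulr_natl -[X in _ *+ X](card_ord i.+1) -sumr_const.
  apply: ler_sum => j _; apply: (le_powR p0 (cabs_ge0 _)).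
  by apply: bdec; rewrite -ltnS ltn_ord.
have bM n m : cabs (b n m) `^ p <= C.
  apply: le_trans (bdecC n m); rewrite -[leLHS]mul1r ler_wpM2r//.
  by rewrite ler1n.
have bB n m : cabs (b n m) <= C `^ p^-1.
  rewrite -[leLHS](powRr1 (cabs_ge0 _)) -(mulfV (lt0r_neq0 p0)) powRrM.
  by apply: le_powR; rewrite ?invr_gt0.
(* [U] contains all final segments of the integers, so limits along it respect statements that hold
   eventually. *)
have [U [UU Uoo]] := ultraFilterLemma (eventually_filter).
have Un n0 : U [set n | (n0 <= n)%N].
  by apply: Uoo; exists n0.
have /choice[beta hbeta] m := ultra_limC UU (z := fun n => b n m) (fun n => bB n m).
have gB n m : cabs (g n m) <= 1 by rewrite g1.
have /choice[gamma hgamma] m := ultra_limC UU (z := fun n => g n m) (fun n => gB n m).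
have PU : ProperFilter U by exact: ultra_proper.
have dist (x y : R[i]) : cabs x <= cabs y + cabs (y - x).
  by rewrite -(cabsN (y - x)) opprB (le_trans _ (cabsD _ _))// subrKC.
have gam1 m : cabs (gamma m) = 1.
  apply/eqP; rewrite eq_le; apply/andP; split; apply/ler_addgt0Pr => e e0;
    have [n /= hn] := filter_ex (hgamma m e e0).
    by rewrite (le_trans (dist _ (g n m)))// g1 lerD2l.
  by rewrite -(g1 n m) (le_trans (dist _ (gamma m)))// lerD2l -cabsN opprB.
have powdist (x y : R[i]) d : cabs (y - x) <= d -> cabs x `^ p <= cabs y `^ p + d `^ p.
  move=> yx; have d0' : 0 <= d := le_trans (cabs_ge0 _) yx.
  rewrite (le_trans _ (powRD_le p0 p1 (cabs_ge0 _) d0'))//.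
  by rewrite le_powR ?cabs_ge0// (le_trans (dist _ y))// lerD2l.
have betasum m : \sum_(i < m) cabs (beta i) `^ p <= C.
  apply/ler_addgt0Pr => e e0; have [d d_gt0 dm] := small_pow p0 (ler0n R m) e0.
  have [n /= hn] := filter_ex (ultra_all UU (T := m) (fun i _ => hbeta i d d_gt0)).
  apply: (@le_trans _ _ (\sum_(i < m) (cabs (b n i) `^ p + d `^ p))).
    by apply: ler_sum => i _; apply: powdist; exact: hn.
  by rewrite big_split/= lerD ?bsum// sumr_const card_ord -mulr_natr.
have betadec i : i.+1%:R * cabs (beta i) `^ p <= C.
  apply/ler_addgt0Pr => e e0; have [d d_gt0 dm] := small_pow p0 (ler0n R i.+1) e0.
  have [n /= hn] := filter_ex (hbeta i d d_gt0).
  rewrite (le_trans (ler_wpM2l _ (powdist _ _ _ hn)))// mulrDr lerD//.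
  by rewrite mulrC.
have decb n : decaying C (fun i => cabs (b n i)).
  split; [by move=> i; exact: cabs_ge0| |exact: bdecC].
  by apply: nsum_nat_le; [move=> i; exact: powR_ge0|exact: bsum].
have decbeta : decaying C (fun i => cabs (beta i)).
  split; [by move=> i; exact: cabs_ge0| |exact: betadec].
  by apply: nsum_nat_le; [move=> i; exact: powR_ge0|exact: betasum].
exists beta, gamma; split => //; first by case: decbeta.
have as_ (x : nat -> R[i]) : decaying C (fun i => cabs (x i)) -> asum x.
  move=> [x0 xC _]; apply: (nsum_of_pow p0 p1) => //.
  by rewrite (le_lt_trans xC)// ltry.
have asz (x y : nat -> R[i]) k : (forall m, cabs (y m) = 1) -> asum x -> asum (fun m => x m * y m ^ k).
  by move=> y1 ax; apply: (asum_le _ ax) => m; rewrite cabsM cabsXz y1 exp1rz mulr1.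
move=> k; apply/eqP; rewrite -subr_eq0 -cabs_eq0 eq_le cabs_ge0 andbT.
apply/ler_addgt0Pr => e e0; rewrite add0r.
have e4 : 0 < e / 4 by rewrite divr_gt0.
have [T hT] := decaying_tail C0 e4.
have [n0 hn0] := lphi k _ e4.
have T1 : 0 < T.+1%:R :> R by rewrite ltr0n.
(* The T leading terms share an error e/4; dividing by T + 1 avoids the case T = 0. The constant [L]
   below collects the errors on the mass and on the location. *)
have term i : U [set n | cabs (b n i * g n i ^ (- k) - beta i * gamma i ^ (- k)) <= e / 4 / T.+1%:R].
  pose L := 1 + cabs (beta i) * `|k|%N%:R.
  have L0 : 0 < L by rewrite ltr_pwDl// mulr_ge0 ?cabs_ge0.
  have eta0 : 0 < e / 4 / T.+1%:R / L by rewrite !divr_gt0.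
  apply: filterS (filterI (hbeta i _ eta0) (hgamma i _ eta0)) => n /= [h1 h2].
  rewrite (_ : _ - _ = (b n i - beta i) * g n i ^ (- k) + beta i * (g n i ^ (- k) - gamma i ^ (- k))); last by ring.
  rewrite (le_trans (cabsD _ _))// !cabsM cabsXz g1 exp1rz mulr1.
  have h3 := unit_pow_lip (- k) (g1 n i) (gam1 i); rewrite abszN in h3.
  have h4 : cabs (g n i ^ (- k) - gamma i ^ (- k)) <= `|k|%N%:R * (e / 4 / T.+1%:R / L).
    by rewrite (le_trans h3)// ler_wpM2l.
  rewrite (le_trans (lerD h1 (ler_wpM2l (cabs_ge0 _) h4)))//.
  rewrite (_ : _ + _ = e / 4 / T.+1%:R / L * L); last by rewrite /L; ring.
  by rewrite divfK// gt_eqF.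
have [n /= [hn1 hn2]] := filter_ex (filterI (ultra_all UU (T := T) (fun i _ => term i)) (Un n0)).
pose S := csum (fun m => b n m * g n m ^ (- k)); pose S' := csum (fun m => beta m * gamma m ^ (- k)).
have SE : \sum_(x <- l n) x.1 * x.2 ^ (- k) = S.
  rewrite -(perm_big _ (permEl (perm_sort r (l n)))) -/(ls n) (big_nth d0) /S.
  rewrite (csum_supp (iota_uniq 0 (size (ls n)))) => [|m]; first by rewrite /index_iota subn0.
  by rewrite mem_iota add0n -leqNgt => mn; rewrite /b nth_default//= mul0r.
have tailE (x y : nat -> R[i]) : (forall m, cabs (y m) = 1) -> decaying C (fun i => cabs (x i)) ->
    cabs (csum (fun m => x m * y m ^ (- k)) - \sum_(m <- iota 0 T) x m * y m ^ (- k)) <= e / 4.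
  move=> y1 dx; have ax := asz x y (- k) y1 (as_ _ dx).
  rewrite (csum_restrict ax (iota_uniq 0 T)) addrC addKr -lee_fin.
  have at_ : asum (fun i => if i \in iota 0 T then 0 else x i * y i ^ (- k)).
    by apply: (asum_le _ ax) => i; case: ifP => _; rewrite ?cabs0 ?cabs_ge0.
  rewrite (le_trans (cabs_csum at_))// (le_trans _ (hT _ dx))//; apply: le_nsum => i.
  by case: ifP => _; rewrite ?cabs0// cabsM cabsXz y1 exp1rz mulr1.
have h1 := hn0 n hn2; rewrite SE in h1.
have h2 := tailE (b n) (g n) (g1 n) (decb n); have h3 := tailE beta gamma gam1 decbeta.
rewrite -/S in h2; rewrite -/S' in h3 *.
set s1 := \sum_(m <- _) _ in h2; set s2 := \sum_(m <- _) _ in h3.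
have h4 : cabs (s1 - s2) <= e / 4.
  rewrite /s1 /s2 -sumrB (le_trans (cabs_sum _ _ _))//.
  apply: (@le_trans _ _ (\sum_(m <- iota 0 T) e / 4 / T.+1%:R)).
    rewrite big_seq [leRHS]big_seq; apply: ler_sum => i; rewrite mem_iota add0n => iT.
    exact: hn1.
  rewrite big_const_seq count_predT size_iota iter_addr_0.
  have -> : e / 4 / T.+1%:R *+ T = e / 4 * (T%:R / T.+1%:R) by rewrite -[LHS]mulr_natr mulrAC -[LHS]mulrA.
  by rewrite ler_piMr ?(ltW e4)// ler_pdivrMr// mul1r ler_nat.
(* Four errors: the given approximation of phi, the tail of the approximant, the leading terms, the
   tail of the limit. *)
rewrite (_ : phi k - S' = - (S - phi k) + (S - s1) + (s1 - s2) + - (S' - s2)); last by ring.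
apply: (cabsD4 _ h2 h4 _); rewrite cabsN; [exact: h1|exact: h3].
Qed.

(* Atoms sharing a location are merged. *)
Lemma atomic_of_seq (phi : int -> R[i]) (C : R) (beta gamma : nat -> R[i]) :
  (forall m, cabs (gamma m) = 1) -> (nsum (fun m => cabs (beta m) `^ p)%R <= C%:E)%E ->
  (forall k, phi k = csum (fun m => beta m * gamma m ^ (- k))) ->
  exists a : circle R -> R[i], (nsum (fun g => cabs (a g) `^ p)%R <= C%:E)%E /\
    forall k, phi k = fourier_atomic a k.
Proof.
move=> gam1 bC phiE.
have ng m : `|gamma m| == 1 by rewrite -cabsE gam1.
pose G m : circle R := exist _ (gamma m) (ng m).
have boo : (nsum (fun m => cabs (beta m) `^ p)%R < +oo)%E by rewrite (le_lt_trans bC)// ltry.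
have ab : asum beta by apply: (nsum_of_pow p0 p1) => // m; exact: cabs_ge0.
pose f (g : circle R) m : R[i] := if g == G m then beta m else 0.
pose a g := csum (f g).
have af g : asum (f g).
  by apply: (asum_le _ ab) => m; rewrite /f; case: ifP => _; rewrite ?cabs0 ?cabs_ge0.
have ap g : ((cabs (a g) `^ p)%:E <= nsum (fun m => cabs (f g m) `^ p)%R)%E.
  have foo : (nsum (fun m => cabs (f g m) `^ p)%R < +oo)%E.
    apply: le_lt_trans boo; apply: le_nsum => m; rewrite /f; case: ifP => // _.
    by rewrite cabs0 powR0 ?gt_eqF ?powR_ge0.
  have f0 m : 0 <= cabs (f g m) `^ p by exact: powR_ge0.
  rewrite (nsum_fin f0 foo) lee_fin -[leRHS]mulr1.
  (* Countable p-subadditivity of the modulus, as the instance with trivial characters and Q c =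
     |c_0|^p. *)
  have := @psemi_atomic _ _ p0 p1 _ [:: 0] _ _ (fun _ _ => 1) (f g) (fine (nsum (fun m => cabs (f g m) `^ p)%R)) 1
    (psemi_scalcomb [:: 0] (fun=> 1) p0 p1).
  rewrite !big_seq1 !mulr1 cabs1 powR1.
  rewrite (eq_csum (g := f g)) => [|m]; last by rewrite mulr1.
  by apply => //; rewrite -nsum_fin.
exists a; split.
  apply: le_trans bC.
  apply: (@le_trans _ _ (\esum_(g in [set: circle R]) nsum (fun m => cabs (f g m) `^ p)%R)).
    by apply: le_esum => g _; exact: ap.
  rewrite (nsum_exchange (f := fun g m => cabs (f g m) `^ p)) => [|g m]; last exact: powR_ge0.
  rewrite le_eqVlt; apply/orP; left; apply/eqP; apply: eq_esum => m _.
  rewrite -(nsum1 (G m) (powR_ge0 (cabs (beta m)) p)); apply: eq_nsum => g.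
  by rewrite /f; case: ifP => // _; rewrite cabs0 powR0 ?gt_eqF.
move=> k; rewrite phiE /fourier_atomic.
pose h (m : nat) (g : circle R) : R[i] := if g == G m then beta m * gamma m ^ (- k) else 0.
transitivity (csum (fun m => csum (h m))).
  by apply: eq_csum => m; rewrite /h csum1.
rewrite (csum_exchange (f := h)); last first.
  rewrite /asum -(nsum_pair (f := fun m g => cabs (h m g))); last by move=> *; exact: cabs_ge0.
  apply: le_lt_trans ab; rewrite /nsum; apply: le_esum => m _.
  rewrite -[leRHS](nsum1 (G m) (cabs_ge0 (beta m))); apply: le_nsum => g.
  by rewrite /h; case: ifP => _; rewrite ?cabs0// cabsM cabsXz gam1 exp1rz mulr1.
apply: eq_csum => g; rewrite mulrC -csumZ//; apply: eq_csum => m.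
by rewrite /h /f; case: eqP => [->|_]; rewrite ?mulr0// mulrC.
Qed.

Lemma Lp_atomic (phi : int -> R[i]) :
  fourier_contractive_Lp p phi -> atomic_fourier_transform p phi.
Proof.
move=> H; have [C C0 hC] := sampled_measures p0 p1 H.
have /choice[l hl] n : exists l : seq (R[i] * R[i]),
  [/\ forall x, x \in l -> cabs x.2 = 1,
      \sum_(x <- l) cabs x.1 `^ p <= C &
      forall k : int, `|k|%N%:R * C < n.+1%:R ->
        cabs (\sum_(x <- l) x.1 * x.2 ^ (- k) - phi k) <= `|k|%N%:R * C / n.+1%:R * cabs (phi k)].
  exact: hC.
have [|||beta [gamma [gam1 bC phiE]]] := @atomic_limit phi C l C0.
- by move=> n x; have [h _ _] := hl n; exact: h.
- by move=> n; have [_ h _] := hl n.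
(* [D] dominates both |k| C, required by the sampling estimate, and |k| C |phi_k| / e, which makes
   its error at most e. *)
- move=> k e e0; pose D := `|k|%N%:R * C * (1 + cabs (phi k) / e).
  exists (Num.truncn D) => n Dn.
  have n0 : 0 < n.+1%:R :> R by rewrite ltr0n.
  have kC0 : 0 <= `|k|%N%:R * C by rewrite mulr_ge0.
  have pe0 : 0 <= cabs (phi k) / e by rewrite divr_ge0 ?cabs_ge0 ?(ltW e0).
  have Dn1 : D < n.+1%:R.
    by rewrite (lt_le_trans (truncnS_gt _))// ler_nat ltnS.
  have [_ _ h] := hl n; apply: (le_trans (h k _)).
    by rewrite (le_lt_trans _ Dn1)// /D ler_peMr// lerDl.
  rewrite mulrAC ler_pdivrMr// -ler_pdivrMl// mulrC -mulrA (le_trans _ (ltW Dn1))// /D.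
  by rewrite ler_wpM2l// ler_wpDl.
(* The p-sum is known to be at most C only; its finiteness is what the sharpening to 1 takes as
   input. *)
have [a [aC aE]] := atomic_of_seq gam1 bC phiE.
exists a; split => //; apply: (atomic_mass_le1 p0 p1 H aE).
by rewrite (le_lt_trans aC)// ltry.
Qed.

End AtomicLimit.

Theorem theorem1p6 (R : realType) (p : R) (phi : int -> R[i])
    (hp0 : 0 < p) (hp1 : p < 1) :
  [<-> fourier_contractive_Lp p phi;
       fourier_contractive_LpSp p phi;
       schur_contractive_Sp p (fun r c => phi (r - c));
       schur_contractive_SpSp p (fun r c => phi (r - c));
       atomic_fourier_transform p phi].
Proof.
have h04 := @Lp_atomic R p hp0 hp1 phi.
have h10 := @LpSp_Lp R p hp0 hp1 phi.
have h20 := @schur_Sp_Lp R p hp0 hp1 phi.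
have h30 := @schur_SpSp_Lp R p hp0 hp1 phi.
have h40 := @atomic_Lp R p hp0 hp1 phi.
have h41 := @atomic_LpSp R p hp0 hp1 phi.
have h42 := @atomic_Sp R p hp0 hp1 phi.
have h43 := @atomic_SpSp R p hp0 hp1 phi.
(* Each arrow of the cycle goes back to contractivity on L^p, from there to the atomic measure, and
   then forward to its target. *)
by tfae; [move=> /h04/h41|move=> /h10/h04/h42|move=> /h20/h04/h43|move=> /h30/h04|].
Qed.
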